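(* Let $t>0$, let $P_t(x,y):=xy(x-ty)(x-y/t)$, and let $\beta=\beta(t)\in(0,1)$ be defined by $\frac{t+i}{t-i}=e^{2\pi i\beta}$. Suppose there is a constant $C>0$ such that $$\left|\beta-\frac{n}{m}\right|\geq\frac{C}{m^2}\quad\text{for all } n,m\in\mathbb Z,\ m\ne0.$$ Let $0<R\le\infty$ and $c\in A(B_R)$. Then there exists $0<r\le R$ such that for every $f,g\in A(B_R)$ the Goursat problem $$\Delta^2u+cu=f,\qquad P_t\mid(u-g)$$ has a unique solution $u\in A(B_r)$.
   Context: $\Delta$ is the Laplace operator on $\mathbb R^2$. $B_R=\{(x,y): x^2+y^2<R^2\}$ and $A(B_R)$ denotes the algebra of all $C^\infty$ functions $f:B_R\to\mathbb C$ such that for every compact $K\subset B_R$ the homogeneous Taylor series $\sum_m f_m$ of $f$ at $0$ converges absolutely and uniformly to $f$ on $K$. $P_t\mid(u-g)$ means $u-g=P_tq$ with $q$ real-analytic near $0$ (here $q\in A(B_r)$). *)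

(* Defs.v *)
From Stdlib Require Import Reals List ZArith.
From Coquelicot Require Import Coquelicot.
Open Scope R_scope.

Definition pt := (R * R)%type.

Definition disk (Rr : Rbar) (p : pt) : Prop :=
  Rbar_lt (Finite (sqrt (fst p ^ 2 + snd p ^ 2))) Rr.

(* Partial derivatives of a complex-valued function on R^2
   (componentwise on real and imaginary parts); b = true: d/dx, false: d/dy. *)
Definition slice (b : bool) (p : pt) (s : R) : pt :=
  if b then (s, snd p) else (fst p, s).
Definition coord (b : bool) (p : pt) : R := if b then fst p else snd p.

Definition dpart (b : bool) (f : pt -> C) (p : pt) : C :=
  (Derive (fun s => fst (f (slice b p s))) (coord b p),
   Derive (fun s => snd (f (slice b p s))) (coord b p)).

Definition ex_dpart (b : bool) (f : pt -> C) (p : pt) : Prop :=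
  ex_derive (fun s => fst (f (slice b p s))) (coord b p) /\
  ex_derive (fun s => snd (f (slice b p s))) (coord b p).

Fixpoint iter_d (w : list bool) (f : pt -> C) : pt -> C :=
  match w with
  | nil => f
  | b :: w' => dpart b (iter_d w' f)
  end.

Definition smooth_on (U : pt -> Prop) (f : pt -> C) : Prop :=
  forall w : list bool,
    (forall p, U p -> continuous (iter_d w f) p) /\
    (forall b p, U p -> ex_dpart b (iter_d w f) p).

Definition compact_set (K : pt -> Prop) : Prop :=
  forall (I : Type) (U : I -> pt -> Prop),
    (forall i, open (U i)) ->
    (forall p, K p -> exists i, U i p) ->
    exists l : list I, forall p, K p -> exists i, In i l /\ U i p.

Definition dxy (k j : nat) (f : pt -> C) : pt -> C :=
  iter_d (repeat true k ++ repeat false j) f.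

Definition taylor_hom (f : pt -> C) (m : nat) (p : pt) : C :=
  sum_n (fun k =>
    Cmult (RtoC (fst p ^ k * snd p ^ (m - k) / (INR (fact k) * INR (fact (m - k)))))
          (dxy k (m - k) f (0, 0))) m.

Definition inA (Rr : Rbar) (f : pt -> C) : Prop :=
  smooth_on (disk Rr) f /\
  forall K : pt -> Prop, compact_set K -> (forall p, K p -> disk Rr p) ->
    (* absolute uniform convergence: uniform Cauchy criterion for sum |f_m| *)
    (forall eps, 0 < eps -> exists N : nat, forall n p, (N <= n)%nat -> K p ->
        sum_n_m (fun m => Cmod (taylor_hom f m p)) N n < eps) /\
    (forall eps, 0 < eps -> exists N : nat, forall n p, (N <= n)%nat -> K p ->
        Cmod (Cminus (f p) (sum_n (fun m => taylor_hom f m p) n)) < eps).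

Definition lap (u : pt -> C) (p : pt) : C :=
  Cplus (dpart true (dpart true u) p) (dpart false (dpart false u) p).

Definition bilap (u : pt -> C) : pt -> C := lap (lap u).

Definition Pt (t : R) (p : pt) : R :=
  fst p * snd p * (fst p - t * snd p) * (fst p - snd p / t).

Definition goursat (t : R) (r : Rbar) (c f g u : pt -> C) : Prop :=
  (forall p, disk r p -> Cplus (bilap u p) (Cmult (c p) (u p)) = f p) /\
  exists q, inA r q /\
    forall p, disk r p -> Cminus (u p) (g p) = Cmult (RtoC (Pt t p)) (q p).

(* Main.v *)
(** Write homogeneous polynomials of degree [m] as [sum a_k z^k zbar^(m-k)] and
    measure them by [sum |a_k|], a submultiplicative norm; by a discrete Fourier
    transform, [A(B_r)] consists exactly of the sums of homogeneous parts [f_m]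
    whose norms satisfy [|f_m| rho^m] bounded for every [rho < r].

    In degree [N = m + 4], the equation [Delta^2 u = h] has a particular solution
    of norm at most [|h| / N].  A biharmonic correction, a combination of
    [cos, sin (N psi)] and [cos, sin ((N-2) psi)] with [psi = theta - PI/4], makes
    it vanish on the four lines of [P_t], which lie at [psi = +-PI/4] and
    [psi = +-alpha], [alpha = PI/4 - PI beta].  The even and odd 2x2 determinants
    of this interpolation factor into sines and cosines of [k alpha] with [k]
    even, so that the Diophantine condition bounds them below by [kappa / N].
    Hence the homogeneous problem is uniquely solvable with an inverse bounded
    uniformly in [m].

    With [w = u - g], the full problem becomes the recursion
    [w_(m+4) = S_m (F_m - sum_j c_j w_(m-j))], [F = f - Delta^2 g - c g]; as the
    degree rises by 4, it converges on every disk with [K r^4 sum |c_j| r^j <= 1/2],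
    a condition on [c] alone.  Dividing [w_(m+4)] by [P_t] only costs a factor
    polynomial in [m], hence no radius.  Uniqueness follows degree by degree. *)

Require Import Defs.
From Stdlib Require Import Reals List ZArith Lra Lia Classical.
From Stdlib Require Import FunctionalExtensionality ClassicalEpsilon.
From Coquelicot Require Import Coquelicot.
Open Scope R_scope.

(** * Finite sums *)

(** Exchanging x and y permutes the four lines of [P_t]. In the angle [psi], centred at the diagonal
    for this reason, the exchange is [psi -> - psi], so the four interpolation conditions split into
    an even and an odd 2x2 system. The divisors that arise are factors of sin (4 l alpha) = 2 sin (2
    l alpha) cos (2 l alpha), and 4 l alpha = l PI - 4 l PI beta; the Diophantine condition
    therefore enters through the denominators 4 l. A uniform inverse is indispensable inside the
    recursion, where any loss growing with the degree would be multiplied up at every step. Losses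
    polynomial in the degree are harmless when they occur once, so the division by [P_t] is
    postponed until the recursion is finished. The other obstacle is the definition of the algebra
    by Taylor polynomials and uniform convergence, while products and the recursion call for
    coefficient norms. The relation [rep] mediates: it asks only for homogeneous parts, norm bounds
    and pointwise sums, and smoothness as well as the identification of the parts with Taylor
    polynomials are deduced from it. *)

Fixpoint csum (n : nat) (f : nat -> C) : C :=
  match n with O => RtoC 0 | S n' => Cplus (csum n' f) (f n') end.

Fixpoint rsum (n : nat) (f : nat -> R) : R :=
  match n with O => 0 | S n' => rsum n' f + f n' end.

Lemma csum_ext n f g :
  (forall k, (k < n)%nat -> f k = g k) -> csum n f = csum n g.
Proof.
  induction n; simpl; intros H; auto.
  rewrite IHn, H by auto with arith. reflexivity.
Qed.

Lemma rsum_ext n f g :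
  (forall k, (k < n)%nat -> f k = g k) -> rsum n f = rsum n g.
Proof.
  induction n; simpl; intros H; auto.
  rewrite IHn, H by auto with arith. reflexivity.
Qed.

Lemma csum_plus n f g :
  csum n (fun k => Cplus (f k) (g k)) = Cplus (csum n f) (csum n g).
Proof. induction n; simpl; [ | rewrite IHn]; ring. Qed.

Lemma csum_scal n c f :
  csum n (fun k => Cmult c (f k)) = Cmult c (csum n f).
Proof. induction n; simpl; [ | rewrite IHn]; ring. Qed.

Lemma rsum_plus n f g : rsum n (fun k => f k + g k) = rsum n f + rsum n g.
Proof. induction n; simpl; [ | rewrite IHn]; ring. Qed.

Lemma rsum_scal n c f : rsum n (fun k => c * f k) = c * rsum n f.
Proof. induction n; simpl; [ | rewrite IHn]; ring. Qed.

Lemma rsum_le n f g :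
  (forall k, (k < n)%nat -> f k <= g k) -> rsum n f <= rsum n g.
Proof.
  induction n; simpl; intros H; [lra | ].
  apply Rplus_le_compat; auto with arith.
Qed.

Lemma rsum_nonneg n f : (forall k, (k < n)%nat -> 0 <= f k) -> 0 <= rsum n f.
Proof.
  induction n; simpl; intros H; [lra | ].
  apply Rplus_le_le_0_compat; auto with arith.
Qed.

Lemma rsum_term_le n f i :
  (forall k, (k < n)%nat -> 0 <= f k) -> (i < n)%nat -> f i <= rsum n f.
Proof.
  induction n; simpl; intros H Hi; [lia | ].
  assert (0 <= rsum n f) by (apply rsum_nonneg; auto with arith).
  assert (0 <= f n) by auto with arith.
  destruct (Nat.eq_dec i n) as [->|Hne]; [lra | ].
  assert (f i <= rsum n f) by (apply IHn; [auto with arith | lia]). lra.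
Qed.

Lemma rsum_const n c : rsum n (fun _ => c) = INR n * c.
Proof.
  induction n; [simpl; ring | ].
  simpl rsum; rewrite IHn, S_INR; ring.
Qed.

Lemma Cmod_csum n f : Cmod (csum n f) <= rsum n (fun k => Cmod (f k)).
Proof.
  induction n; simpl; [rewrite Cmod_0; lra | ].
  eapply Rle_trans; [apply Cmod_triangle | lra].
Qed.

Lemma csum_zero n f :
  (forall k, (k < n)%nat -> f k = RtoC 0) -> csum n f = RtoC 0.
Proof.
  induction n; simpl; intros H; auto.
  rewrite IHn, H by auto with arith. ring.
Qed.

Lemma csum_single n f i :
  (i < n)%nat -> (forall k, (k < n)%nat -> k <> i -> f k = RtoC 0) ->
  csum n f = f i.
Proof.
  induction n; simpl; intros Hi H; [lia | ].
  destruct (Nat.eq_dec i n) as [->|Hne].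
  - rewrite csum_zero; [ring | ].
    intros; apply H; lia.
  - rewrite IHn, (H n) by (auto with arith || lia). ring.
Qed.

Lemma csum_add n m f :
  csum (n + m) f = Cplus (csum n f) (csum m (fun k => f (n + k)%nat)).
Proof.
  induction m; simpl; [rewrite Nat.add_0_r; ring | ].
  rewrite Nat.add_succ_r; simpl; rewrite IHm; ring.
Qed.

Lemma rsum_add n m f :
  rsum (n + m) f = rsum n f + rsum m (fun k => f (n + k)%nat).
Proof.
  induction m; simpl; [rewrite Nat.add_0_r; ring | ].
  rewrite Nat.add_succ_r; simpl; rewrite IHm; ring.
Qed.

Lemma csum_swap n m (f : nat -> nat -> C) :
  csum n (fun i => csum m (f i)) = csum m (fun j => csum n (fun i => f i j)).
Proof.
  induction n; simpl.
  - rewrite csum_zero; auto.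
  - rewrite IHn, csum_plus; reflexivity.
Qed.

Lemma csum_sum_n (f : nat -> C) n : sum_n f n = csum (S n) f.
Proof.
  induction n; [rewrite sum_O; simpl; ring | ].
  rewrite sum_Sn, IHn; reflexivity.
Qed.

Lemma rsum_sum_n (f : nat -> R) n : sum_n f n = rsum (S n) f.
Proof.
  induction n; [rewrite sum_O; simpl; ring | ].
  rewrite sum_Sn, IHn; reflexivity.
Qed.

Lemma fst_csum n f : fst (csum n f) = rsum n (fun k => fst (f k)).
Proof. induction n; simpl; [ | rewrite IHn]; reflexivity. Qed.

Lemma snd_csum n f : snd (csum n f) = rsum n (fun k => snd (f k)).
Proof. induction n; simpl; [ | rewrite IHn]; reflexivity. Qed.

Lemma csum_geom n (q : C) :
  Cmult (Cminus q 1) (csum n (fun k => Cpow q k)) = Cminus (Cpow q n) 1.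
Proof.
  induction n; simpl; [ring | ].
  rewrite Cmult_plus_distr_l, IHn; ring.
Qed.

(** * Homogeneous polynomials in [z] and [conj z] *)

Definition mono (k j : nat) (p : pt) : C := Cmult (Cpow p k) (Cpow (Cconj p) j).

Definition ev (m : nat) (a : nat -> C) (p : pt) : C :=
  csum (S m) (fun k => Cmult (a k) (mono k (m - k) p)).

(* [N] bounds the l^1 norm of the coefficients, which is submultiplicative. *)
Definition hom (m : nat) (h : pt -> C) (N : R) : Prop :=
  exists a, (forall p, h p = ev m a p) /\ rsum (S m) (fun k => Cmod (a k)) <= N.

Lemma mono_mul k j k' j' p :
  Cmult (mono k j p) (mono k' j' p) = mono (k + k') (j + j') p.
Proof. unfold mono; rewrite !Cpow_add_r; ring. Qed.

Lemma Cmod_mono k j p : Cmod (mono k j p) = Cmod p ^ (k + j).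
Proof.
  unfold mono; rewrite Cmod_mult, !Cmod_pow, Cmod_conj, pow_add; reflexivity.
Qed.

Lemma hom_ext m h h' N : hom m h N -> (forall p, h' p = h p) -> hom m h' N.
Proof.
  intros [a [H1 H2]] H; exists a; split; auto.
  intros p; rewrite H; auto.
Qed.

Lemma hom_weaken m h N N' : hom m h N -> N <= N' -> hom m h N'.
Proof. intros [a [H1 H2]] H; exists a; split; auto; lra. Qed.

Lemma hom_nonneg m h N : hom m h N -> 0 <= N.
Proof.
  intros [a [H1 H2]]; eapply Rle_trans; [ | apply H2].
  apply rsum_nonneg; intros; apply Cmod_ge_0.
Qed.

Lemma hom_0 m : hom m (fun _ => RtoC 0) 0.
Proof.
  exists (fun _ => RtoC 0); split.
  - intros p; unfold ev; rewrite csum_zero; auto; intros; ring.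
  - rewrite (rsum_ext _ _ (fun _ => 0)), rsum_const; [lra | intros; apply Cmod_0].
Qed.

Lemma hom_plus m f g M N :
  hom m f M -> hom m g N -> hom m (fun p => Cplus (f p) (g p)) (M + N).
Proof.
  intros [a [H1 H2]] [b [H3 H4]]; exists (fun k => Cplus (a k) (b k)); split.
  - intros p; rewrite H1, H3; unfold ev; rewrite <- csum_plus.
    apply csum_ext; intros; ring.
  - apply Rle_trans with (rsum (S m) (fun k => Cmod (a k) + Cmod (b k))).
    + apply rsum_le; intros; apply Cmod_triangle.
    + rewrite rsum_plus; lra.
Qed.

Lemma hom_scal m f N (c : C) :
  hom m f N -> hom m (fun p => Cmult c (f p)) (Cmod c * N).
Proof.
  intros [a [H1 H2]]; exists (fun k => Cmult c (a k)); split.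
  - intros p; rewrite H1; unfold ev; rewrite <- csum_scal.
    apply csum_ext; intros; ring.
  - rewrite (rsum_ext _ _ (fun k => Cmod c * Cmod (a k))), rsum_scal
      by (intros; apply Cmod_mult).
    apply Rmult_le_compat_l; auto; apply Cmod_ge_0.
Qed.

Lemma hom_opp m f N : hom m f N -> hom m (fun p => Copp (f p)) N.
Proof.
  intros H; apply (hom_scal _ _ _ (Copp 1)) in H.
  rewrite Cmod_m1, Rmult_1_l in H.
  apply (hom_ext _ _ _ _ H); intros; ring.
Qed.

Lemma hom_minus m f g M N :
  hom m f M -> hom m g N -> hom m (fun p => Cminus (f p) (g p)) (M + N).
Proof. intros H1 H2; apply (hom_plus _ _ _ _ _ H1 (hom_opp _ _ _ H2)). Qed.

Lemma hom_sum m n (f : nat -> pt -> C) N :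
  (forall k, (k < n)%nat -> hom m (f k) (N k)) ->
  hom m (fun p => csum n (fun k => f k p)) (rsum n N).
Proof.
  induction n; simpl; intros H; [apply hom_0 | ].
  apply hom_plus; auto with arith.
Qed.

(** Multiplication by z^k zbar^j shifts the coefficient sequence by [k], which preserves the l^1
    norm. Expanding one factor into monomials then gives submultiplicativity. *)
Lemma hom_mono_mul k j n g N :
  hom n g N -> hom (k + j + n) (fun p => Cmult (mono k j p) (g p)) N.
Proof.
  intros [a [H1 H2]].
  pose (b := fun i => if andb (k <=? i)%nat (i - k <=? n)%nat then a (i - k)%nat else RtoC 0).
  assert (Hlow : forall i, (i < k)%nat -> b i = RtoC 0).
  { intros i Hi; unfold b; destruct (Nat.leb_spec k i); [lia | reflexivity]. }
  assert (Hmid : forall i, (i < S n)%nat -> b (k + i)%nat = a i).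
  { intros i Hi; unfold b; destruct (Nat.leb_spec k (k + i)); [ | lia].
    replace (k + i - k)%nat with i by lia.
    destruct (Nat.leb_spec i n); [reflexivity | lia]. }
  assert (Hup : forall i, b (k + (S n + i))%nat = RtoC 0).
  { intros i; unfold b; destruct (Nat.leb_spec k (k + (S n + i))); [ | lia].
    destruct (Nat.leb_spec (k + (S n + i) - k) n); [lia | reflexivity]. }
  exists b; split.
  - intros p; rewrite H1; unfold ev.
    (* [k] low zeros, the [S n] shifted coefficients, [j] high zeros. *)
    replace (S (k + j + n)) with (k + (S n + j))%nat by lia.
    rewrite !csum_add, (csum_zero k), (csum_zero j).
    + rewrite <- csum_scal.
      rewrite (csum_ext (S n) (fun i => Cmult (b (k + i)%nat) _)
        (fun i => Cmult (mono k j p) (Cmult (a i) (mono i (n - i) p)))).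
      * ring.
      * intros i Hi; rewrite Hmid by auto.
        replace (k + j + n - (k + i))%nat with (j + (n - i))%nat by lia.
        rewrite <- mono_mul; ring.
    + intros i _; rewrite Hup; ring.
    + intros i Hi; rewrite Hlow by auto; ring.
  - replace (S (k + j + n)) with (k + (S n + j))%nat by lia.
    rewrite !rsum_add.
    rewrite (rsum_ext k _ (fun _ => 0)), (rsum_ext j _ (fun _ => 0)), !rsum_const.
    + rewrite (rsum_ext (S n) _ (fun i => Cmod (a i)))
        by (intros i Hi; rewrite Hmid by auto; reflexivity).
      lra.
    + intros i _; rewrite Hup; apply Cmod_0.
    + intros i Hi; rewrite Hlow by auto; apply Cmod_0.
Qed.

Lemma hom_mul m n f g M N :
  hom m f M -> hom n g N -> hom (m + n) (fun p => Cmult (f p) (g p)) (M * N).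
Proof.
  intros [a [H1 H2]] Hg.
  assert (HN := hom_nonneg _ _ _ Hg).
  apply (hom_weaken _ _ (rsum (S m) (fun k => Cmod (a k) * N))).
  - eapply (hom_ext _ (fun p => csum (S m) (fun k => Cmult (a k) (Cmult (mono k (m - k) p) (g p))))).
    + apply hom_sum; intros k Hk; apply hom_scal.
      replace (m + n)%nat with (k + (m - k) + n)%nat by lia.
      apply hom_mono_mul; auto.
    + intros p; rewrite H1; unfold ev; rewrite Cmult_comm, <- csum_scal.
      apply csum_ext; intros; ring.
  - rewrite (rsum_ext _ _ (fun k => N * Cmod (a k))) by (intros; ring).
    rewrite rsum_scal; nra.
Qed.

Lemma hom_1 : hom 0 (fun _ => RtoC 1) 1.
Proof.
  exists (fun _ => RtoC 1); split.
  - intros p; unfold ev, mono; simpl; ring.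
  - simpl; rewrite Cmod_1; lra.
Qed.

Lemma hom_mono k j : hom (k + j) (mono k j) 1.
Proof.
  replace (k + j)%nat with (k + j + 0)%nat by lia.
  apply (hom_ext _ (fun p => Cmult (mono k j p) (RtoC 1))).
  - apply hom_mono_mul, hom_1.
  - intros; ring.
Qed.

Lemma hom_pow n f N k : hom n f N -> hom (k * n) (fun p => Cpow (f p) k) (N ^ k).
Proof.
  intros H; induction k; simpl; [apply hom_1 | ].
  apply hom_mul; auto.
Qed.

Lemma hom_fst : hom 1 (fun p => RtoC (fst p)) 1.
Proof.
  apply (hom_weaken _ _ (Cmod (/ 2)%C * (1 + 1))).
  - apply (hom_ext _ (fun p => Cmult (/ 2)%C (Cplus (mono 1 0 p) (mono 0 1 p)))).
    + apply hom_scal, hom_plus; [apply (hom_mono 1 0) | apply (hom_mono 0 1)].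
    + intros [x y]; unfold mono; simpl.
      apply injective_projections; simpl; field.
  - rewrite Cmod_inv, Cmod_R, Rabs_right; [lra | lra | ].
    intros H; apply (f_equal fst) in H; simpl in H; lra.
Qed.

Lemma hom_snd : hom 1 (fun p => RtoC (snd p)) 1.
Proof.
  apply (hom_weaken _ _ (Cmod ((/ 2) * Ci)%C * (1 + 1))).
  - apply (hom_ext _ (fun p => Cmult ((/ 2) * Ci)%C (Cminus (mono 0 1 p) (mono 1 0 p)))).
    + apply hom_scal, hom_minus; [apply (hom_mono 0 1) | apply (hom_mono 1 0)].
    + intros [x y]; unfold mono; simpl.
      apply injective_projections; simpl; field.
  - rewrite Cmod_mult, Cmod_Ci, Cmod_inv, Cmod_R, Rabs_right; [lra | lra | ].
    intros H; apply (f_equal fst) in H; simpl in H; lra.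
Qed.

Lemma Cmod_hom m h N p : hom m h N -> Cmod (h p) <= N * Cmod p ^ m.
Proof.
  intros [a [H1 H2]]; rewrite H1; unfold ev.
  eapply Rle_trans; [apply Cmod_csum | ].
  rewrite (rsum_ext _ _ (fun k => Cmod p ^ m * Cmod (a k))).
  - rewrite rsum_scal, Rmult_comm; apply Rmult_le_compat_r; auto.
    apply pow_le, Cmod_ge_0.
  - intros k Hk; rewrite Cmod_mult, Cmod_mono.
    replace (k + (m - k))%nat with m by lia; ring.
Qed.

Lemma hom_rescale m h N (s : R) p :
  hom m h N -> h (s * fst p, s * snd p) = Cmult (RtoC (s ^ m)) (h p).
Proof.
  intros [a [H1 _]]; rewrite !H1; unfold ev; rewrite <- csum_scal.
  apply csum_ext; intros k Hk.
  assert (E1 : ((s * fst p, s * snd p) : C) = Cmult (RtoC s) p)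
    by (destruct p; apply injective_projections; simpl; ring).
  unfold mono; rewrite E1, Cmult_conj, !Cpow_mult_l.
  replace (Cconj (RtoC s)) with (RtoC s)
    by (apply injective_projections; simpl; ring).
  rewrite RtoC_pow.
  replace (Cpow (RtoC s) m) with (Cmult (Cpow (RtoC s) k) (Cpow (RtoC s) (m - k)))
    by (rewrite <- Cpow_add_r; f_equal; lia).
  ring.
Qed.

(** * Partial derivatives of homogeneous polynomials *)

Definition cder (f : R -> C) (s : R) (l : C) : Prop :=
  is_derive (fun x => fst (f x)) s (fst l) /\
  is_derive (fun x => snd (f x)) s (snd l).

Lemma cder_const c s : cder (fun _ => c) s 0.
Proof. split; apply @is_derive_const. Qed.

Lemma cder_plus f g s l k :
  cder f s l -> cder g s k -> cder (fun x => Cplus (f x) (g x)) s (Cplus l k).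
Proof.
  intros [H1 H2] [H3 H4]; split; simpl.
  - apply (is_derive_plus (fun x => fst (f x)) (fun x => fst (g x))); auto.
  - apply (is_derive_plus (fun x => snd (f x)) (fun x => snd (g x))); auto.
Qed.

Lemma cder_mult f g s l k :
  cder f s l -> cder g s k ->
  cder (fun x => Cmult (f x) (g x)) s (Cplus (Cmult l (g s)) (Cmult (f s) k)).
Proof.
  intros [H1 H2] [H3 H4].
  assert (M : forall u v a b, is_derive u s a -> is_derive v s b ->
    is_derive (fun x : R => u x * v x) s (a * v s + u s * b)).
  { intros; apply (is_derive_mult u v); auto; intros; apply Rmult_comm. }
  split; simpl.
  - eapply eq_rect.
    + apply (is_derive_minus (fun x => fst (f x) * fst (g x))
               (fun x => snd (f x) * snd (g x))); apply M; eauto.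
    + unfold minus, plus, opp; simpl; ring.
  - eapply eq_rect.
    + apply (is_derive_plus (fun x => fst (f x) * snd (g x))
               (fun x => snd (f x) * fst (g x))); apply M; eauto.
    + unfold plus; simpl; ring.
Qed.

Lemma cder_scal c f s l :
  cder f s l -> cder (fun x => Cmult c (f x)) s (Cmult c l).
Proof.
  intros H; replace (Cmult c l) with (Cplus (Cmult 0 (f s)) (Cmult c l)) by ring.
  apply cder_mult; auto; apply cder_const.
Qed.

Lemma cder_pow f s l n :
  cder f s l ->
  cder (fun x => Cpow (f x) n) s (Cmult (Cmult (INR n) (Cpow (f s) (n - 1))) l).
Proof.
  intros H; induction n.
  - simpl; replace (Cmult (Cmult _ _) _) with (RtoC 0) by ring; apply cder_const.
  - replace (Cmult _ _) with
      (Cplus (Cmult l (Cpow (f s) n))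
         (Cmult (f s) (Cmult (Cmult (INR n) (Cpow (f s) (n - 1))) l))).
    + simpl Cpow; apply (cder_mult f (fun x => Cpow (f x) n)); auto.
    + rewrite S_INR, RtoC_plus; destruct n; simpl Nat.sub.
      * simpl; ring.
      * rewrite Nat.sub_0_r, (Cpow_S _ n); ring.
Qed.

Lemma cder_sum n (f : nat -> R -> C) s l :
  (forall k, (k < n)%nat -> cder (f k) s (l k)) ->
  cder (fun x => csum n (fun k => f k x)) s (csum n l).
Proof.
  induction n; simpl; intros H; [apply cder_const | ].
  apply cder_plus; auto with arith.
Qed.

Definition isD (b : bool) (f : pt -> C) (p : pt) (l : C) : Prop :=
  cder (fun s => f (slice b p s)) (coord b p) l.

Lemma slice_coord b p : slice b p (coord b p) = p.
Proof. destruct b, p; reflexivity. Qed.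

Lemma isD_dpart b f p l : isD b f p l -> dpart b f p = l.
Proof.
  intros [H1 H2]; unfold dpart.
  destruct l; f_equal; apply is_derive_unique; assumption.
Qed.

Lemma isD_ex b f p l : isD b f p l -> ex_dpart b f p.
Proof. intros [H1 H2]; split; eexists; eauto. Qed.

(* the derivative of [z] in the direction [b] *)
Definition dz (b : bool) : C := if b then RtoC 1 else Ci.

(** The truncated exponents [k - 1] and [j - 1] are harmless: at exponent 0 the factor [INR 0] kills
    the term. *)
Definition dmono (b : bool) (k j : nat) (p : pt) : C :=
  Cplus (Cmult (Cmult (INR k) (dz b)) (mono (k - 1) j p))
        (Cmult (Cmult (INR j) (Cconj (dz b))) (mono k (j - 1) p)).

Lemma isD_mono b k j p : isD b (mono k j) p (dmono b k j p).
Proof.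
  unfold isD, mono.
  assert (Hz : cder (fun s => (slice b p s : C)) (coord b p) (dz b)).
  { destruct b; split; simpl; first [apply @is_derive_id | apply @is_derive_const]. }
  assert (Hc : cder (fun s => Cconj (slice b p s)) (coord b p) (Cconj (dz b))).
  { destruct b; split; simpl.
    - apply @is_derive_id.
    - auto_derive; auto; ring.
    - apply @is_derive_const.
    - auto_derive; auto; ring. }
  pose proof (cder_mult _ _ _ _ _ (cder_pow _ _ _ k Hz) (cder_pow _ _ _ j Hc)) as H.
  cbv beta in H; rewrite slice_coord in H.
  eapply eq_rect; [exact H | unfold dmono, mono; ring].
Qed.

(** Free exponent functions, instead of [k] and [m - k], keep this class closed under [lap], which
    lowers both exponents. *)
Definition lin (n : nat) (a : nat -> C) (K J : nat -> nat) (p : pt) : C :=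
  csum n (fun k => Cmult (a k) (mono (K k) (J k) p)).

Lemma isD_lin b n a K J p :
  isD b (lin n a K J) p (csum n (fun k => Cmult (a k) (dmono b (K k) (J k) p))).
Proof.
  apply (cder_sum n (fun k s => Cmult (a k) (mono (K k) (J k) (slice b p s)))).
  intros; apply cder_scal; apply isD_mono.
Qed.

Lemma dpart_lin b n a K J :
  dpart b (lin n a K J) = fun p => csum n (fun k => Cmult (a k) (dmono b (K k) (J k) p)).
Proof.
  apply functional_extensionality; intros p.
  apply isD_dpart, isD_lin.
Qed.

Definition ddmono (b b' : bool) (k j : nat) (p : pt) : C :=
  Cplus (Cmult (Cmult (INR k) (dz b)) (dmono b' (k - 1) j p))
        (Cmult (Cmult (INR j) (Cconj (dz b))) (dmono b' k (j - 1) p)).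

Lemma isD_dpart_lin b b' n a K J p :
  isD b' (dpart b (lin n a K J)) p
    (csum n (fun k => Cmult (a k) (ddmono b b' (K k) (J k) p))).
Proof.
  rewrite dpart_lin.
  apply (cder_sum n (fun k s => Cmult (a k) (dmono b (K k) (J k) (slice b' p s)))).
  intros k _; apply cder_scal, cder_plus; apply cder_scal, isD_mono.
Qed.

Lemma ddmono_sym b b' k j p : ddmono b b' k j p = ddmono b' b k j p.
Proof. unfold ddmono, dmono; ring. Qed.

(** This is Delta = 4 d_z d_zbar: the pure second derivatives in z and in zbar carry the factor 1 +
    i^2 = 0. *)
Lemma lap_lin n a K J :
  lap (lin n a K J) =
  lin n (fun k => Cmult (a k) (4 * INR (K k) * INR (J k)))
    (fun k => (K k - 1)%nat) (fun k => (J k - 1)%nat).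
Proof.
  apply functional_extensionality; intros p; unfold lap.
  rewrite !(isD_dpart _ _ _ _ (isD_dpart_lin _ _ _ _ _ _ _)), <- csum_plus.
  apply csum_ext; intros k _.
  unfold ddmono, dmono, dz.
  replace (Cconj Ci) with (Copp Ci) by (apply injective_projections; simpl; ring).
  replace (Cconj 1) with (RtoC 1) by (apply injective_projections; simpl; ring).
  (* With 4 written as 2 - 2 i^2 the claim becomes a polynomial identity in [Ci] up to a multiple of
     1 + i^2. *)
  replace (RtoC 4) with (Cminus 2 (Cmult 2 (Cmult Ci Ci)))
    by (apply injective_projections; simpl; ring).
  assert (E : Cmult Ci Ci = Copp 1) by (apply injective_projections; simpl; ring).
  set (A := mono (K k - 1 - 1) (J k) p).
  set (B := mono (K k) (J k - 1 - 1) p).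
  set (D := mono (K k - 1) (J k - 1) p).
  transitivity (Cplus (Cmult (Cplus 1 (Cmult Ci Ci))
     (Cmult (a k) (Cplus (Cmult (Cmult (INR (K k)) (INR (K k - 1))) A)
       (Cmult (Cmult (INR (J k)) (INR (J k - 1))) B))))
     (Cmult (Cmult (a k) (Cmult (Cmult (Cminus 2 (Cmult 2 (Cmult Ci Ci))) (INR (K k))) (INR (J k)))) D)).
  - ring.
  - rewrite E; ring.
Qed.

Lemma bilap_lin n a K J :
  bilap (lin n a K J) =
  lin n (fun k => Cmult (a k) (16 * (INR (K k) * INR (K k - 1)) * (INR (J k) * INR (J k - 1))))
    (fun k => (K k - 2)%nat) (fun k => (J k - 2)%nat).
Proof.
  unfold bilap; rewrite !lap_lin.
  apply functional_extensionality; intros p; apply csum_ext; intros k _.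
  rewrite <- !Nat.sub_add_distr; simpl Nat.add.
  ring.
Qed.

Lemma hom_lin m h N : hom m h N ->
  exists a, h = lin (S m) a (fun k => k) (fun k => (m - k)%nat) /\
    rsum (S m) (fun k => Cmod (a k)) <= N.
Proof.
  intros [a [H1 H2]]; exists a; split; auto.
  apply functional_extensionality; auto.
Qed.

Lemma Cmod_dz b : Cmod (dz b) = 1.
Proof. destruct b; [apply Cmod_1 | apply Cmod_Ci]. Qed.

Lemma Cmod_INR n : Cmod (INR n) = INR n.
Proof. rewrite Cmod_R; apply Rabs_right, Rle_ge, pos_INR. Qed.

Lemma hom_dmono b k j n : (k + j = S n)%nat -> hom n (dmono b k j) (INR (S n)).
Proof.
  intros E.
  assert (H1 : hom n (fun p => Cmult (Cmult (INR k) (dz b)) (mono (k - 1) j p)) (INR k)).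
  { destruct k.
    - apply (hom_ext _ (fun _ => RtoC 0)); [apply hom_0 | intros; simpl; ring].
    - eapply hom_weaken.
      + apply hom_scal; replace n with (S k - 1 + j)%nat by lia; apply hom_mono.
      + rewrite Cmod_mult, Cmod_dz, Cmod_INR; lra. }
  assert (H2 : hom n (fun p => Cmult (Cmult (INR j) (Cconj (dz b))) (mono k (j - 1) p)) (INR j)).
  { destruct j.
    - apply (hom_ext _ (fun _ => RtoC 0)); [apply hom_0 | intros; simpl; ring].
    - eapply hom_weaken.
      + apply hom_scal; replace n with (k + (S j - 1))%nat by lia; apply hom_mono.
      + rewrite Cmod_mult, Cmod_conj, Cmod_dz, Cmod_INR; lra. }
  rewrite <- E, plus_INR; apply hom_plus; auto.
Qed.

Lemma isD_hom b m h N p : hom m h N -> isD b h p (dpart b h p).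
Proof.
  intros H; destruct (hom_lin _ _ _ H) as [a [-> _]].
  rewrite (isD_dpart _ _ _ _ (isD_lin _ _ _ _ _ _)); apply isD_lin.
Qed.

Lemma hom_dpart b n h N : hom (S n) h N -> hom n (dpart b h) (INR (S n) * N).
Proof.
  intros H; destruct (hom_lin _ _ _ H) as [a [-> Ha]].
  rewrite dpart_lin.
  apply (hom_weaken _ _ (rsum (S (S n)) (fun k => Cmod (a k) * INR (S n)))).
  - apply hom_sum; intros k Hk; apply hom_scal, hom_dmono; lia.
  - rewrite (rsum_ext _ _ (fun k => INR (S n) * Cmod (a k))) by (intros; ring).
    rewrite rsum_scal; apply Rmult_le_compat_l; auto; apply pos_INR.
Qed.

Lemma dpart_hom0 b h N p : hom 0 h N -> dpart b h p = RtoC 0.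
Proof.
  intros H; destruct (hom_lin _ _ _ H) as [a [-> _]].
  rewrite dpart_lin; unfold dmono; simpl; ring.
Qed.

Lemma dpart_plus b m f g M N :
  hom m f M -> hom m g N ->
  dpart b (fun p => Cplus (f p) (g p)) = fun p => Cplus (dpart b f p) (dpart b g p).
Proof.
  intros H1 H2; apply functional_extensionality; intros p; apply isD_dpart.
  apply (cder_plus (fun s => f (slice b p s)) (fun s => g (slice b p s)));
    eapply isD_hom; eauto.
Qed.

Lemma dpart_scal b m f N c :
  hom m f N ->
  dpart b (fun p => Cmult c (f p)) = fun p => Cmult c (dpart b f p).
Proof.
  intros H; apply functional_extensionality; intros p; apply isD_dpart.
  apply (cder_scal c (fun s => f (slice b p s))); eapply isD_hom; eauto.
Qed.

Lemma lap_plus m f g M N :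
  hom (S (S m)) f M -> hom (S (S m)) g N ->
  lap (fun p => Cplus (f p) (g p)) = fun p => Cplus (lap f p) (lap g p).
Proof.
  intros H1 H2; apply functional_extensionality; intros p; unfold lap.
  rewrite !(dpart_plus _ _ _ _ _ _ H1 H2).
  rewrite !(dpart_plus _ (S m) _ _ _ _ (hom_dpart _ _ _ _ H1) (hom_dpart _ _ _ _ H2)).
  ring.
Qed.

Lemma lap_scal m f N c :
  hom (S (S m)) f N ->
  lap (fun p => Cmult c (f p)) = fun p => Cmult c (lap f p).
Proof.
  intros H; apply functional_extensionality; intros p; unfold lap.
  rewrite !(dpart_scal _ _ _ _ _ H).
  rewrite !(dpart_scal _ (S m) _ _ _ (hom_dpart _ _ _ _ H)).
  ring.
Qed.

Lemma hom_lap n h N :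
  hom (S (S n)) h N -> hom n (lap h) (2 * INR (S n) * INR (S (S n)) * N).
Proof.
  intros H.
  replace (2 * INR (S n) * INR (S (S n)) * N) with
    (INR (S n) * (INR (S (S n)) * N) + INR (S n) * (INR (S (S n)) * N)) by ring.
  apply hom_plus; apply hom_dpart, hom_dpart; auto.
Qed.

Lemma bilap_plus m f g M N :
  hom (4 + m) f M -> hom (4 + m) g N ->
  bilap (fun p => Cplus (f p) (g p)) = fun p => Cplus (bilap f p) (bilap g p).
Proof.
  intros H1 H2; unfold bilap.
  rewrite (lap_plus _ _ _ _ _ H1 H2).
  apply (lap_plus m _ _ _ _ (hom_lap _ _ _ H1) (hom_lap _ _ _ H2)).
Qed.

Lemma bilap_scal m f N c :
  hom (4 + m) f N ->
  bilap (fun p => Cmult c (f p)) = fun p => Cmult c (bilap f p).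
Proof.
  intros H; unfold bilap.
  rewrite (lap_scal _ _ _ _ H).
  apply (lap_scal m _ _ _ (hom_lap _ _ _ H)).
Qed.

Lemma dpart_comm_hom m h N :
  hom m h N -> dpart true (dpart false h) = dpart false (dpart true h).
Proof.
  intros H; destruct (hom_lin _ _ _ H) as [a [-> _]].
  apply functional_extensionality; intros p.
  rewrite !(isD_dpart _ _ _ _ (isD_dpart_lin _ _ _ _ _ _ _)).
  apply csum_ext; intros; rewrite ddmono_sym; reflexivity.
Qed.

(** The Euler field is z d_z + zbar d_zbar and multiplies every monomial by its degree. Taylor
    polynomials obey the same recursion, which is how the two get identified. *)
Lemma euler_hom m h N p :
  hom m h N ->
  Cmult (INR m) (h p) =
  Cplus (Cmult (fst p) (dpart true h p)) (Cmult (snd p) (dpart false h p)).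
Proof.
  intros H; destruct (hom_lin _ _ _ H) as [a [-> _]].
  rewrite !dpart_lin; unfold lin; rewrite <- !csum_scal, <- csum_plus.
  apply csum_ext; intros k Hk.
  replace (INR m) with (INR k + INR (m - k)) by (rewrite <- plus_INR; f_equal; lia).
  generalize (m - k)%nat; intros j.
  assert (Ez : Cplus (fst p) (Cmult (snd p) Ci) = p)
    by (destruct p; apply injective_projections; simpl; ring).
  assert (Ec : Cminus (fst p) (Cmult (snd p) Ci) = Cconj p)
    by (destruct p; apply injective_projections; simpl; ring).
  assert (E1 : Cmult (INR k) (mono k j p) = Cmult (Cmult (INR k) p) (mono (k - 1) j p)).
  { destruct k; [simpl; ring | ].
    unfold mono; simpl Nat.sub; rewrite Nat.sub_0_r, Cpow_S; ring. }
  assert (E2 : Cmult (INR j) (mono k j p) = Cmult (Cmult (INR j) (Cconj p)) (mono k (j - 1) p)).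
  { destruct j; [simpl; ring | ].
    unfold mono; simpl Nat.sub; rewrite Nat.sub_0_r, (Cpow_S _ j); ring. }
  rewrite RtoC_plus.
  transitivity (Cmult (a k) (Cplus (Cmult (INR k) (mono k j p)) (Cmult (INR j) (mono k j p))));
    [ring | ].
  transitivity (Cmult (a k) (Cplus
    (Cmult (Cmult (INR k) (Cplus (fst p) (Cmult (snd p) Ci))) (mono (k - 1) j p))
    (Cmult (Cmult (INR j) (Cminus (fst p) (Cmult (snd p) Ci))) (mono k (j - 1) p)))).
  - rewrite E1, E2, Ez, Ec; reflexivity.
  - unfold dmono, dz.
    replace (Cconj Ci) with (Copp Ci) by (apply injective_projections; simpl; ring).
    replace (Cconj 1) with (RtoC 1) by (apply injective_projections; simpl; ring).
    ring.
Qed.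

(** * Growth of coefficient bounds *)

(* By comparison with a geometric series, boundedness of [N m * rho ^ m] for
   all [rho < r] is equivalent to summability for all [rho < r]. *)
Definition rad (r : Rbar) (N : nat -> R) : Prop :=
  (forall m, 0 <= N m) /\
  forall rho, 0 <= rho -> Rbar_lt rho r -> exists M, forall m, N m * rho ^ m <= M.

Lemma Rbar_lt_between (x : R) (r : Rbar) :
  Rbar_lt x r -> exists y : R, x < y /\ Rbar_lt y r.
Proof.
  destruct r as [r | | ]; simpl; intros H.
  - exists ((x + r) / 2); lra.
  - exists (x + 1); split; [lra | exact I].
  - contradiction.
Qed.

(** Bernoulli's inequality for 1 + d = 1 / q. *)
Lemma linear_geom_bound q :
  0 <= q < 1 -> exists M, 0 <= M /\ forall m, (INR m + 1) * q ^ m <= M.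
Proof.
  intros [H0 H1]; destruct (Req_dec q 0) as [-> | Hq].
  - exists 1; split; [lra | ]; intros [ | m]; simpl; lra.
  - pose (d := / q - 1).
    assert (Hd : 0 < d).
    { unfold d; apply Rlt_0_minus; rewrite <- Rinv_1; apply Rinv_lt_contravar; lra. }
    assert (Hi : 0 < / d) by (apply Rinv_0_lt_compat; auto).
    exists (1 + / d); split; [lra | ]; intros m.
    assert (B := poly m d Hd).
    replace (1 + d) with (/ q) in B by (unfold d; ring).
    rewrite pow_inv in B.
    assert (Hp : 0 < q ^ m) by (apply pow_lt; lra).
    assert ((1 + INR m * d) * q ^ m <= 1).
    { apply (Rmult_le_compat_r (q ^ m)) in B; [ | lra].
      rewrite Rinv_l in B; lra. }
    assert (INR m + 1 <= (1 + / d) * (1 + INR m * d)).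
    { assert (Hm := pos_INR m).
      replace ((1 + / d) * (1 + INR m * d)) with (1 + INR m * d + / d + INR m)
        by (field; lra).
      assert (0 <= INR m * d) by (apply Rmult_le_pos; lra). lra. }
    apply Rle_trans with ((1 + / d) * (1 + INR m * d) * q ^ m).
    + apply Rmult_le_compat_r; lra.
    + rewrite Rmult_assoc; rewrite <- (Rmult_1_r (1 + / d)) at 2.
      apply Rmult_le_compat_l; lra.
Qed.

(** The gap between [rho] and some [s] below [r] yields the factor (rho / s)^m, which absorbs a
    linear factor; repetition absorbs polynomial ones. *)
Lemma rad_lin r N : rad r N -> rad r (fun m => (INR m + 1) * N m).
Proof.
  intros [H0 H]; split.
  - intros m; apply Rmult_le_pos; auto; assert (Hm := pos_INR m); lra.
  - intros rho Hr Hlt; destruct (Rbar_lt_between _ _ Hlt) as [s [Hs Hs']].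
    destruct (H s) as [M HM]; [lra | auto | ].
    destruct (linear_geom_bound (rho / s)) as [L [HL HL']].
    { split; [apply Rdiv_le_0_compat; lra | apply Rlt_div_l; lra]. }
    exists (L * M); intros m.
    replace (rho ^ m) with ((rho / s) ^ m * s ^ m)
      by (rewrite <- Rpow_mult_distr; f_equal; field; lra).
    replace ((INR m + 1) * N m * ((rho / s) ^ m * s ^ m))
      with ((INR m + 1) * (rho / s) ^ m * (N m * s ^ m)) by ring.
    apply Rmult_le_compat; auto.
    + apply Rmult_le_pos; [assert (Hm := pos_INR m); lra | ].
      apply pow_le, Rdiv_le_0_compat; lra.
    + apply Rmult_le_pos; auto; apply pow_le; lra.
Qed.

Lemma rad_le r N N' : (forall m, 0 <= N' m <= N m) -> rad r N -> rad r N'.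
Proof.
  intros HN [H0 H]; split; [apply HN | ].
  intros rho Hr Hlt; destruct (H rho Hr Hlt) as [M HM]; exists M; intros m.
  eapply Rle_trans; [ | apply HM]; apply Rmult_le_compat_r; [apply pow_le; auto | apply HN].
Qed.

Lemma rad_shift r N : rad r N -> rad r (fun m => N (S m)).
Proof.
  intros [H0 H]; split; auto.
  intros rho Hr Hlt; destruct (Rbar_lt_between _ _ Hlt) as [s [Hs Hs']].
  destruct (H s) as [M HM]; [lra | auto | ]; exists (M / s); intros m.
  (* Division is by [s], since [rho] may be 0. *)
  apply (proj1 (Rle_div_r _ _ s ltac:(lra))).
  apply Rle_trans with (N (S m) * s ^ (S m)); auto.
  simpl pow; rewrite Rmult_assoc; apply Rmult_le_compat_l; auto.
  rewrite Rmult_comm; apply Rmult_le_compat_l; [lra | ].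
  apply pow_incr; lra.
Qed.

Lemma rad_plus r N N' : rad r N -> rad r N' -> rad r (fun m => N m + N' m).
Proof.
  intros [H0 H] [H0' H']; split.
  - intros m; specialize (H0 m); specialize (H0' m); lra.
  - intros rho Hr Hlt; destruct (H rho Hr Hlt) as [M HM].
    destruct (H' rho Hr Hlt) as [M' HM']; exists (M + M'); intros m.
    rewrite Rmult_plus_distr_r; apply Rplus_le_compat; auto.
Qed.

Lemma rad_scal r N c : 0 <= c -> rad r N -> rad r (fun m => c * N m).
Proof.
  intros Hc [H0 H]; split.
  - intros m; apply Rmult_le_pos; auto.
  - intros rho Hr Hlt; destruct (H rho Hr Hlt) as [M HM]; exists (c * M); intros m.
    rewrite Rmult_assoc; apply Rmult_le_compat_l; auto.
Qed.

(** Each of the [m + 1] terms is at most M M' s^(-m); their number is absorbed in passing from [s]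
    to [rho]. *)
Lemma rad_conv r N N' : rad r N -> rad r N' ->
  rad r (fun m => rsum (S m) (fun j => N j * N' (m - j)%nat)).
Proof.
  intros [H0 H] [H0' H'].
  assert (Hpos : forall m, 0 <= rsum (S m) (fun j => N j * N' (m - j)%nat)).
  { intros m; apply rsum_nonneg; intros; apply Rmult_le_pos; auto. }
  split; auto.
  intros rho Hr Hlt; destruct (Rbar_lt_between _ _ Hlt) as [s [Hs Hs']].
  destruct (H s) as [M HM]; [lra | auto | ].
  destruct (H' s) as [M' HM']; [lra | auto | ].
  destruct (linear_geom_bound (rho / s)) as [L [HL HL']].
  { split; [apply Rdiv_le_0_compat; lra | apply Rlt_div_l; lra]. }
  exists (L * (M * M')); intros m.
  assert (Hq : 0 <= (rho / s) ^ m) by (apply pow_le, Rdiv_le_0_compat; lra).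
  assert (HMM : 0 <= M * M').
  { specialize (HM 0%nat); specialize (HM' 0%nat); simpl in HM, HM'.
    specialize (H0 0%nat); specialize (H0' 0%nat); apply Rmult_le_pos; lra. }
  assert (B : rsum (S m) (fun j => N j * N' (m - j)%nat) * s ^ m <= (INR m + 1) * (M * M')).
  { rewrite Rmult_comm, <- rsum_scal, <- S_INR, <- rsum_const.
    apply rsum_le; intros j Hj.
    replace (s ^ m) with (s ^ j * s ^ (m - j)) by (rewrite <- pow_add; f_equal; lia).
    replace (s ^ j * s ^ (m - j) * (N j * N' (m - j)%nat))
      with (N j * s ^ j * (N' (m - j)%nat * s ^ (m - j))) by ring.
    apply Rmult_le_compat; auto; apply Rmult_le_pos; auto; apply pow_le; lra. }
  replace (rho ^ m) with ((rho / s) ^ m * s ^ m)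
    by (rewrite <- Rpow_mult_distr; f_equal; field; lra).
  apply Rle_trans with ((rho / s) ^ m * ((INR m + 1) * (M * M'))).
  - replace (rsum (S m) (fun j => N j * N' (m - j)%nat) * ((rho / s) ^ m * s ^ m))
      with ((rho / s) ^ m * (rsum (S m) (fun j => N j * N' (m - j)%nat) * s ^ m)) by ring.
    apply Rmult_le_compat_l; auto.
  - replace ((rho / s) ^ m * ((INR m + 1) * (M * M')))
      with ((INR m + 1) * (rho / s) ^ m * (M * M')) by ring.
    apply Rmult_le_compat_r; auto.
Qed.

Lemma rad_series r N rho :
  rad r N -> 0 <= rho -> Rbar_lt rho r -> ex_series (fun m => N m * rho ^ m).
Proof.
  intros [H0 H] Hr Hlt; destruct (Rbar_lt_between _ _ Hlt) as [s [Hs Hs']].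
  destruct (H s) as [M HM]; [lra | auto | ].
  apply (ex_series_le (V := R_CompleteNormedModule) _ (fun m => M * (rho / s) ^ m)).
  - intros m; change norm with Rabs.
    rewrite Rabs_right by (apply Rle_ge, Rmult_le_pos; auto; apply pow_le; auto).
    replace (rho ^ m) with (s ^ m * (rho / s) ^ m)
      by (rewrite <- Rpow_mult_distr; f_equal; field; lra).
    rewrite <- Rmult_assoc; apply Rmult_le_compat_r; auto.
    apply pow_le, Rdiv_le_0_compat; lra.
  - apply (ex_series_scal_l (K := R_AbsRing) (V := R_NormedModule) M (fun m => (rho / s) ^ m)), ex_series_geom.
    rewrite Rabs_right by (apply Rle_ge, Rdiv_le_0_compat; lra).
    apply Rlt_div_l; lra.
Qed.

Lemma rad_mono (r r' : Rbar) N : Rbar_le r' r -> rad r N -> rad r' N.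
Proof.
  intros Hle [H0 H]; split; auto.
  intros rho Hr Hlt; apply H; auto; eapply Rbar_lt_le_trans; eauto.
Qed.

(** * Sums of homogeneous polynomials *)

Definition cser (a : nat -> C) (l : C) : Prop :=
  is_series (fun m => fst (a m)) (fst l) /\ is_series (fun m => snd (a m)) (snd l).

Lemma cser_unique a l l' : cser a l -> cser a l' -> l = l'.
Proof.
  intros [H1 H2] [H3 H4]; apply injective_projections.
  - rewrite <- (is_series_unique _ _ H1); apply is_series_unique; auto.
  - rewrite <- (is_series_unique _ _ H2); apply is_series_unique; auto.
Qed.

Lemma cser_ext a b l : (forall m, a m = b m) -> cser a l -> cser b l.
Proof.
  intros H [H1 H2]; split; eapply is_series_ext; eauto; intros m; cbv beta;
    rewrite H; reflexivity.
Qed.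

Lemma cser_plus a b l k :
  cser a l -> cser b k -> cser (fun m => Cplus (a m) (b m)) (Cplus l k).
Proof.
  intros [H1 H2] [H3 H4]; split; simpl.
  - apply (is_series_plus (fun m => fst (a m)) (fun m => fst (b m))); auto.
  - apply (is_series_plus (fun m => snd (a m)) (fun m => snd (b m))); auto.
Qed.

Lemma cser_opp a l : cser a l -> cser (fun m => Copp (a m)) (Copp l).
Proof.
  intros [H1 H2]; split; simpl.
  - apply (is_series_opp (fun m => fst (a m))); auto.
  - apply (is_series_opp (fun m => snd (a m))); auto.
Qed.

Lemma Rabs_fst_le c : Rabs (fst c) <= Cmod c.
Proof. eapply Rle_trans; [apply Rmax_l | apply Rmax_Cmod]. Qed.

Lemma Rabs_snd_le c : Rabs (snd c) <= Cmod c.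
Proof. eapply Rle_trans; [apply Rmax_r | apply Rmax_Cmod]. Qed.

Lemma Cmod_le_components c : Cmod c <= Rabs (fst c) + Rabs (snd c).
Proof.
  replace c with (Cplus (RtoC (fst c)) (Cmult Ci (RtoC (snd c)))) at 1
    by (destruct c; apply injective_projections; simpl; ring).
  eapply Rle_trans; [apply Cmod_triangle | ].
  rewrite Cmod_mult, Cmod_Ci, !Cmod_R; lra.
Qed.

Lemma ex_cser_abs a B :
  (forall m, Cmod (a m) <= B m) -> ex_series B -> exists l, cser a l.
Proof.
  intros H HB.
  assert (H1 : ex_series (fun m => fst (a m))).
  { apply (ex_series_le (V := R_CompleteNormedModule) _ B); auto.
    intros m; eapply Rle_trans; [apply Rabs_fst_le | apply H]. }
  assert (H2 : ex_series (fun m => snd (a m))).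
  { apply (ex_series_le (V := R_CompleteNormedModule) _ B); auto.
    intros m; eapply Rle_trans; [apply Rabs_snd_le | apply H]. }
  destruct H1 as [x Hx], H2 as [y Hy]; exists (x, y); split; auto.
Qed.

Lemma is_series_abs_le (a B : nat -> R) l b :
  (forall m, Rabs (a m) <= B m) -> is_series a l -> is_series B b -> Rabs l <= b.
Proof.
  intros H Ha HB.
  rewrite <- (is_series_unique _ _ Ha), <- (is_series_unique _ _ HB).
  assert (Hex : ex_series (fun m => Rabs (a m))).
  { apply (ex_series_le (V := R_CompleteNormedModule) _ B).
    - intros m; change norm with Rabs; rewrite Rabs_Rabsolu; auto.
    - exists b; auto. }
  eapply Rle_trans; [apply Series_Rabs; auto | ].
  apply Series_le; [ | exists b; auto].
  intros m; split; [apply Rabs_pos | auto].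
Qed.

Lemma cser_le a B l b :
  (forall m, Cmod (a m) <= B m) -> cser a l -> is_series B b ->
  Rabs (fst l) <= b /\ Rabs (snd l) <= b.
Proof.
  intros H [H1 H2] HB; split.
  - apply (is_series_abs_le _ B _ _ (fun m => Rle_trans _ _ _ (Rabs_fst_le _) (H m)) H1 HB).
  - apply (is_series_abs_le _ B _ _ (fun m => Rle_trans _ _ _ (Rabs_snd_le _) (H m)) H2 HB).
Qed.

(** Real and imaginary parts give four real Cauchy products; the majorants [A] and [B] supply the
    absolute convergence. *)
Lemma cser_mult a b A B l k :
  (forall m, Cmod (a m) <= A m) -> ex_series A ->
  (forall m, Cmod (b m) <= B m) -> ex_series B ->
  cser a l -> cser b k ->
  cser (fun m => csum (S m) (fun j => Cmult (a j) (b (m - j)%nat))) (Cmult l k).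
Proof.
  intros HA HA' HB HB' [H1 H2] [H3 H4].
  assert (X : forall (f : nat -> R) D, (forall m, Rabs (f m) <= D m) -> ex_series D ->
    ex_series (fun m => Rabs (f m))).
  { intros f D Hf HD; apply (ex_series_le (V := R_CompleteNormedModule) _ D); auto.
    intros m; change norm with Rabs; rewrite Rabs_Rabsolu; auto. }
  assert (X1 : ex_series (fun m => Rabs (fst (a m))))
    by (apply (X _ A); auto; intros m; eapply Rle_trans; [apply Rabs_fst_le | auto]).
  assert (X2 : ex_series (fun m => Rabs (snd (a m))))
    by (apply (X _ A); auto; intros m; eapply Rle_trans; [apply Rabs_snd_le | auto]).
  assert (X3 : ex_series (fun m => Rabs (fst (b m))))
    by (apply (X _ B); auto; intros m; eapply Rle_trans; [apply Rabs_fst_le | auto]).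
  assert (X4 : ex_series (fun m => Rabs (snd (b m))))
    by (apply (X _ B); auto; intros m; eapply Rle_trans; [apply Rabs_snd_le | auto]).
  assert (E : forall (f g : nat -> R) m,
    sum_f_R0 (fun j => f j * g (m - j)%nat) m = rsum (S m) (fun j => f j * g (m - j)%nat)).
  { intros f g m; rewrite <- rsum_sum_n, sum_n_Reals; reflexivity. }
  split.
  - assert (Y := is_series_minus _ _ _ _ (is_series_mult _ _ _ _ H1 H3 X1 X3)
      (is_series_mult _ _ _ _ H2 H4 X2 X4)).
    eapply is_series_ext; [ | exact Y]; intros m; simpl.
    rewrite fst_csum; unfold minus, plus, opp; simpl.
    rewrite (E (fun j => fst (a j)) (fun j => fst (b j))), (E (fun j => snd (a j)) (fun j => snd (b j))).
    assert (Z : forall u v, u + - v = u + (-1) * v) by (intros; ring).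
    rewrite Z, <- rsum_scal, <- rsum_plus.
    simpl; f_equal; [apply rsum_ext; intros; ring | ring].
  - assert (Y := is_series_plus _ _ _ _ (is_series_mult _ _ _ _ H1 H4 X1 X4)
      (is_series_mult _ _ _ _ H2 H3 X2 X3)).
    eapply is_series_ext; [ | exact Y]; intros m; simpl.
    rewrite snd_csum; unfold plus; simpl.
    rewrite (E (fun j => fst (a j)) (fun j => snd (b j))), (E (fun j => snd (a j)) (fun j => fst (b j))).
    rewrite <- rsum_plus.
    reflexivity.
Qed.

(** The working form of membership in the algebra. It contains no derivative of [f], so a solution
    can be assembled from its parts; [rep_inA] and [inA_rep] lead back and forth. *)
Definition rep (r : Rbar) (fs : nat -> pt -> C) (f : pt -> C) : Prop :=
  exists N, (forall m, hom m (fs m) (N m)) /\ rad r N /\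
    forall p, disk r p -> cser (fun m => fs m p) (f p).

Lemma disk_Cmod r p : disk r p <-> Rbar_lt (Cmod p) r.
Proof. reflexivity. Qed.

Lemma rep_ext r fs f g : (forall p, disk r p -> g p = f p) -> rep r fs f -> rep r fs g.
Proof.
  intros E [N [H1 [H2 H3]]]; exists N; split; [ | split]; auto.
  intros p Hp; rewrite E; auto.
Qed.

Lemma rep_mono (r r' : Rbar) fs f : Rbar_le r' r -> rep r fs f -> rep r' fs f.
Proof.
  intros E [N [H1 [H2 H3]]]; exists N; split; [ | split]; auto.
  - eapply rad_mono; eauto.
  - intros p Hp; apply H3; eapply Rbar_lt_le_trans; eauto.
Qed.

Lemma rep_plus r fs gs f g :
  rep r fs f -> rep r gs g ->
  rep r (fun m p => Cplus (fs m p) (gs m p)) (fun p => Cplus (f p) (g p)).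
Proof.
  intros [N [H1 [H2 H3]]] [M [K1 [K2 K3]]].
  exists (fun m => N m + M m); split; [ | split].
  - intros; apply hom_plus; auto.
  - apply rad_plus; auto.
  - intros; apply cser_plus; auto.
Qed.

Lemma rep_opp r fs f :
  rep r fs f -> rep r (fun m p => Copp (fs m p)) (fun p => Copp (f p)).
Proof.
  intros [N [H1 [H2 H3]]]; exists N; split; [ | split]; auto.
  - intros; apply hom_opp; auto.
  - intros; apply cser_opp; auto.
Qed.

Lemma rep_minus r fs gs f g :
  rep r fs f -> rep r gs g ->
  rep r (fun m p => Cminus (fs m p) (gs m p)) (fun p => Cminus (f p) (g p)).
Proof. intros H1 H2; apply (rep_plus _ _ _ _ _ H1 (rep_opp _ _ _ H2)). Qed.

Lemma rad_series_disk r N p :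
  rad r N -> disk r p -> ex_series (fun m => N m * Cmod p ^ m).
Proof. intros H Hp; eapply rad_series; eauto; apply Cmod_ge_0. Qed.

Definition conv (fs gs : nat -> pt -> C) (m : nat) (p : pt) : C :=
  csum (S m) (fun j => Cmult (fs j p) (gs (m - j)%nat p)).

Lemma hom_conv fs gs N M m :
  (forall j, (j <= m)%nat -> hom j (fs j) (N j)) ->
  (forall j, (j <= m)%nat -> hom j (gs j) (M j)) ->
  hom m (conv fs gs m) (rsum (S m) (fun j => N j * M (m - j)%nat)).
Proof.
  intros H1 H2; unfold conv.
  apply hom_sum; intros j Hj.
  replace m with (j + (m - j))%nat at 1 by lia.
  apply hom_mul; [apply H1 | apply H2]; lia.
Qed.

Lemma rep_mult r fs gs f g :
  rep r fs f -> rep r gs g ->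
  rep r (conv fs gs) (fun p => Cmult (f p) (g p)).
Proof.
  intros [N [H1 [H2 H3]]] [M [K1 [K2 K3]]].
  exists (fun m => rsum (S m) (fun j => N j * M (m - j)%nat)); split; [ | split].
  - intros; apply hom_conv; auto.
  - apply rad_conv; auto.
  - intros p Hp.
    apply (cser_mult (fun m => fs m p) (fun m => gs m p)
             (fun m => N m * Cmod p ^ m) (fun m => M m * Cmod p ^ m)); auto.
    + intros; apply Cmod_hom; auto.
    + eapply rad_series_disk; eauto.
    + intros; apply Cmod_hom; auto.
    + eapply rad_series_disk; eauto.
Qed.

(** * Termwise differentiation *)

(** A quadratic remainder estimate can be summed term by term, which makes it a convenient criterion
    for differentiating a series. *)
Lemma is_derive_of_quadratic (G : R -> R) s L K d :
  0 < d -> (forall x, Rabs (x - s) < d -> Rabs (G x - G s - (x - s) * L) <= K * (x - s) ^ 2) ->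
  is_derive G s L.
Proof.
  intros Hd H; apply is_derive_Reals; intros eps Heps.
  assert (HK : 0 < Rabs K + 1) by (assert (X := Rabs_pos K); lra).
  assert (Hdel : 0 < Rmin d (eps / (Rabs K + 1))).
  { apply Rmin_pos; auto; apply Rdiv_lt_0_compat; auto. }
  exists (mkposreal _ Hdel); simpl; intros h Hh Hlt.
  assert (H1 : Rabs h < d) by (eapply Rlt_le_trans; [apply Hlt | apply Rmin_l]).
  assert (H2 : Rabs h < eps / (Rabs K + 1)) by (eapply Rlt_le_trans; [apply Hlt | apply Rmin_r]).
  specialize (H (s + h)); replace (s + h - s) with h in H by ring.
  specialize (H H1).
  assert (Hh' : 0 < Rabs h) by (apply Rabs_pos_lt; auto).
  replace ((G (s + h) - G s) / h - L) with ((G (s + h) - G s - h * L) * / h) by (field; auto).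
  rewrite Rabs_mult, Rabs_inv.
  apply Rle_lt_trans with (Rabs K * Rabs h).
  - apply (proj2 (Rle_div_l _ _ _ Hh')).
    eapply Rle_trans; [apply H | ].
    rewrite <- (pow2_abs h); simpl; rewrite Rmult_1_r, <- Rmult_assoc.
    do 2 (apply Rmult_le_compat_r; [lra | ]); apply Rle_abs.
  - apply Rle_lt_trans with ((Rabs K + 1) * Rabs h); [nra | ].
    apply (Rmult_lt_compat_l (Rabs K + 1)) in H2; auto.
    replace ((Rabs K + 1) * (eps / (Rabs K + 1))) with eps in H2 by (field; lra); auto.
Qed.

Lemma mvt_abs (g g' : R -> R) s x B :
  (forall y, Rabs (y - s) <= Rabs (x - s) -> is_derive g y (g' y)) ->
  (forall y, Rabs (y - s) <= Rabs (x - s) -> Rabs (g' y) <= B) ->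
  Rabs (g x - g s) <= B * Rabs (x - s).
Proof.
  intros H1 H2.
  assert (Y : forall y, Rmin s x <= y <= Rmax s x -> Rabs (y - s) <= Rabs (x - s)).
  { intros y; unfold Rmin, Rmax; destruct (Rle_dec s x); intros Hy.
    - rewrite !Rabs_right; lra.
    - rewrite !Rabs_left1; lra. }
  destruct (MVT_gen g s x g') as [c [Hc E]].
  - intros y Hy; apply H1, Y; lra.
  - intros y Hy; apply continuity_pt_filterlim.
    apply (ex_derive_continuous (V := R_NormedModule) g); exists (g' y); apply H1, Y; auto.
  - rewrite E, Rabs_mult; apply Rmult_le_compat_r; [apply Rabs_pos | auto].
Qed.

(** Two applications of the mean value theorem bound the first order remainder of each term by
    [B m * (x - s) ^ 2], and these bounds are summable. *)
Lemma is_derive_series (g g' g'' : nat -> R -> R) (B : nat -> R) (G : R -> R) s L d :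
  0 < d ->
  (forall m x, Rabs (x - s) < d -> is_derive (g m) x (g' m x)) ->
  (forall m x, Rabs (x - s) < d -> is_derive (g' m) x (g'' m x)) ->
  (forall m x, Rabs (x - s) < d -> Rabs (g'' m x) <= B m) ->
  ex_series B ->
  (forall x, Rabs (x - s) < d -> is_series (fun m => g m x) (G x)) ->
  is_series (fun m => g' m s) L ->
  is_derive G s L.
Proof.
  intros Hd H1 H2 H3 [b Hb] H4 H5.
  apply (is_derive_of_quadratic G s L b d); auto.
  intros x Hx.
  assert (Q : forall m, Rabs (g m x - g m s - (x - s) * g' m s) <= B m * (x - s) ^ 2).
  { intros m.
    (* The term minus its linear part at [s]; its derivative [g' m y - g' m s] is small by the
       second application. *)
    pose (k := fun y => g m y - (y - s) * g' m s).
    replace (g m x - g m s - (x - s) * g' m s) with (k x - k s) by (unfold k; ring).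
    replace (B m * (x - s) ^ 2) with (B m * Rabs (x - s) * Rabs (x - s))
      by (rewrite <- (pow2_abs (x - s)); ring).
    apply (mvt_abs k (fun y => g' m y - g' m s)).
    - intros y Hy; unfold k.
      assert (D := H1 m y ltac:(lra)).
      auto_derive; [exists (g' m y); exact D | ].
      replace (Derive (fun x0 => g m x0) y) with (g' m y)
        by (symmetry; apply is_derive_unique; exact D).
      ring.
    - intros y Hy; apply Rle_trans with (B m * Rabs (y - s)).
      + apply (mvt_abs (g' m) (g'' m)).
        * intros z Hz; apply H2; lra.
        * intros z Hz; apply H3; lra.
      + apply Rmult_le_compat_l; auto.
        eapply Rle_trans; [apply Rabs_pos | apply (H3 m s)].
        rewrite Rminus_diag, Rabs_R0; auto. }
  assert (S1 := is_series_minus _ _ _ _ (is_series_minus _ _ _ _ (H4 x Hx)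
    (H4 s ltac:(rewrite Rminus_diag, Rabs_R0; auto)))
    (is_series_scal_l (x - s) _ _ H5)).
  assert (S2 := is_series_scal_r ((x - s) ^ 2) _ _ Hb).
  exact (is_series_abs_le _ _ _ _ Q S1 S2).
Qed.

Lemma slice_slice b p x s : slice b (slice b p x) s = slice b p s.
Proof. destruct b; reflexivity. Qed.

Lemma coord_slice b p x : coord b (slice b p x) = x.
Proof. destruct b; reflexivity. Qed.

Lemma Cmod_slice b p x : Cmod (slice b p x) <= Cmod p + Rabs (x - coord b p).
Proof.
  replace (slice b p x : C) with (Cplus p (Cmult (dz b) (RtoC (x - coord b p))))
    by (destruct b, p; apply injective_projections; simpl; ring).
  eapply Rle_trans; [apply Cmod_triangle | ].
  rewrite Cmod_mult, Cmod_dz, Cmod_R; lra.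
Qed.

Lemma isD_slice b f p x l :
  isD b f (slice b p x) l -> cder (fun s => f (slice b p s)) x l.
Proof.
  unfold isD; rewrite coord_slice.
  intros [H1 H2]; split.
  - eapply is_derive_ext; [ | exact H1]; intros t; cbv beta; rewrite slice_slice; reflexivity.
  - eapply is_derive_ext; [ | exact H2]; intros t; cbv beta; rewrite slice_slice; reflexivity.
Qed.

Lemma is_series_prepend_0 (a : nat -> R) l :
  a 0%nat = 0 -> is_series (fun m => a (S m)) l -> is_series a l.
Proof.
  intros H0 H; apply is_series_decr_1.
  rewrite H0; unfold plus, opp; simpl.
  rewrite Ropp_0, Rplus_0_r; exact H.
Qed.

Section Derivative.

Variables (r : Rbar) (fs : nat -> pt -> C) (f : pt -> C).
Hypothesis Hrep : rep r fs f.

Lemma rep_derivative b p : disk r p ->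
  exists L, cser (fun m => dpart b (fs (S m)) p) L /\ isD b f p L.
Proof.
  destruct Hrep as [N [H1 [H2 H3]]]; intros Hp.
  destruct (Rbar_lt_between _ _ Hp) as [rho [Hrho Hrho']].
  change (Cmod p < rho) in Hrho.
  assert (Hr0 : 0 <= rho) by (assert (X := Cmod_ge_0 p); lra).
  pose (N1 := fun m => INR (S m) * N (S m)).
  assert (R1 : rad r N1).
  { apply (rad_shift _ (fun m => INR m * N m)).
    apply (rad_le _ (fun m => (INR m + 1) * N m)); [ | apply rad_lin; auto].
    intros m; assert (X := pos_INR m); assert (Y := proj1 H2 m); nra. }
  pose (N2 := fun m => INR (S m) * N1 (S m)).
  assert (R2 : rad r N2).
  { apply (rad_shift _ (fun m => INR m * N1 m)).
    apply (rad_le _ (fun m => (INR m + 1) * N1 m)); [ | apply rad_lin; auto].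
    intros m; assert (X := pos_INR m); assert (Y := proj1 R1 m); nra. }
  assert (D1 : forall m, hom m (dpart b (fs (S m))) (N1 m)) by (intros; apply hom_dpart; auto).
  assert (D2 : forall m, hom m (dpart b (dpart b (fs (S (S m))))) (N2 m))
    by (intros; apply hom_dpart; auto).
  destruct (ex_cser_abs (fun m => dpart b (fs (S m)) p) (fun m => N1 m * Cmod p ^ m))
    as [L HL].
  { intros; apply Cmod_hom; auto. }
  { apply (rad_series_disk _ _ _ R1 Hp). }
  exists L; split; auto.
  (* Degrees 0 and 1 have zero second derivatives. From degree 2 on the bound is uniform on the disk
     of radius [rho], which contains the slices near [p]. *)
  pose (B := fun m => match m with S (S k) => N2 k * rho ^ k | _ => 0 end).
  assert (HB : ex_series B).
  { apply (ex_series_incr_n B 2); simpl.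
    apply (rad_series _ _ _ R2); auto. }
  assert (Hm : forall m, exists k M, hom k (dpart b (fs m)) M).
  { intros [ | m]; [ | exists m, (N1 m); auto].
    exists 0%nat, 0; apply (hom_ext _ (fun _ => RtoC 0)); [apply hom_0 | ].
    intros; eapply dpart_hom0; eauto. }
  assert (Hbnd : forall m x, Rabs (x - coord b p) < rho - Cmod p ->
    Cmod (dpart b (dpart b (fs m)) (slice b p x)) <= B m).
  { intros m x Hx; destruct m as [ | [ | m]].
    - simpl; replace (dpart b (fs 0%nat)) with (fun _ : pt => RtoC 0).
      + rewrite (dpart_hom0 _ _ 0); [rewrite Cmod_0; lra | apply hom_0].
      + apply functional_extensionality; intros; symmetry; eapply dpart_hom0; eauto.
    - simpl; rewrite (dpart_hom0 _ _ (N1 0%nat)); [rewrite Cmod_0; lra | apply D1].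
    - simpl; eapply Rle_trans; [apply Cmod_hom; auto | ].
      apply Rmult_le_compat_l; [apply (proj1 R2) | ].
      apply pow_incr; split; [apply Cmod_ge_0 | ].
      eapply Rle_trans; [apply Cmod_slice | lra]. }
  assert (Hdisk : forall x, Rabs (x - coord b p) < rho - Cmod p -> disk r (slice b p x)).
  { intros x Hx; apply disk_Cmod; eapply Rbar_le_lt_trans; [ | apply Hrho'].
    simpl; eapply Rle_trans; [apply Cmod_slice | lra]. }
  (* [HL] is indexed by the lowered degree; the vanishing derivative of the constant part restores
     the index 0. *)
  assert (HL0 : cser (fun m => dpart b (fs m) (slice b p (coord b p))) L).
  { rewrite slice_coord; destruct HL as [L1 L2].
    assert (Z : dpart b (fs 0%nat) p = RtoC 0) by (eapply dpart_hom0; eauto).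
    split; apply is_series_prepend_0; auto; rewrite Z; reflexivity. }
  split.
  - apply (is_derive_series (fun m s => fst (fs m (slice b p s)))
      (fun m s => fst (dpart b (fs m) (slice b p s)))
      (fun m s => fst (dpart b (dpart b (fs m)) (slice b p s))) B _ _ _ (rho - Cmod p)); auto.
    + lra.
    + intros m x Hx; apply (isD_slice b (fs m)); eapply isD_hom; eauto.
    + intros m x Hx; destruct (Hm m) as [k [M HM]].
      apply (isD_slice b (dpart b (fs m))); eapply isD_hom; eauto.
    + intros m x Hx; eapply Rle_trans; [apply Rabs_fst_le | auto].
    + intros x Hx; apply (H3 _ (Hdisk x Hx)).
    + apply HL0.
  - apply (is_derive_series (fun m s => snd (fs m (slice b p s)))
      (fun m s => snd (dpart b (fs m) (slice b p s)))
      (fun m s => snd (dpart b (dpart b (fs m)) (slice b p s))) B _ _ _ (rho - Cmod p)); auto.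
    + lra.
    + intros m x Hx; apply (isD_slice b (fs m)); eapply isD_hom; eauto.
    + intros m x Hx; destruct (Hm m) as [k [M HM]].
      apply (isD_slice b (dpart b (fs m))); eapply isD_hom; eauto.
    + intros m x Hx; eapply Rle_trans; [apply Rabs_snd_le | auto].
    + intros x Hx; apply (H3 _ (Hdisk x Hx)).
    + apply HL0.
Qed.

Lemma rep_isD b p : disk r p -> isD b f p (dpart b f p).
Proof.
  intros Hp; destruct (rep_derivative b p Hp) as [L [_ HL]].
  rewrite (isD_dpart _ _ _ _ HL); auto.
Qed.

Lemma rep_dpart b : rep r (fun m => dpart b (fs (S m))) (dpart b f).
Proof.
  destruct Hrep as [N [H1 [H2 H3]]].
  exists (fun m => INR (S m) * N (S m)); split; [ | split].
  - intros; apply hom_dpart; auto.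
  - apply (rad_shift _ (fun m => INR m * N m)).
    apply (rad_le _ (fun m => (INR m + 1) * N m)); [ | apply rad_lin; auto].
    intros m; assert (X := pos_INR m); assert (Y := proj1 H2 m); nra.
  - intros p Hp; destruct (rep_derivative b p Hp) as [L [HL1 HL2]].
    rewrite (isD_dpart _ _ _ _ HL2); auto.
Qed.

End Derivative.

Lemma rep_lap r fs f : rep r fs f -> rep r (fun m => lap (fs (S (S m)))) (lap f).
Proof.
  intros H.
  apply (rep_plus r (fun m => dpart true (dpart true (fs (S (S m)))))
    (fun m => dpart false (dpart false (fs (S (S m)))))
    (dpart true (dpart true f)) (dpart false (dpart false f))).
  - apply (rep_dpart _ _ _ (rep_dpart _ _ _ H true) true).
  - apply (rep_dpart _ _ _ (rep_dpart _ _ _ H false) false).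
Qed.

Lemma rep_bilap r fs f : rep r fs f -> rep r (fun m => bilap (fs (4 + m)%nat)) (bilap f).
Proof. intros H; apply (rep_lap _ _ _ (rep_lap _ _ _ H)). Qed.

Lemma rep_locally_bounded r fs f rho :
  rep r fs f -> 0 <= rho -> Rbar_lt rho r ->
  exists M, forall p, Cmod p <= rho -> Rabs (fst (f p)) <= M /\ Rabs (snd (f p)) <= M.
Proof.
  intros [N [H1 [H2 H3]]] Hr Hlt.
  destruct (rad_series _ _ _ H2 Hr Hlt) as [M HM]; exists M; intros p Hp.
  apply (cser_le (fun m => fs m p) (fun m => N m * rho ^ m)); auto.
  - intros m; eapply Rle_trans; [apply Cmod_hom; auto | ].
    apply Rmult_le_compat_l; [apply (proj1 H2) | ].
    apply pow_incr; split; auto; apply Cmod_ge_0.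
  - apply H3, disk_Cmod; eapply Rbar_le_lt_trans; [ | apply Hlt]; auto.
Qed.

Lemma continuous_of_lipschitz (f : pt -> C) p d K :
  0 < d ->
  (forall q, Rabs (fst q - fst p) < d -> Rabs (snd q - snd p) < d ->
     Rabs (fst (f q) - fst (f p)) <= K * (Rabs (fst q - fst p) + Rabs (snd q - snd p)) /\
     Rabs (snd (f q) - snd (f p)) <= K * (Rabs (fst q - fst p) + Rabs (snd q - snd p))) ->
  continuous f p.
Proof.
  intros Hd H; apply filterlim_locally; intros eps.
  assert (HK : 0 < Rabs K + 1) by (assert (X := Rabs_pos K); lra).
  assert (He : 0 < eps / (2 * (Rabs K + 1)))
    by (apply Rdiv_lt_0_compat; [apply cond_pos | lra]).
  assert (Hdel : 0 < Rmin d (eps / (2 * (Rabs K + 1)))) by (apply Rmin_pos; auto).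
  exists (mkposreal _ Hdel); intros q; change pt in q; intros [Hq1 Hq2].
  change (Rabs (fst q - fst p) < Rmin d (eps / (2 * (Rabs K + 1)))) in Hq1.
  change (Rabs (snd q - snd p) < Rmin d (eps / (2 * (Rabs K + 1)))) in Hq2.
  assert (M1 := Rmin_l d (eps / (2 * (Rabs K + 1)))).
  assert (M2 := Rmin_r d (eps / (2 * (Rabs K + 1)))).
  destruct (H q) as [A1 A2]; [lra | lra | ].
  set (u := Rabs (fst q - fst p)) in *; set (v := Rabs (snd q - snd p)) in *.
  assert (B : K * (u + v) < eps).
  { assert (Hu : 0 <= u) by apply Rabs_pos; assert (Hv : 0 <= v) by apply Rabs_pos.
    apply Rle_lt_trans with ((Rabs K + 1) * (u + v)).
    - apply Rmult_le_compat_r; [lra | ]; assert (X := Rle_abs K); lra.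
    - replace (pos eps) with ((Rabs K + 1) * (2 * (eps / (2 * (Rabs K + 1))))) by (field; lra).
      apply Rmult_lt_compat_l; lra. }
  split; [change (Rabs (fst (f q) - fst (f p)) < eps) | change (Rabs (snd (f q) - snd (f p)) < eps)]; lra.
Qed.

(** Both partial derivatives are bounded on a smaller disk, so [f] is Lipschitz near [p]: one moves
    first horizontally, then vertically. *)
Lemma rep_continuous r fs f p : rep r fs f -> disk r p -> continuous f p.
Proof.
  intros H Hp.
  destruct (Rbar_lt_between _ _ Hp) as [rho [Hrho Hrho']].
  change (Cmod p < rho) in Hrho.
  assert (Hr0 : 0 <= rho) by (assert (X := Cmod_ge_0 p); lra).
  destruct (rep_locally_bounded _ _ _ rho (rep_dpart _ _ _ H true) Hr0 Hrho') as [M1 HM1].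
  destruct (rep_locally_bounded _ _ _ rho (rep_dpart _ _ _ H false) Hr0 Hrho') as [M2 HM2].
  (* Half of the gap, because two moves shorter than [d] are made. *)
  pose (d := (rho - Cmod p) / 2).
  assert (Hdisk : forall q, Cmod q <= rho -> disk r q).
  { intros q Hq; apply disk_Cmod; eapply Rbar_le_lt_trans; [ | apply Hrho']; auto. }
  pose (M := Rmax M1 M2).
  assert (HB : forall b q, Cmod q <= rho ->
    Rabs (fst (dpart b f q)) <= M /\ Rabs (snd (dpart b f q)) <= M).
  { intros b q Hq; assert (X1 := Rmax_l M1 M2); assert (X2 := Rmax_r M1 M2).
    destruct b; [destruct (HM1 q Hq) | destruct (HM2 q Hq)]; unfold M; split; lra. }
  assert (STEP : forall b q x, Cmod q + Rabs (x - coord b q) <= rho ->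
    Rabs (fst (f (slice b q x)) - fst (f q)) <= M * Rabs (x - coord b q) /\
    Rabs (snd (f (slice b q x)) - snd (f q)) <= M * Rabs (x - coord b q)).
  { intros b q x Hx.
    assert (Y : forall y, Rabs (y - coord b q) <= Rabs (x - coord b q) ->
      Cmod (slice b q y) <= rho).
    { intros y Hy; eapply Rle_trans; [apply Cmod_slice | lra]. }
    rewrite <- (slice_coord b q) at 2 5.
    split.
    - apply (mvt_abs (fun s => fst (f (slice b q s))) (fun s => fst (dpart b f (slice b q s)))).
      + intros y Hy; apply (isD_slice b f); eapply rep_isD; eauto.
      + intros y Hy; apply HB; auto.
    - apply (mvt_abs (fun s => snd (f (slice b q s))) (fun s => snd (dpart b f (slice b q s)))).
      + intros y Hy; apply (isD_slice b f); eapply rep_isD; eauto.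
      + intros y Hy; apply HB; auto. }
  apply (continuous_of_lipschitz f p d M); [unfold d; lra | ].
  intros q Hq1 Hq2; unfold d in *.
  destruct (STEP true p (fst q)) as [A1 A2]; [simpl; lra | ].
  assert (C1 := Cmod_slice true p (fst q)).
  destruct (STEP false (slice true p (fst q)) (snd q)) as [B1 B2].
  { simpl in *; lra. }
  replace (slice false (slice true p (fst q)) (snd q)) with q in B1, B2 by (destruct q; reflexivity).
  simpl coord in *; simpl snd in B1, B2.
  change (snd (slice true p (fst q))) with (snd p) in *.
  split.
  - replace (fst (f q) - fst (f p)) with
      ((fst (f q) - fst (f (slice true p (fst q)))) + (fst (f (slice true p (fst q))) - fst (f p))) by ring.
    eapply Rle_trans; [apply Rabs_triang | simpl in *; lra].
  - replace (snd (f q) - snd (f p)) with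
      ((snd (f q) - snd (f (slice true p (fst q)))) + (snd (f (slice true p (fst q))) - snd (f p))) by ring.
    eapply Rle_trans; [apply Rabs_triang | simpl in *; lra].
Qed.

Lemma rep_iter_d r fs f w : rep r fs f -> exists gs, rep r gs (iter_d w f).
Proof.
  intros H; induction w as [ | b w [gs IH]]; simpl; [exists fs; auto | ].
  exists (fun m => dpart b (gs (S m))); apply rep_dpart; auto.
Qed.

Lemma rep_smooth r fs f : rep r fs f -> smooth_on (disk r) f.
Proof.
  intros H w; destruct (rep_iter_d _ _ _ w H) as [gs Hg]; split.
  - intros p Hp; eapply rep_continuous; eauto.
  - intros b p Hp; eapply isD_ex, rep_isD; eauto.
Qed.

(** * Taylor polynomials *)

Lemma disk_slice_locally r b p :
  disk r p -> locally (coord b p) (fun s => disk r (slice b p s)).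
Proof.
  intros Hp; destruct (Rbar_lt_between _ _ Hp) as [rho [Hrho Hrho']].
  change (Cmod p < rho) in Hrho.
  assert (Hd : 0 < rho - Cmod p) by lra.
  exists (mkposreal _ Hd); intros s Hs.
  change (Rabs (s - coord b p) < rho - Cmod p) in Hs.
  apply disk_Cmod; eapply Rbar_le_lt_trans; [ | apply Hrho'].
  simpl; eapply Rle_trans; [apply Cmod_slice | lra].
Qed.

Lemma dpart_ext_disk r f g b p :
  (forall q, disk r q -> f q = g q) -> disk r p -> dpart b f p = dpart b g p.
Proof.
  intros H Hp; unfold dpart; f_equal; apply Derive_ext_loc;
    eapply filter_imp; [ | apply (disk_slice_locally _ b _ Hp) | | apply (disk_slice_locally _ b _ Hp)];
    intros s Hs; cbv beta; rewrite H; auto.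
Qed.

Lemma iter_d_ext_disk r f g w :
  (forall q, disk r q -> f q = g q) ->
  forall p, disk r p -> iter_d w f p = iter_d w g p.
Proof.
  intros H; induction w; simpl; auto.
  intros p Hp; eapply dpart_ext_disk; eauto.
Qed.

Lemma iter_d_app w w' f : iter_d (w ++ w') f = iter_d w (iter_d w' f).
Proof. induction w; simpl; [ | rewrite IHw]; reflexivity. Qed.

(** Both sides are sums of second derivatives of the same parts, and for polynomials these
    commute. *)
Lemma rep_dpart_comm r fs f p : rep r fs f -> disk r p ->
  dpart true (dpart false f) p = dpart false (dpart true f) p.
Proof.
  intros H Hp.
  destruct (rep_dpart _ _ _ (rep_dpart _ _ _ H true) false) as [N1 [_ [_ S1]]].
  destruct (rep_dpart _ _ _ (rep_dpart _ _ _ H false) true) as [N2 [_ [_ S2]]].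
  eapply cser_unique; [apply (S2 p Hp) | ].
  eapply cser_ext; [ | apply (S1 p Hp)].
  intros m; cbv beta; destruct H as [N [H1 _]].
  rewrite (dpart_comm_hom _ _ _ (H1 (S (S m)))); reflexivity.
Qed.

Lemma iter_d_false_true r fs f j p : rep r fs f -> disk r p ->
  iter_d (repeat false j) (dpart true f) p = dpart true (iter_d (repeat false j) f) p.
Proof.
  intros H; revert p; induction j; simpl; auto.
  intros p Hp; rewrite (dpart_ext_disk r _ _ false p IHj Hp).
  destruct (rep_iter_d _ _ _ (repeat false j) H) as [gs Hg].
  symmetry; eapply rep_dpart_comm; eauto.
Qed.

(** [dxy] takes the y-derivatives first, so an inner x-derivative must be carried through them; the
    companion for y needs no exchange. *)
Lemma dxy_dpart_true r fs f k j p : rep r fs f -> disk r p ->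
  dxy k j (dpart true f) p = dxy (S k) j f p.
Proof.
  intros H Hp; unfold dxy; rewrite !iter_d_app.
  rewrite (iter_d_ext_disk r _ (dpart true (iter_d (repeat false j) f)) _
    (fun q => iter_d_false_true r fs f j q H) p Hp).
  change (repeat true (S k)) with (true :: repeat true k).
  rewrite repeat_cons, iter_d_app; reflexivity.
Qed.

Lemma dxy_dpart_false f k j : dxy k j (dpart false f) = dxy k (S j) f.
Proof.
  unfold dxy; rewrite !iter_d_app.
  change (repeat false (S j)) with (false :: repeat false j).
  rewrite (repeat_cons j), iter_d_app; reflexivity.
Qed.

Lemma csum_recl n f : csum (S n) f = Cplus (f 0%nat) (csum n (fun k => f (S k))).
Proof. change (S n) with (1 + n)%nat; rewrite csum_add; simpl; ring. Qed.

Lemma disk_0 r : Rbar_lt 0 r -> disk r (0, 0).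
Proof.
  intros Hr; apply disk_Cmod.
  replace (Cmod (0, 0)) with 0 by (symmetry; exact Cmod_0); exact Hr.
Qed.

(** In the coefficient of x^k y^(m+1-k) write m + 1 = k + (m + 1 - k): each summand cancels a factor
    of one factorial. The term k = 0 drops out of the first sum and k = m + 1 out of the second. *)
Lemma taylor_hom_euler r fs f m p : rep r fs f -> Rbar_lt 0 r ->
  Cmult (INR (S m)) (taylor_hom f (S m) p) =
  Cplus (Cmult (fst p) (taylor_hom (dpart true f) m p))
        (Cmult (snd p) (taylor_hom (dpart false f) m p)).
Proof.
  intros H Hr; unfold taylor_hom; rewrite !csum_sum_n.
  assert (H0 := disk_0 _ Hr).
  pose (T := fun k j => Cmult (RtoC (fst p ^ k * snd p ^ j / (INR (fact k) * INR (fact j))))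
    (dxy k j f (0, 0))).
  rewrite <- csum_scal.
  rewrite (csum_ext _ _ (fun k => Cplus (Cmult (INR k) (T k (S m - k)%nat))
     (Cmult (INR (S m - k)) (T k (S m - k)%nat)))).
  2: { intros k Hk; fold (T k (S m - k)%nat).
       replace (INR (S m)) with (INR k + INR (S m - k)) by (rewrite <- plus_INR; f_equal; lia).
       rewrite RtoC_plus; ring. }
  rewrite csum_plus; f_equal.
  - rewrite csum_recl, <- csum_scal.
    rewrite (csum_ext (S m) (fun k => Cmult (fst p) _)
      (fun k => Cmult (INR (S k)) (T (S k) (S m - S k)%nat))); [simpl INR at 1; ring | ].
    intros k Hk; simpl Nat.sub; rewrite (dxy_dpart_true r fs f k _ _ H H0).
    unfold T; rewrite !Cmult_assoc; f_equal.
    rewrite <- !RtoC_mult; f_equal.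
    change (fact (S k)) with (S k * fact k)%nat; rewrite mult_INR.
    simpl pow; field.
    repeat split; try apply INR_fact_neq_0; apply not_0_INR; lia.
  - assert (R1 : forall g, csum (S (S m)) g = Cplus (csum (S m) g) (g (S m))) by reflexivity.
    rewrite R1; clear R1.
    rewrite Nat.sub_diag; simpl (INR 0).
    rewrite <- csum_scal.
    rewrite (csum_ext (S m) (fun k => Cmult (snd p) _)
      (fun k => Cmult (INR (S m - k)) (T k (S m - k)%nat))); [ring | ].
    intros k Hk; rewrite dxy_dpart_false.
    replace (S m - k)%nat with (S (m - k)) by lia.
    unfold T; rewrite !Cmult_assoc; f_equal.
    rewrite <- !RtoC_mult; f_equal.
    change (fact (S (m - k))) with (S (m - k) * fact (m - k))%nat; rewrite mult_INR.
    simpl pow; field.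
    repeat split; try apply INR_fact_neq_0; apply not_0_INR; lia.
Qed.

Lemma hom_at_0 m h N : hom (S m) h N -> h (0, 0) = RtoC 0.
Proof.
  intros H; apply Cmod_eq_0, Rle_antisym; [ | apply Cmod_ge_0].
  eapply Rle_trans; [apply (Cmod_hom _ _ _ _ H) | ].
  replace (Cmod (0, 0)) with 0 by (symmetry; exact Cmod_0); simpl; lra.
Qed.

Lemma hom_degree_0 h N p q : hom 0 h N -> h p = h q.
Proof.
  intros [a [H _]]; rewrite !H; unfold ev, mono; simpl; ring.
Qed.

Lemma is_series_0 : is_series (fun _ : nat => 0) 0.
Proof.
  apply (filterlim_ext (fun _ => 0)); [ | apply filterlim_const].
  intros n; rewrite rsum_sum_n, rsum_const; ring.
Qed.

(** Taylor polynomials and parts agree at the origin in degree 0 and satisfy the same Euler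
    recursion. The induction hypothesis is needed for both partial derivatives, hence the
    generalization over [fs] and [f]. *)
Lemma taylor_hom_rep r fs f m p :
  rep r fs f -> Rbar_lt 0 r -> taylor_hom f m p = fs m p.
Proof.
  intros H Hr; revert fs f H p; induction m; intros fs f H p.
  - destruct H as [N [H1 [H2 H3]]].
    assert (H0 := disk_0 _ Hr).
    assert (E : f (0, 0) = fs 0%nat (0, 0)).
    { apply (cser_unique (fun m => fs m (0, 0))); auto.
      assert (Z : forall m, fs (S m) (0, 0) = RtoC 0) by (intros; eapply hom_at_0; eauto).
      split; apply is_series_decr_1;
        unfold plus, opp; simpl; rewrite Rplus_opp_r;
        (eapply is_series_ext; [ | exact is_series_0]); intros m; cbv beta; rewrite Z; reflexivity. }
    unfold taylor_hom; rewrite sum_O; simpl.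
    unfold dxy; simpl.
    rewrite (hom_degree_0 _ _ p (0, 0) (H1 0%nat)), <- E.
    replace (1 * 1 / (1 * 1)) with 1 by field; ring.
  - assert (E := taylor_hom_euler _ _ _ m p H Hr).
    rewrite (IHm _ _ (rep_dpart _ _ _ H true)), (IHm _ _ (rep_dpart _ _ _ H false)) in E.
    destruct H as [N [H1 _]].
    rewrite <- (euler_hom _ _ _ p (H1 (S m))) in E.
    assert (Hn : RtoC (INR (S m)) <> RtoC 0).
    { intros X; apply RtoC_inj in X; revert X; apply not_0_INR; lia. }
    apply (f_equal (Cmult (/ RtoC (INR (S m))))) in E.
    rewrite !Cmult_assoc, Cinv_l, !Cmult_1_l in E; auto.
Qed.

Lemma rep_parts_unique r fs gs f :
  rep r fs f -> rep r gs f -> Rbar_lt 0 r -> forall m p, fs m p = gs m p.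
Proof.
  intros H1 H2 Hr m p.
  rewrite <- (taylor_hom_rep _ _ _ m p H1 Hr); eapply taylor_hom_rep; eauto.
Qed.

Lemma rep_0 r : rep r (fun _ _ => RtoC 0) (fun _ => RtoC 0).
Proof.
  exists (fun _ => 0); split; [ | split].
  - intros; apply hom_0.
  - split; [intros; lra | ]; intros; exists 0; intros; lra.
  - intros p _.
    split; apply is_series_0.
Qed.

Lemma rep_null_parts r fs f :
  rep r fs f -> Rbar_lt 0 r -> (forall p, disk r p -> f p = RtoC 0) ->
  forall m p, fs m p = RtoC 0.
Proof.
  intros H Hr H0; apply (rep_parts_unique r fs (fun _ _ => RtoC 0) f); auto.
  apply (rep_ext _ _ (fun _ => RtoC 0)); auto; apply rep_0.
Qed.

(** * The algebra [A(B_r)] *)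

Lemma Cmod_open_ball rho : open (fun p : pt => Cmod p < rho).
Proof.
  intros p Hp.
  assert (Hd : 0 < (rho - Cmod p) / 2) by lra.
  exists (mkposreal _ Hd); intros q; change pt in q; intros [H1 H2].
  change (Rabs (fst q - fst p) < (rho - Cmod p) / 2) in H1.
  change (Rabs (snd q - snd p) < (rho - Cmod p) / 2) in H2.
  replace (q : C) with (Cplus p (Cminus q p)) by ring.
  eapply Rle_lt_trans; [apply Cmod_triangle | ].
  assert (X : Cmod (Cminus q p) <= Rabs (fst q - fst p) + Rabs (snd q - snd p))
    by apply Cmod_le_components.
  lra.
Qed.

Lemma compact_in_smaller_disk r K :
  Rbar_lt 0 r -> compact_set K -> (forall p, K p -> disk r p) ->
  exists rho, 0 <= rho /\ Rbar_lt rho r /\ forall p, K p -> Cmod p <= rho.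
Proof.
  intros Hr HK Hsub.
  (* The clause [Rbar_lt rho r] empties the sets of too large index, so only radii below [r] count
     in the finite subcover. *)
  destruct (HK R (fun rho p => Cmod p < rho /\ Rbar_lt rho r)) as [l Hl].
  - intros rho; destruct (Rbar_lt_dec rho r) as [Hlt | Hlt].
    + apply (open_ext (fun p => Cmod p < rho)); [ | apply Cmod_open_ball].
      intros p; split; [auto | intros [A _]; auto].
    + apply (open_ext (fun _ => False)); [ | apply open_false].
      intros p; split; [contradiction | intros [_ A]; auto].
  - intros p Hp; apply (Rbar_lt_between _ _ (Hsub p Hp)).
  - assert (G : exists rho, 0 <= rho /\ Rbar_lt rho r /\
      forall x, In x l -> Rbar_lt x r -> x <= rho).
    { clear Hl; induction l as [ | x l [rho [A [B D]]]].
      - exists 0; split; [lra | split; auto]; intros x [].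
      - destruct (Rbar_lt_dec x r) as [Hlt | Hlt].
        + exists (Rmax rho x); split; [ | split].
          * eapply Rle_trans; [apply A | apply Rmax_l].
          * unfold Rmax; destruct (Rle_dec rho x); auto.
          * intros y [-> | Hy] Hy'; [apply Rmax_r | ].
            eapply Rle_trans; [apply D; auto | apply Rmax_l].
        + exists rho; split; [ | split]; auto.
          intros y [-> | Hy] Hy'; [contradiction | auto]. }
    destruct G as [rho [A [B D]]]; exists rho; split; [ | split]; auto.
    intros p Hp; destruct (Hl p Hp) as [x [Hx [H1 H2]]].
    specialize (D x Hx H2); lra.
Qed.

Lemma rep_inA r fs f : Rbar_lt 0 r -> rep r fs f -> inA r f.
Proof.
  intros Hr H; split; [eapply rep_smooth; eauto | ].
  intros K HK Hsub.
  destruct (compact_in_smaller_disk r K Hr HK Hsub) as [rho [Hr0 [Hlt Hrho]]].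
  assert (ET : forall m p, taylor_hom f m p = fs m p) by (intros; eapply taylor_hom_rep; eauto).
  destruct H as [N [H1 [H2 H3]]].
  assert (Hex := rad_series _ _ _ H2 Hr0 Hlt).
  assert (HB : forall m p, K p -> Cmod (fs m p) <= N m * rho ^ m).
  { intros m p Hp; eapply Rle_trans; [apply Cmod_hom; auto | ].
    apply Rmult_le_compat_l; [apply (proj1 H2) | ].
    apply pow_incr; split; auto; apply Cmod_ge_0. }
  split; intros eps Heps.
  - destruct (Cauchy_ex_series _ Hex (mkposreal _ Heps)) as [M HM].
    exists M; intros n p Hn Hp.
    eapply Rle_lt_trans; [ | eapply Rle_lt_trans; [apply Rle_abs | apply (HM M n); auto with arith]].
    apply sum_n_m_le; intros m; rewrite ET; auto.
  - destruct Hex as [S0 HS]; change R in S0.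
    (* The two components of the tail are each at most eps / 3, which keeps its modulus below
       eps. *)
    assert (Heps2 : 0 < eps / 3) by lra.
    destruct (proj1 (filterlim_locally _ _) HS (mkposreal _ Heps2)) as [M HM].
    exists M; intros n p Hn Hp.
    specialize (HM n Hn).
    change (Rabs (sum_n (fun m => N m * rho ^ m) n - S0) < eps / 3) in HM.
    assert (Hdp := Hsub p Hp).
    assert (T1 : is_series (fun k => N (S n + k)%nat * rho ^ (S n + k))
                   (S0 - sum_n (fun m => N m * rho ^ m) n)).
    { apply (is_series_incr_n (K := R_AbsRing) (V := R_NormedModule)
        (fun m => N m * rho ^ m) (S n)); [lia | ].
      apply (@eq_rect R S0 (is_series (fun m => N m * rho ^ m)) HS).
      unfold plus; simpl.
      change (@eq R S0 (S0 - sum_n (fun m => N m * rho ^ m) n + sum_n (fun m => N m * rho ^ m) n)).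
      ring. }
    destruct (H3 p Hdp) as [F1 F2].
    assert (T2 : cser (fun k => fs (S n + k)%nat p)
                   (Cminus (f p) (sum_n (fun m => taylor_hom f m p) n))).
    { rewrite (sum_n_ext _ (fun m => fs m p)) by (intros; apply ET).
      rewrite csum_sum_n; split; cbn [fst snd Cminus Cplus Copp].
      - apply (is_series_incr_n (K := R_AbsRing) (V := R_NormedModule)
          (fun m => fst (fs m p)) (S n)); [lia | ].
        apply (@eq_rect R _ (is_series (fun m => fst (fs m p))) F1).
        simpl pred; rewrite rsum_sum_n, <- fst_csum.
        match goal with |- _ = plus ?u ?v => change (@eq R (fst (f p)) (u + v)) end; ring.
      - apply (is_series_incr_n (K := R_AbsRing) (V := R_NormedModule)
          (fun m => snd (fs m p)) (S n)); [lia | ].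
        apply (@eq_rect R _ (is_series (fun m => snd (fs m p))) F2).
        simpl pred; rewrite rsum_sum_n, <- snd_csum.
        match goal with |- _ = plus ?u ?v => change (@eq R (snd (f p)) (u + v)) end; ring. }
    destruct (cser_le _ _ _ _ (fun k => HB (S n + k)%nat p Hp) T2 T1) as [A B].
    eapply Rle_lt_trans; [apply Cmod_le_components | ].
    assert (X : S0 - sum_n (fun m => N m * rho ^ m) n <= eps / 3).
    { rewrite Rabs_minus_sym in HM; assert (Y := Rle_abs (S0 - sum_n (fun m => N m * rho ^ m) n)); lra. }
    lra.
Qed.

(** * Characters on the circle and recovery of coefficients *)

Definition cis (s : R) : C := (cos s, sin s).

Lemma cis_plus a b : cis (a + b) = Cmult (cis a) (cis b).
Proof.
  apply injective_projections; simpl; [apply cos_plus | rewrite sin_plus; ring].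
Qed.

Lemma cis_0 : cis 0 = RtoC 1.
Proof. unfold cis; rewrite cos_0, sin_0; reflexivity. Qed.

Lemma Cmod_cis s : Cmod (cis s) = 1.
Proof.
  unfold Cmod, cis; simpl fst; simpl snd.
  replace (cos s ^ 2 + sin s ^ 2) with 1; [apply sqrt_1 | ].
  assert (H := sin2_cos2 s); unfold Rsqr in H; lra.
Qed.

Lemma Cconj_cis s : Cconj (cis s) = cis (- s).
Proof. unfold cis, Cconj; simpl; rewrite cos_neg, sin_neg; reflexivity. Qed.

Lemma cis_pow s n : Cpow (cis s) n = cis (INR n * s).
Proof.
  induction n; simpl Cpow.
  - simpl; rewrite Rmult_0_l, cis_0; reflexivity.
  - rewrite IHn, <- cis_plus, S_INR; f_equal; ring.
Qed.

Lemma mono_cis k j s : mono k j (cis s) = cis ((INR k - INR j) * s).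
Proof.
  unfold mono; rewrite Cconj_cis, !cis_pow, <- cis_plus; f_equal; ring.
Qed.

Lemma cis_2PI_INR k : cis (2 * PI * INR k) = RtoC 1.
Proof.
  rewrite Rmult_comm, <- cis_pow.
  replace (cis (2 * PI)) with (RtoC 1); [apply Cpow_1_l | ].
  unfold cis; rewrite cos_2PI, sin_2PI; reflexivity.
Qed.

Lemma cis_eq_1_sin x : cis x = RtoC 1 -> sin (x / 2) = 0.
Proof.
  intros H; apply (f_equal fst) in H; simpl in H.
  replace x with (2 * (x / 2)) in H by field.
  rewrite cos_2a_sin in H.
  assert (sin (x / 2) * sin (x / 2) = 0) by lra.
  destruct (Rmult_integral _ _ H0); auto.
Qed.

(** A geometric sum whose ratio has angle 2 PI (k - l) / (m + 1); the ratio differs from 1 because 0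
    < |k - l| < m + 1. *)
Lemma root_of_unity_sum m k l :
  (k <= m)%nat -> (l <= m)%nat -> k <> l ->
  csum (S m) (fun j => cis (2 * (INR k - INR l) * (PI * INR j / INR (S m)))) = RtoC 0.
Proof.
  intros Hk Hl Hne.
  assert (Hm : 0 < INR (S m)) by (apply lt_0_INR; lia).
  pose (x := 2 * PI * (INR k - INR l) / INR (S m)).
  rewrite (csum_ext _ _ (fun j => Cpow (cis x) j)).
  2: { intros j _; rewrite cis_pow; unfold x; f_equal; field; lra. }
  assert (G := csum_geom (S m) (cis x)).
  replace (Cpow (cis x) (S m)) with (RtoC 1) in G.
  2: { rewrite cis_pow; unfold x.
       replace (INR (S m) * (2 * PI * (INR k - INR l) / INR (S m)))
         with (2 * PI * INR k + - (2 * PI * INR l)) by (field; lra).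
       rewrite cis_plus, <- Cconj_cis, !cis_2PI_INR.
       apply injective_projections; simpl; ring. }
  replace (Cminus 1 1) with (RtoC 0) in G by ring.
  assert (Hx : Cminus (cis x) 1 <> 0).
  { intros E.
    assert (E1 : cis x = RtoC 1)
      by (replace (cis x) with (Cplus (Cminus (cis x) 1) 1) by ring; rewrite E; ring).
    apply cis_eq_1_sin in E1.
    assert (HPI := PI_RGT_0).
    assert (K1 : INR k <= INR m) by (apply le_INR; auto).
    assert (K2 : INR l <= INR m) by (apply le_INR; auto).
    assert (K3 := pos_INR k); assert (K4 := pos_INR l).
    assert (HS : INR (S m) = INR m + 1) by apply S_INR.
    assert (P : forall u, 0 < u -> u < INR (S m) -> 0 < sin (PI * u / INR (S m))).
    { intros u Hu1 Hu2; apply sin_gt_0.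
      - apply Rdiv_lt_0_compat; auto; apply Rmult_lt_0_compat; auto.
      - apply Rlt_div_l; auto; apply Rmult_lt_compat_l; auto. }
    destruct (Nat.lt_ge_cases l k) as [Hlt | Hge].
    - apply lt_INR in Hlt.
      assert (Q := P (INR k - INR l) ltac:(lra) ltac:(lra)).
      replace (x / 2) with (PI * (INR k - INR l) / INR (S m)) in E1 by (unfold x; field; lra).
      lra.
    - assert (Hlt : (k < l)%nat) by lia; apply lt_INR in Hlt.
      assert (Q := P (INR l - INR k) ltac:(lra) ltac:(lra)).
      replace (x / 2) with (- (PI * (INR l - INR k) / INR (S m))) in E1 by (unfold x; field; lra).
      rewrite sin_neg in E1; lra. }
  apply (f_equal (Cmult (/ Cminus (cis x) 1))) in G.
  rewrite Cmult_assoc, Cinv_l, Cmult_1_l, Cmult_0_r in G; auto.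
Qed.

(* A discrete Fourier transform over [m + 1] equidistributed points of the
   half circle isolates each coefficient. *)
Lemma ev_coef_bound m a M :
  (forall s, 0 <= s <= PI -> Cmod (ev m a (cis s)) <= M) ->
  forall l, (l <= m)%nat -> Cmod (a l) <= M.
Proof.
  intros H l Hl.
  assert (Hm : 0 < INR (S m)) by (apply lt_0_INR; lia).
  pose (th := fun j => PI * INR j / INR (S m)).
  (* On the circle the monomial of index k has frequency 2k - m, and [W] is the conjugate of the
     character of index [l]. Differences of frequencies are even, so half the circle suffices. *)
  pose (W := fun j => cis (- ((2 * INR l - INR m) * th j))).
  assert (E : csum (S m) (fun j => Cmult (W j) (ev m a (cis (th j)))) = Cmult (INR (S m)) (a l)).
  { rewrite (csum_ext _ _ (fun j => csum (S m) (fun k =>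
      Cmult (a k) (cis (2 * (INR k - INR l) * th j))))).
    2: { intros j _; unfold ev; rewrite <- csum_scal; apply csum_ext; intros k Hk.
         rewrite mono_cis, minus_INR by lia.
         transitivity (Cmult (a k) (Cmult (W j) (cis ((INR k - (INR m - INR k)) * th j)))); [ring | ].
         unfold W; rewrite <- cis_plus; do 2 f_equal; ring. }
    rewrite csum_swap, (csum_single _ _ l); [ | lia | ].
    - rewrite (csum_ext _ _ (fun _ => a l)).
      + generalize (S m); intros n; clear; induction n; simpl csum; [simpl; ring | ].
        rewrite IHn, S_INR, RtoC_plus; ring.
      + intros j _; replace (2 * (INR l - INR l) * th j) with 0 by ring.
        rewrite cis_0; ring.
    - intros k Hk Hne; rewrite csum_scal.
      unfold th; rewrite root_of_unity_sum by lia; ring. }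
  apply (Rmult_le_reg_l (INR (S m))); auto.
  rewrite <- (Cmod_INR (S m)) at 1; rewrite <- Cmod_mult, <- E.
  eapply Rle_trans; [apply Cmod_csum | ].
  rewrite <- rsum_const; apply rsum_le; intros j Hj.
  rewrite Cmod_mult; unfold W at 1; rewrite Cmod_cis, Rmult_1_l.
  apply H; unfold th; assert (HPI := PI_RGT_0); split.
  - apply Rdiv_le_0_compat; auto; apply Rmult_le_pos; [lra | apply pos_INR].
  - apply (proj2 (Rle_div_l _ _ _ Hm)), Rmult_le_compat_l; [lra | ].
    apply le_INR; lia.
Qed.

Lemma ev_zero_coef m a :
  (forall p, ev m a p = RtoC 0) -> forall l, (l <= m)%nat -> a l = RtoC 0.
Proof.
  intros H l Hl; apply Cmod_eq_0, Rle_antisym; [ | apply Cmod_ge_0].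
  apply (ev_coef_bound m a 0); auto.
  intros; rewrite H, Cmod_0; lra.
Qed.

(** * Compactness of half circles and points *)

Definition arc (rho : R) (p : pt) : Prop :=
  exists s, 0 <= s <= PI /\ p = (rho * cos s, rho * sin s).

Lemma arc_param_locally rho (U : pt -> Prop) s :
  open U -> U (rho * cos s, rho * sin s) ->
  exists d : posreal, forall x, Rabs (x - s) < d -> U (rho * cos x, rho * sin x).
Proof.
  intros HU Hs.
  assert (Hc : continuous (fun x => (rho * cos x, rho * sin x) : pt) s).
  { assert (C1 : continuous (fun x => rho * cos x) s)
      by (apply (ex_derive_continuous (V := R_NormedModule)); auto_derive; auto).
    assert (C2 : continuous (fun x => rho * sin x) s)
      by (apply (ex_derive_continuous (V := R_NormedModule)); auto_derive; auto).
    apply filterlim_locally; intros eps.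
    generalize (filter_and _ _ (proj1 (filterlim_locally _ _) C1 eps)
      (proj1 (filterlim_locally _ _) C2 eps)).
    apply filter_imp; intros x [A B]; split; assumption. }
  destruct (Hc _ (HU _ Hs)) as [d Hd]; exists d; intros x Hx; apply Hd; exact Hx.
Qed.

Lemma compact_arc rho : compact_set (arc rho).
Proof.
  intros I U HU Hcov.
  (* [Q] is void outside [0, PI], so that a gauge can be chosen at every real number. *)
  pose (Q := fun (s : R) (d : posreal) => 0 <= s <= PI ->
    exists i, forall x, Rabs (x - s) < d -> U i (rho * cos x, rho * sin x)).
  assert (HQ : forall s, exists d, Q s d).
  { intros s; destruct (classic (0 <= s <= PI)) as [Hs | Hs].
    - destruct (Hcov (rho * cos s, rho * sin s)) as [i Hi]; [exists s; auto | ].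
      destruct (arc_param_locally rho (U i) s (HU i) Hi) as [d Hd].
      exists d; intros _; exists i; auto.
    - exists (mkposreal 1 Rlt_0_1); intros X; contradiction. }
  assert (HD : exists D : R -> posreal, forall s, Q s (D s)).
  { exists (fun s => proj1_sig (constructive_indefinite_description _ (HQ s))).
    intros s; exact (proj2_sig (constructive_indefinite_description _ (HQ s))). }
  destruct HD as [D HD].
  (* Finitely many gauge intervals cover [0, PI]; its points are pairs with [tt] here because the
     compactness statement concerns boxes in n dimensions, with n = 1. *)
  assert (HL := NNPP _ (compactness_list 1 (0, tt) (PI, tt) (fun t => D (fst t)))).
  destruct HL as [l Hl].
  assert (HI : exists li : list I, forall t, In t l -> 0 <= fst t <= PI ->
    exists i, In i li /\ forall x, Rabs (x - fst t) < D (fst t) -> U i (rho * cos x, rho * sin x)).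
  { clear Hl; induction l as [ | t l [li IH]].
    - exists nil; intros t [].
    - destruct (classic (0 <= fst t <= PI)) as [Ht | Ht].
      + destruct (HD (fst t) Ht) as [i Hi]; exists (i :: li).
        intros t' [<- | Ht'] Hb; [exists i; split; [left; auto | auto] | ].
        destruct (IH t' Ht' Hb) as [j [Hj Hj']]; exists j; split; [right; auto | auto].
      + exists li; intros t' [<- | Ht'] Hb; [contradiction | auto]. }
  destruct HI as [li Hli]; exists li.
  intros p [s [Hs ->]].
  destruct (Hl (s, tt)) as [t [Ht [Hb Hc]]]; [simpl; auto | ].
  destruct t as [t []]; simpl in Hb, Hc.
  destruct (Hli (t, tt) Ht) as [i [Hi Hi']]; [simpl; tauto | ].
  exists i; split; auto; apply Hi'; simpl; tauto.
Qed.

Lemma compact_singleton p : compact_set (fun q => q = p).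
Proof.
  intros I U HU Hcov; destruct (Hcov p eq_refl) as [i Hi].
  exists (i :: nil); intros q ->; exists i; split; [left | ]; auto.
Qed.

(** * From uniform convergence to coefficient bounds *)

Lemma hom_taylor_hom f m : exists N, hom m (taylor_hom f m) N.
Proof.
  pose (c := fun k => Cmult (RtoC (/ (INR (fact k) * INR (fact (m - k))))) (dxy k (m - k) f (0, 0))).
  exists (rsum (S m) (fun k => Cmod (c k) * (1 ^ k * 1 ^ (m - k)))).
  apply (hom_ext _ (fun p => csum (S m) (fun k =>
    Cmult (c k) (Cmult (Cpow (fst p) k) (Cpow (snd p) (m - k)))))).
  - apply hom_sum; intros k Hk; apply hom_scal.
    replace m with (k * 1 + (m - k) * 1)%nat at 1 by lia.
    apply hom_mul; apply hom_pow; [apply hom_fst | apply hom_snd].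
  - intros p; unfold taylor_hom; rewrite csum_sum_n; apply csum_ext; intros k Hk.
    unfold c, Rdiv; rewrite !RtoC_mult, !RtoC_pow; ring.
Qed.

(** The Cauchy criterion on the arc of radius [s] bounds the parts of high degree there by 1, hence
    their coefficients by s^(-m). The norm is then at most (m + 1) s^(-m), and m + 1 is absorbed in
    passing to a smaller [rho]. *)
Lemma inA_rep r f : inA r f -> rep r (taylor_hom f) f.
Proof.
  intros [_ H].
  assert (HA : exists A : nat -> nat -> C, forall m p, taylor_hom f m p = ev m (A m) p).
  { assert (X : forall m, exists a, forall p, taylor_hom f m p = ev m a p).
    { intros m; destruct (hom_taylor_hom f m) as [N [a [E _]]]; exists a; auto. }
    exists (fun m => proj1_sig (constructive_indefinite_description _ (X m))).
    intros m; exact (proj2_sig (constructive_indefinite_description _ (X m))). }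
  destruct HA as [A HA].
  pose (N := fun m => rsum (S m) (fun k => Cmod (A m k))).
  assert (HN : forall m, hom m (taylor_hom f m) (N m))
    by (intros m; exists (A m); split; [auto | unfold N; lra]).
  assert (HN0 : forall m, 0 <= N m) by (intros m; eapply hom_nonneg; eauto).
  exists N; split; [ | split]; auto.
  - split; auto.
    intros rho Hrho Hlt; destruct (Rbar_lt_between _ _ Hlt) as [s [Hs Hs']].
    destruct (H (arc s) (compact_arc s)) as [H1 _].
    { intros p [x [_ ->]]; apply disk_Cmod.
      replace ((s * cos x, s * sin x) : C) with (Cmult (RtoC s) (cis x))
        by (apply injective_projections; simpl; ring).
      rewrite Cmod_mult, Cmod_cis, Cmod_R, Rabs_right, Rmult_1_r by lra; auto. }
    destruct (H1 1 Rlt_0_1) as [N0 HN1].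
    destruct (linear_geom_bound (rho / s)) as [L [HL HL']].
    { split; [apply Rdiv_le_0_compat; lra | apply Rlt_div_l; lra]. }
    (* [L] serves the degrees from [N0] on; the sum covers the finitely many lower ones. *)
    exists (L + rsum N0 (fun m => N m * rho ^ m)); intros m.
    assert (Hterm : forall k, 0 <= N k * rho ^ k)
      by (intros; apply Rmult_le_pos; auto; apply pow_le; auto).
    destruct (Nat.lt_ge_cases m N0) as [Hm | Hm].
    + assert (X := rsum_term_le N0 (fun m => N m * rho ^ m) m (fun k _ => Hterm k) Hm).
      simpl in X; lra.
    + assert (X := rsum_nonneg N0 (fun m => N m * rho ^ m) (fun k _ => Hterm k)).
      assert (Hsm : 0 < s ^ m) by (apply pow_lt; lra).
      assert (Y : N m * s ^ m <= INR m + 1).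
      { assert (Z : forall k, (k <= m)%nat -> Cmod (A m k) <= / s ^ m).
        { apply ev_coef_bound; intros x Hx; rewrite <- HA.
          assert (Hp : arc s (s * cos x, s * sin x)) by (exists x; auto).
          specialize (HN1 m _ Hm Hp).
          assert (T : Cmod (taylor_hom f m (s * cos x, s * sin x)) < 1).
          { eapply Rle_lt_trans; [ | apply HN1].
            destruct (Nat.eq_dec N0 m) as [-> | Hne].
            - rewrite sum_n_n; apply Rle_refl.
            - destruct m as [ | m]; [lia | ].
              rewrite sum_n_Sm by lia.
              assert (P : 0 <= sum_n_m (fun m0 => Cmod (taylor_hom f m0 (s * cos x, s * sin x))) N0 m).
              { apply (Rle_trans _ (sum_n_m (fun _ => zero) N0 m)).
                - right; symmetry; apply (sum_n_m_const_zero (G := R_AbelianMonoid)).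
                - apply sum_n_m_le; intros; apply Cmod_ge_0. }
              unfold plus; simpl; lra. }
          assert (ER : taylor_hom f m (s * cos x, s * sin x) =
            Cmult (RtoC (s ^ m)) (taylor_hom f m (cis x)))
            by exact (hom_rescale m (taylor_hom f m) (N m) s (cis x) (HN m)).
          rewrite ER in T.
          rewrite Cmod_mult, Cmod_R, Rabs_right in T by lra.
          apply (Rmult_le_reg_l (s ^ m)); auto.
          rewrite Rinv_r by lra; left; exact T. }
        apply Rle_trans with (INR (S m) * / s ^ m * s ^ m).
        - apply Rmult_le_compat_r; [lra | ].
          rewrite <- rsum_const; apply rsum_le; intros k Hk; apply Z; lia.
        - rewrite S_INR, Rmult_assoc, Rinv_l by lra; lra. }
      replace (rho ^ m) with (s ^ m * (rho / s) ^ m)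
        by (rewrite <- Rpow_mult_distr; f_equal; field; lra).
      rewrite <- Rmult_assoc.
      apply Rle_trans with ((INR m + 1) * (rho / s) ^ m).
      * apply Rmult_le_compat_r; auto; apply pow_le, Rdiv_le_0_compat; lra.
      * specialize (HL' m); lra.
  - intros p Hp.
    destruct (H (fun q => q = p) (compact_singleton p)) as [_ H2]; [intros q ->; auto | ].
    split; apply (filterlim_locally (F := eventually)); intros eps;
      destruct (H2 eps (cond_pos eps)) as [N0 HN1]; exists N0; intros n Hn;
      specialize (HN1 n p Hn eq_refl); rewrite csum_sum_n in HN1; rewrite rsum_sum_n.
    + rewrite <- fst_csum.
      match goal with |- ball _ _ ?v => change (Rabs (v - fst (f p)) < eps) end.
      eapply Rle_lt_trans; [ | apply HN1]; rewrite Rabs_minus_sym.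
      apply (Rabs_fst_le (Cminus (f p) (csum (S n) (fun m => taylor_hom f m p)))).
    + rewrite <- snd_csum.
      match goal with |- ball _ _ ?v => change (Rabs (v - snd (f p)) < eps) end.
      eapply Rle_lt_trans; [ | apply HN1]; rewrite Rabs_minus_sym.
      apply (Rabs_snd_le (Cminus (f p) (csum (S n) (fun m => taylor_hom f m p)))).
Qed.

(** * Small divisors *)

Lemma cos_IZR_PI_abs n : Rabs (cos (IZR n * PI)) = 1.
Proof.
  assert (H := sin2_cos2 (IZR n * PI)).
  rewrite (sin_eq_0_1 (IZR n * PI)) in H by (exists n; reflexivity).
  unfold Rsqr in H.
  assert (E : Rabs (cos (IZR n * PI)) * Rabs (cos (IZR n * PI)) = 1)
    by (rewrite <- Rabs_mult, Rabs_right; nra).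
  assert (P := Rabs_pos (cos (IZR n * PI))); nra.
Qed.

Lemma Rabs_sin_plus_IZR_PI y n : Rabs (sin (y + IZR n * PI)) = Rabs (sin y).
Proof.
  rewrite sin_plus, (sin_eq_0_1 (IZR n * PI)) by (exists n; reflexivity).
  rewrite Rmult_0_r, Rplus_0_r, Rabs_mult, cos_IZR_PI_abs; ring.
Qed.

(** Up to PI/3 the cosine is at least 1/2, so the sine of PI y is at least PI y / 2; beyond that the
    sine is at least 1/2, which is at least y. *)
Lemma sin_PI_ge y : 0 <= y <= 1 / 2 -> y <= sin (PI * y).
Proof.
  intros Hy; assert (HPI := PI_RGT_0); assert (H3 := PI2_3_2).
  destruct (Rle_dec (PI * y) (PI / 3)) as [H | H].
  - destruct (MVT_gen sin 0 (PI * y) cos) as [c [Hc E]].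
    + intros x _; apply is_derive_Reals, derivable_pt_lim_sin.
    + intros x _; apply continuity_sin.
    + rewrite Rmin_left, Rmax_right in Hc by nra.
      rewrite sin_0, !Rminus_0_r in E; rewrite E.
      assert (1 / 2 <= cos c) by (rewrite <- cos_PI3; apply cos_decr_1; lra).
      assert (0 <= PI * y) by nra.
      apply Rle_trans with (1 / 2 * (PI * y)); [nra | ].
      apply Rmult_le_compat_r; lra.
  - apply Rle_trans with (sin (PI / 6)); [rewrite sin_PI6; lra | ].
    apply sin_incr_1; nra.
Qed.

Lemma abs_sin_PI_ge_dist x : exists n : Z, Rabs (x - IZR n) <= Rabs (sin (PI * x)).
Proof.
  pose (n := Int_part (x + 1 / 2)); exists n.
  destruct (base_Int_part (x + 1 / 2)) as [H1 H2]; fold n in H1, H2.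
  replace (PI * x) with (PI * (x - IZR n) + IZR n * PI) by ring.
  rewrite Rabs_sin_plus_IZR_PI.
  destruct (Rle_dec 0 (x - IZR n)) as [H | H].
  - assert (Q := sin_PI_ge (x - IZR n) ltac:(lra)).
    rewrite !Rabs_right; lra.
  - assert (Q := sin_PI_ge (- (x - IZR n)) ltac:(lra)).
    rewrite <- Ropp_mult_distr_r, sin_neg in Q.
    rewrite !Rabs_left1; lra.
Qed.

(** |sin (PI x)| dominates the distance from x to some integer. For x = 4 l beta the hypothesis at
    denominator 4 l bounds that distance below by 4 l Cst / (4 l)^2. *)
Lemma badly_approximable_sin beta Cst :
  (forall n m : Z, m <> 0%Z -> Rabs (beta - IZR n / IZR m) >= Cst / (IZR m) ^ 2) ->
  forall l, (1 <= l)%nat -> Cst / 4 / INR l <= Rabs (sin (PI * (4 * INR l * beta))).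
Proof.
  intros H l Hl; destruct (abs_sin_PI_ge_dist (4 * INR l * beta)) as [n Hn].
  eapply Rle_trans; [ | apply Hn].
  assert (Hpos : 0 < INR l) by (apply lt_0_INR; lia).
  assert (Q := H n (4 * Z.of_nat l)%Z ltac:(lia)).
  rewrite mult_IZR, <- INR_IZR_INZ in Q.
  replace (4 * INR l * beta - IZR n) with (4 * INR l * (beta - IZR n / (4 * INR l))) by (field; lra).
  rewrite Rabs_mult, (Rabs_right (4 * INR l)) by lra.
  replace (Cst / 4 / INR l) with (4 * INR l * (Cst / (4 * INR l) ^ 2)) by (field; lra).
  apply Rmult_le_compat_l; lra.
Qed.

(** Determinant of the system that samples cos (N psi) and cos ((N - 2) psi) at psi = PI/4 and psi =
    [al]; [det_odd] is its analogue for sines. *)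
Definition det_even (al : R) (N : nat) : R :=
  cos (INR N * (PI / 4)) * cos ((INR N - 2) * al) -
  cos ((INR N - 2) * (PI / 4)) * cos (INR N * al).

Definition det_odd (al : R) (N : nat) : R :=
  sin (INR N * (PI / 4)) * sin ((INR N - 2) * al) -
  sin ((INR N - 2) * (PI / 4)) * sin (INR N * al).

(** As (N - 2) PI/4 = a - PI/2, only cos a and sin a remain. For even [N] one of them is 0, and for
    odd [N] their sum or difference is 0, so in each class modulo 4 the determinant collapses to a
    single product. *)
Lemma dets_sum al N (a := INR N * (PI / 4)) (M := INR N - 1) :
  det_even al N = cos (M * al) * cos al * (cos a - sin a) + sin (M * al) * sin al * (cos a + sin a) /\
  det_odd al N = sin (M * al) * cos al * (sin a + cos a) + cos (M * al) * sin al * (cos a - sin a).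
Proof.
  assert (E1 : (INR N - 2) * (PI / 4) = a - PI / 2) by (unfold a; field).
  assert (E2 : (INR N - 2) * al = M * al - al) by (unfold M; ring).
  assert (E3 : INR N * al = M * al + al) by (unfold M; ring).
  unfold det_even, det_odd; fold a; rewrite E1, E2, E3.
  rewrite !cos_minus, !sin_minus, !cos_plus, !sin_plus, cos_PI2, sin_PI2; split; ring.
Qed.

Section SmallDivisors.

Variables (al k0 : R).
Hypothesis k0_pos : 0 < k0.
Hypothesis al_bound : forall l, (1 <= l)%nat ->
  k0 / INR l <= Rabs (sin (4 * INR l * al)).

(** Neither factor of sin (4 l al) = 2 sin (2 l al) cos (2 l al) exceeds 1 in modulus, so each
    inherits half the bound. *)
Lemma sin_cos_even_bound l : (1 <= l)%nat ->
  k0 / 2 / INR l <= Rabs (sin (2 * INR l * al)) /\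
  k0 / 2 / INR l <= Rabs (cos (2 * INR l * al)).
Proof.
  intros Hl; assert (H := al_bound l Hl).
  assert (Hpos : 0 < INR l) by (apply lt_0_INR; lia).
  replace (4 * INR l * al) with (2 * (2 * INR l * al)) in H by ring.
  rewrite sin_2a, !Rabs_mult, (Rabs_right 2) in H by lra.
  set (s := Rabs (sin _)) in *; set (c := Rabs (cos _)) in *.
  assert (Hs : 0 <= s <= 1).
  { split; [apply Rabs_pos | apply Rabs_le; apply SIN_bound]. }
  assert (Hc : 0 <= c <= 1).
  { split; [apply Rabs_pos | apply Rabs_le; apply COS_bound]. }
  replace (k0 / 2 / INR l) with (k0 / INR l / 2) by (field; lra).
  split; nra.
Qed.

Lemma sin_cos_bound : k0 / 4 <= Rabs (sin al) /\ k0 / 4 <= Rabs (cos al) /\ k0 <= 2.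
Proof.
  destruct (sin_cos_even_bound 1 ltac:(lia)) as [H _]; simpl INR in H.
  rewrite Rmult_1_r, sin_2a, !Rabs_mult, (Rabs_right 2) in H by lra.
  set (s := Rabs (sin _)) in *; set (c := Rabs (cos _)) in *.
  assert (Hs : 0 <= s <= 1).
  { split; [apply Rabs_pos | apply Rabs_le; apply SIN_bound]. }
  assert (Hc : 0 <= c <= 1).
  { split; [apply Rabs_pos | apply Rabs_le; apply COS_bound]. }
  replace (k0 / 2 / 1) with (k0 / 2) in H by field.
  assert (s * c <= s) by nra. assert (s * c <= c) by nra.
  destruct (sin_cos_even_bound 1 ltac:(lia)) as [H' _]; simpl INR in H'.
  assert (Rabs (sin (2 * 1 * al)) <= 1) by (apply Rabs_le; apply SIN_bound).
  lra.
Qed.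

Lemma dets_bound N : (4 <= N)%nat ->
  k0 ^ 2 / 4 / INR N <= Rabs (det_even al N) /\ k0 ^ 2 / 4 / INR N <= Rabs (det_odd al N).
Proof.
  intros HN.
  destruct sin_cos_bound as [Hs [Hc Hk]].
  assert (HNpos : 4 <= INR N) by (apply (le_INR 4) in HN; simpl in HN; lra).
  (* A frequency 2 l that is at most [N] turns k0 / (2 l) into k0 / N. *)
  assert (EV : forall l, (1 <= l)%nat -> (2 * l <= N)%nat ->
    k0 / INR N <= Rabs (sin (2 * INR l * al)) /\ k0 / INR N <= Rabs (cos (2 * INR l * al))).
  { intros l Hl HlN; assert (Hl0 : 0 < INR l) by (apply lt_0_INR; lia).
    assert (HlN' : 2 * INR l <= INR N) by (apply le_INR in HlN; rewrite mult_INR in HlN; simpl in HlN; lra).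
    assert (X : k0 / INR N <= k0 / 2 / INR l).
    { replace (k0 / 2 / INR l) with (k0 / (2 * INR l)) by (field; lra).
      apply Rmult_le_compat_l; [lra | ]; apply Rinv_le_contravar; lra. }
    destruct (sin_cos_even_bound l Hl); lra. }
  assert (F : 0 < k0 / INR N) by (apply Rdiv_lt_0_compat; lra).
  assert (G : k0 ^ 2 / 4 / INR N = k0 / INR N * (k0 / 4)) by (field; lra).
  assert (G1 : k0 / INR N * (k0 / 4) <= k0 / INR N) by nra.
  rewrite G.
  (* The four residues modulo 4 are treated separately; [1 <= j], available from degree 4 on, keeps
     the frequencies used below positive. *)
  assert (Hj : exists j r, N = (4 * j + r)%nat /\ (1 <= j)%nat /\ (r < 4)%nat).
  { exists (N / 4)%nat, (N mod 4)%nat; split; [apply Nat.div_mod_eq | split].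
    - apply Nat.div_le_lower_bound; lia.
    - apply Nat.mod_upper_bound; lia. }
  destruct Hj as [j [r [Ej [Hj1 Hr]]]].
  pose (e := cos (INR j * PI)).
  assert (He : Rabs e = 1) by (unfold e; rewrite INR_IZR_INZ; apply cos_IZR_PI_abs).
  assert (Hs0 : sin (INR j * PI) = 0) by (rewrite INR_IZR_INZ; apply sin_eq_0_1; eexists; reflexivity).
  assert (EN : INR N = 4 * INR j + INR r) by (rewrite Ej, plus_INR, mult_INR; simpl; ring).
  destruct (dets_sum al N) as [DE DO].
  assert (A4 : cos (PI / 4) = sin (PI / 4)) by (rewrite cos_PI4, sin_PI4; reflexivity).
  (* For odd [N] the determinant carries the factor 2 sin (PI/4), which may be dropped from a lower
     bound. *)
  assert (A5 : 1 <= 2 * sin (PI / 4)).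
  { assert (X := sin_incr_1 (PI / 6) (PI / 4)).
    rewrite sin_PI6 in X; assert (HPI := PI_RGT_0); lra. }
  set (c4 := sin (PI / 4)) in *.
  assert (ea : INR N * (PI / 4) = INR j * PI + INR r * (PI / 4)) by (rewrite EN; field).
  rewrite ea, cos_plus, sin_plus, Hs0, !Rmult_0_l, Rminus_0_r, Rplus_0_l in DE, DO.
  fold e in DE, DO.
  assert (ODD : forall x y, k0 / INR N <= Rabs x -> k0 / 4 <= Rabs y ->
    forall z, Rabs z = 1 -> k0 / INR N * (k0 / 4) <= Rabs (x * y * (z * (2 * c4)))).
  { intros x y Hx Hy z Hz.
    rewrite !Rabs_mult, Hz, (Rabs_right 2), (Rabs_right c4) by lra.
    assert (k0 / INR N * (k0 / 4) <= Rabs x * Rabs y) by (apply Rmult_le_compat; lra).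
    assert (0 <= Rabs x * Rabs y) by (apply Rmult_le_pos; apply Rabs_pos).
    nra. }
  assert (ME : Rabs (- e) = 1) by (rewrite Rabs_Ropp; auto).
  assert (C3 : cos (3 * (PI / 4)) = - c4).
  { replace (3 * (PI / 4)) with (PI - PI / 4) by field.
    rewrite Rtrigo_facts.cos_pi_minus, A4; reflexivity. }
  assert (S3 : sin (3 * (PI / 4)) = c4).
  { replace (3 * (PI / 4)) with (PI - PI / 4) by field.
    rewrite Rtrigo_facts.sin_pi_minus; reflexivity. }
  destruct r as [ | [ | [ | [ | r]]]]; [ | | | | lia];
    simpl INR in DE, DO, EN.
  - rewrite Rmult_0_l, cos_0, sin_0 in DE, DO.
    destruct (EV (2 * j - 1)%nat ltac:(lia) ltac:(lia)) as [V1 V2].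
    destruct (EV (2 * j)%nat ltac:(lia) ltac:(lia)) as [V3 V4].
    split.
    + replace (det_even al N) with (e * cos (2 * INR (2 * j - 1) * al)).
      * rewrite Rabs_mult, He; lra.
      * rewrite DE, minus_INR, mult_INR by lia; simpl INR.
        replace (2 * ((1 + 1) * INR j - 1) * al) with ((INR N - 1) * al - al) by (rewrite EN; ring).
        rewrite cos_minus; ring.
    + replace (det_odd al N) with (e * sin (2 * INR (2 * j) * al)).
      * rewrite Rabs_mult, He; lra.
      * rewrite DO, mult_INR; simpl INR.
        replace (2 * ((1 + 1) * INR j) * al) with ((INR N - 1) * al + al) by (rewrite EN; ring).
        rewrite sin_plus; ring.
  - rewrite Rmult_1_l, A4 in DE, DO; fold c4 in DE, DO.
    destruct (EV (2 * j)%nat ltac:(lia) ltac:(lia)) as [V3 V4].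
    replace (2 * INR (2 * j) * al) with ((INR N - 1) * al) in V3, V4
      by (rewrite EN, mult_INR; simpl; ring).
    split.
    + replace (det_even al N) with (sin ((INR N - 1) * al) * sin al * (e * (2 * c4)))
        by (rewrite DE; ring); auto.
    + replace (det_odd al N) with (sin ((INR N - 1) * al) * cos al * (e * (2 * c4)))
        by (rewrite DO; ring); auto.
  - replace ((1 + 1) * (PI / 4)) with (PI / 2) in DE, DO by field.
    rewrite cos_PI2, sin_PI2 in DE, DO.
    destruct (EV (2 * j + 1)%nat ltac:(lia) ltac:(lia)) as [V1 V2].
    destruct (EV (2 * j)%nat ltac:(lia) ltac:(lia)) as [V3 V4].
    split.
    + replace (det_even al N) with (- e * cos (2 * INR (2 * j + 1) * al)).
      * rewrite Rabs_mult, ME; lra.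
      * rewrite DE, plus_INR, mult_INR; simpl INR.
        replace (2 * ((1 + 1) * INR j + 1) * al) with ((INR N - 1) * al + al) by (rewrite EN; ring).
        rewrite cos_plus; ring.
    + replace (det_odd al N) with (e * sin (2 * INR (2 * j) * al)).
      * rewrite Rabs_mult, He; lra.
      * rewrite DO, mult_INR; simpl INR.
        replace (2 * ((1 + 1) * INR j) * al) with ((INR N - 1) * al - al) by (rewrite EN; ring).
        rewrite sin_minus; ring.
  - replace (1 + 1 + 1) with 3 in DE, DO, EN by ring.
    rewrite C3, S3 in DE, DO.
    destruct (EV (2 * j + 1)%nat ltac:(lia) ltac:(lia)) as [V3 V4].
    replace (2 * INR (2 * j + 1) * al) with ((INR N - 1) * al) in V3, V4
      by (rewrite EN, plus_INR, mult_INR; simpl; ring).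
    split.
    + replace (det_even al N) with (cos ((INR N - 1) * al) * cos al * (- e * (2 * c4)))
        by (rewrite DE; ring); auto.
    + replace (det_odd al N) with (cos ((INR N - 1) * al) * sin al * (- e * (2 * c4)))
        by (rewrite DO; ring); auto.
Qed.

End SmallDivisors.

(** * The homogeneous Goursat problem *)

(** Cramer's rule: each numerator is a difference of two terms bounded by [nu]. *)
Lemma solve_2x2 (a b c d k nu : R) (v1 v2 : C) :
  Rabs a <= 1 -> Rabs b <= 1 -> Rabs c <= 1 -> Rabs d <= 1 ->
  0 < k -> k <= Rabs (a * d - b * c) -> Cmod v1 <= nu -> Cmod v2 <= nu ->
  exists x y : C, Cplus (Cmult a x) (Cmult b y) = v1 /\ Cplus (Cmult c x) (Cmult d y) = v2 /\
    Cmod x <= 2 * nu / k /\ Cmod y <= 2 * nu / k.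
Proof.
  intros Ha Hb Hc Hd Hk HD H1 H2.
  set (D := a * d - b * c) in *.
  assert (D0 : D <> 0) by (intros E; rewrite E, Rabs_R0 in HD; lra).
  assert (DC : RtoC D <> RtoC 0) by (intros E; apply RtoC_inj in E; auto).
  assert (ED : RtoC D = Cminus (Cmult a d) (Cmult b c))
    by (unfold D; rewrite RtoC_minus, !RtoC_mult; reflexivity).
  assert (B : forall u v : R, Rabs u <= 1 -> Rabs v <= 1 -> forall x y, Cmod x <= nu -> Cmod y <= nu ->
    Cmod (Cdiv (Cminus (Cmult u x) (Cmult v y)) D) <= 2 * nu / k).
  { intros u v Hu Hv x y Hx Hy.
    rewrite Cmod_div, Cmod_R by auto.
    assert (X : Cmod (Cminus (Cmult u x) (Cmult v y)) <= 2 * nu).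
    { eapply Rle_trans; [apply Cmod_triangle | ].
      rewrite Cmod_opp, !Cmod_mult, !Cmod_R.
      assert (X1 := Cmod_ge_0 x); assert (X2 := Cmod_ge_0 y).
      assert (X3 := Rabs_pos u); assert (X4 := Rabs_pos v). nra. }
    apply Rmult_le_compat; auto; [apply Cmod_ge_0 | | apply Rinv_le_contravar; auto].
    left; apply Rinv_0_lt_compat; lra. }
  exists (Cdiv (Cminus (Cmult d v1) (Cmult b v2)) D), (Cdiv (Cminus (Cmult a v2) (Cmult c v1)) D).
  split; [ | split; [ | split; apply B; auto]]; rewrite ED in *; field; auto.
Qed.

Lemma unique_2x2 (a b c d : R) (x y : C) :
  a * d - b * c <> 0 ->
  Cplus (Cmult a x) (Cmult b y) = 0 -> Cplus (Cmult c x) (Cmult d y) = 0 ->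
  x = 0 /\ y = 0.
Proof.
  intros HD H1 H2.
  assert (DC : RtoC (a * d - b * c) <> RtoC 0) by (intros E; apply RtoC_inj in E; auto).
  assert (E1 : Cmult (RtoC (a * d - b * c)) x = 0).
  { rewrite RtoC_minus, !RtoC_mult.
    transitivity (Cminus (Cmult d (Cplus (Cmult a x) (Cmult b y))) (Cmult b (Cplus (Cmult c x) (Cmult d y)))); [ring | ].
    rewrite H1, H2; ring. }
  assert (E2 : Cmult (RtoC (a * d - b * c)) y = 0).
  { rewrite RtoC_minus, !RtoC_mult.
    transitivity (Cminus (Cmult a (Cplus (Cmult c x) (Cmult d y))) (Cmult c (Cplus (Cmult a x) (Cmult b y)))); [ring | ].
    rewrite H1, H2; ring. }
  split; [apply (f_equal (Cmult (/ RtoC (a * d - b * c)))) in E1; rewrite Cmult_assoc, Cinv_l, Cmult_1_l, Cmult_0_r in E1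
         | apply (f_equal (Cmult (/ RtoC (a * d - b * c)))) in E2; rewrite Cmult_assoc, Cinv_l, Cmult_1_l, Cmult_0_r in E2]; auto.
Qed.

(* Up to the rotation by [PI/4], the biharmonic homogeneous polynomials of
   degree [N] restrict to the circle as the span of [cis (+-N psi)] and
   [cis (+-(N-2) psi)]. *)
Definition biharm (N : nat) (A A' B B' : C) (p : pt) : C :=
  Cplus (Cplus (Cmult (Cmult A (cis (- (INR N * (PI / 4))))) (mono N 0 p))
               (Cmult (Cmult A' (cis (INR N * (PI / 4)))) (mono 0 N p)))
        (Cplus (Cmult (Cmult B (cis (- ((INR N - 2) * (PI / 4))))) (mono (N - 1) 1 p))
               (Cmult (Cmult B' (cis ((INR N - 2) * (PI / 4)))) (mono 1 (N - 1) p))).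

Definition trig (N : nat) (A A' B B' : C) (psi : R) : C :=
  Cplus (Cplus (Cmult (Cplus A A') (RtoC (cos (INR N * psi))))
               (Cmult (Cmult Ci (Cminus A A')) (RtoC (sin (INR N * psi)))))
        (Cplus (Cmult (Cplus B B') (RtoC (cos ((INR N - 2) * psi))))
               (Cmult (Cmult Ci (Cminus B B')) (RtoC (sin ((INR N - 2) * psi))))).

Lemma cis_decomp A A' x :
  Cplus (Cmult A (cis x)) (Cmult A' (cis (- x))) =
  Cplus (Cmult (Cplus A A') (RtoC (cos x))) (Cmult (Cmult Ci (Cminus A A')) (RtoC (sin x))).
Proof.
  assert (E : forall y, cis y = Cplus (RtoC (cos y)) (Cmult Ci (RtoC (sin y))))
    by (intros y; apply injective_projections; simpl; ring).
  rewrite !E, cos_neg, sin_neg, RtoC_opp; ring.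
Qed.

Lemma biharm_cis N A A' B B' psi : (1 <= N)%nat ->
  biharm N A A' B B' (cis (PI / 4 + psi)) = trig N A A' B B' psi.
Proof.
  intros HN; unfold biharm, trig; rewrite !mono_cis, minus_INR by auto.
  rewrite <- !cis_decomp, <- !Cmult_assoc, <- !cis_plus; simpl INR.
  f_equal; f_equal; f_equal; f_equal; field.
Qed.

Lemma hom_biharm N A A' B B' : (1 <= N)%nat ->
  hom N (biharm N A A' B B') (Cmod A + Cmod A' + (Cmod B + Cmod B')).
Proof.
  intros HN.
  assert (T : forall k j D x, (k + j = N)%nat ->
    hom N (fun p => Cmult (Cmult D (cis x)) (mono k j p)) (Cmod D)).
  { intros k j D x E; eapply hom_weaken.
    - apply hom_scal; rewrite <- E; apply hom_mono.
    - rewrite Cmod_mult, Cmod_cis; lra. }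
  apply hom_plus; apply hom_plus; apply T; lia.
Qed.

Lemma bilap_mono k j p :
  bilap (mono k j) p =
  Cmult (16 * (INR k * INR (k - 1)) * (INR j * INR (j - 1))) (mono (k - 2) (j - 2) p).
Proof.
  replace (mono k j) with (lin 1 (fun _ => RtoC 1) (fun _ => k) (fun _ => j))
    by (apply functional_extensionality; intros q; unfold lin; simpl; ring).
  rewrite bilap_lin; unfold lin; simpl csum; ring.
Qed.

Lemma bilap_biharm m A A' B B' p : bilap (biharm (4 + m) A A' B B') p = RtoC 0.
Proof.
  assert (HM : forall k j D, (k + j = 4 + m)%nat ->
    hom (4 + m) (fun p => Cmult D (mono k j p)) (Cmod D * 1)).
  { intros k j D E; apply hom_scal; rewrite <- E; apply hom_mono. }
  unfold biharm.
  set (a1 := Cmult A _); set (a2 := Cmult A' _).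
  set (b1 := Cmult B _); set (b2 := Cmult B' _).
  assert (H1 := HM (4 + m)%nat 0%nat a1 ltac:(lia)).
  assert (H2 := HM 0%nat (4 + m)%nat a2 ltac:(lia)).
  assert (H3 := HM (4 + m - 1)%nat 1%nat b1 ltac:(lia)).
  assert (H4 := HM 1%nat (4 + m - 1)%nat b2 ltac:(lia)).
  rewrite (bilap_plus m _ _ _ _ (hom_plus _ _ _ _ _ H1 H2) (hom_plus _ _ _ _ _ H3 H4)).
  rewrite (bilap_plus m _ _ _ _ H1 H2), (bilap_plus m _ _ _ _ H3 H4).
  assert (HS : forall k j D, (k + j = 4 + m)%nat ->
    bilap (fun p => Cmult D (mono k j p)) = fun p => Cmult D (bilap (mono k j) p)).
  { intros k j D E; apply (bilap_scal m _ 1); rewrite <- E; apply hom_mono. }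
  rewrite !HS by lia; rewrite !bilap_mono.
  replace (INR 0) with 0 by reflexivity.
  replace (INR (1 - 1)) with 0 by reflexivity.
  ring.
Qed.

Section HomogeneousGoursat.

Variables (al kap : R).
Hypothesis kap_pos : 0 < kap.
Hypothesis dets : forall N, (4 <= N)%nat ->
  kap / INR N <= Rabs (det_even al N) /\ kap / INR N <= Rabs (det_odd al N).

Definition nodes (h : pt -> C) : Prop :=
  forall psi, psi = PI / 4 \/ psi = - (PI / 4) \/ psi = al \/ psi = - al ->
    h (cis (PI / 4 + psi)) = RtoC 0.

(** The even and odd parts of [V] are interpolated by cosines and by sines at PI/4 and [al] alone;
    the reflected nodes follow by parity. Each of the four real-type coefficients costs 2 nu N /
    kap, whence the constant 8. *)
Lemma trig_interpolation N (V : R -> C) nu : (4 <= N)%nat ->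
  (forall psi, Cmod (V psi) <= nu) ->
  exists A A' B B',
    Cmod A + Cmod A' + (Cmod B + Cmod B') <= 8 * nu * INR N / kap /\
    forall psi, psi = PI / 4 \/ psi = - (PI / 4) \/ psi = al \/ psi = - al ->
      trig N A A' B B' psi = V psi.
Proof.
  intros HN HV.
  assert (HN0 : 0 < INR N) by (apply lt_0_INR; lia).
  assert (Hk : 0 < kap / INR N) by (apply Rdiv_lt_0_compat; auto).
  destruct (dets N HN) as [DE DO].
  assert (C2 : RtoC 2 <> RtoC 0) by (intros X; apply RtoC_inj in X; lra).
  assert (Half : forall c, Cmod (Cmult (/ 2) c) = Cmod c / 2).
  { intros c; rewrite Cmod_mult, Cmod_inv, Cmod_R, Rabs_right by (auto; lra); field. }
  pose (Ve := fun psi => Cmult (/ 2) (Cplus (V psi) (V (- psi)))).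
  pose (Vo := fun psi => Cmult (/ 2) (Cminus (V psi) (V (- psi)))).
  assert (Be : forall psi, Cmod (Ve psi) <= nu).
  { intros psi; unfold Ve; rewrite Half.
    assert (X := Cmod_triangle (V psi) (V (- psi))).
    assert (X1 := HV psi); assert (X2 := HV (- psi)); lra. }
  assert (Bo : forall psi, Cmod (Vo psi) <= nu).
  { intros psi; unfold Vo; rewrite Half.
    assert (X := Cmod_triangle (V psi) (- V (- psi))); rewrite Cmod_opp in X.
    assert (X1 := HV psi); assert (X2 := HV (- psi)); unfold Cminus; lra. }
  assert (Rc : forall x, Rabs (cos x) <= 1) by (intros; apply Rabs_le, COS_bound).
  assert (Rs : forall x, Rabs (sin x) <= 1) by (intros; apply Rabs_le, SIN_bound).
  destruct (solve_2x2 _ _ _ _ _ nu (Ve (PI / 4)) (Ve al) (Rc _) (Rc _) (Rc _) (Rc _) Hk DE (Be _) (Be _))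
    as [c1 [c2 [E1 [E2 [Q1 Q2]]]]].
  destruct (solve_2x2 _ _ _ _ _ nu (Vo (PI / 4)) (Vo al) (Rs _) (Rs _) (Rs _) (Rs _) Hk DO (Bo _) (Bo _))
    as [s1 [s2 [E3 [E4 [Q3 Q4]]]]].
  (* The solution of A + A' = c1 and i (A - A') = s1, and likewise for B, B' with c2, s2. *)
  exists (Cmult (/ 2) (Cminus c1 (Cmult Ci s1))), (Cmult (/ 2) (Cplus c1 (Cmult Ci s1))),
    (Cmult (/ 2) (Cminus c2 (Cmult Ci s2))), (Cmult (/ 2) (Cplus c2 (Cmult Ci s2))).
  split.
  - rewrite !Half.
    assert (XP : forall c s, Cmod (Cplus c (Cmult Ci s)) <= Cmod c + Cmod s).
    { intros c s; eapply Rle_trans; [apply Cmod_triangle | ].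
      rewrite Cmod_mult, Cmod_Ci; lra. }
    assert (XM : forall c s, Cmod (Cminus c (Cmult Ci s)) <= Cmod c + Cmod s).
    { intros c s; eapply Rle_trans; [apply Cmod_triangle | ].
      rewrite Cmod_opp, Cmod_mult, Cmod_Ci; lra. }
    assert (X1 := XP c1 s1); assert (X2 := XM c1 s1).
    assert (X3 := XP c2 s2); assert (X4 := XM c2 s2).
    replace (2 * nu / (kap / INR N)) with (2 * nu * INR N / kap) in * by (field; lra).
    set (u := nu * INR N / kap).
    replace (8 * nu * INR N / kap) with (8 * u) by (unfold u; field; lra).
    replace (2 * nu * INR N / kap) with (2 * u) in * by (unfold u; field; lra).
    lra.
  - assert (II : Cmult Ci Ci = Copp 1) by (apply injective_projections; simpl; ring).
    assert (F : forall psi, trig N (Cmult (/ 2) (Cminus c1 (Cmult Ci s1)))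
        (Cmult (/ 2) (Cplus c1 (Cmult Ci s1))) (Cmult (/ 2) (Cminus c2 (Cmult Ci s2)))
        (Cmult (/ 2) (Cplus c2 (Cmult Ci s2))) psi =
      Cplus (Cplus (Cmult (cos (INR N * psi)) c1) (Cmult (cos ((INR N - 2) * psi)) c2))
            (Cplus (Cmult (sin (INR N * psi)) s1) (Cmult (sin ((INR N - 2) * psi)) s2))).
    { intros psi; unfold trig.
      transitivity (Cplus (Cplus (Cmult (cos (INR N * psi)) c1) (Cmult (cos ((INR N - 2) * psi)) c2))
        (Cmult (Copp (Cmult Ci Ci)) (Cplus (Cmult (sin (INR N * psi)) s1) (Cmult (sin ((INR N - 2) * psi)) s2)))).
      - field; auto.
      - rewrite II; ring. }
    assert (S : forall psi, Cplus (Ve psi) (Vo psi) = V psi) by (intros; unfold Ve, Vo; field; auto).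
    assert (S' : forall psi, Cminus (Ve psi) (Vo psi) = V (- psi)) by (intros; unfold Ve, Vo; field; auto).
    intros psi Hpsi; rewrite F; destruct Hpsi as [-> | [-> | [-> | ->]]].
    + rewrite E1, E3; apply S.
    + rewrite <- !Ropp_mult_distr_r, !cos_neg, !sin_neg, E1, !RtoC_opp, <- S', <- E3; ring.
    + rewrite E2, E4; apply S.
    + rewrite <- !Ropp_mult_distr_r, !cos_neg, !sin_neg, E2, !RtoC_opp, <- S', <- E4; ring.
Qed.

Lemma trig_null N A A' B B' : (4 <= N)%nat ->
  (forall psi, psi = PI / 4 \/ psi = - (PI / 4) \/ psi = al \/ psi = - al ->
     trig N A A' B B' psi = RtoC 0) ->
  A = 0 /\ A' = 0 /\ B = 0 /\ B' = 0.
Proof.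
  intros HN H.
  assert (HN0 : 0 < INR N) by (apply lt_0_INR; lia).
  assert (Hk : 0 < kap / INR N) by (apply Rdiv_lt_0_compat; auto).
  destruct (dets N HN) as [DE DO].
  assert (DE0 : det_even al N <> 0) by (intros E; rewrite E, Rabs_R0 in DE; lra).
  assert (DO0 : det_odd al N <> 0) by (intros E; rewrite E, Rabs_R0 in DO; lra).
  assert (C2 : RtoC 2 <> RtoC 0) by (intros X; apply RtoC_inj in X; lra).
  assert (EO : forall psi, trig N A A' B B' psi = 0 -> trig N A A' B B' (- psi) = 0 ->
    Cplus (Cmult (cos (INR N * psi)) (Cplus A A')) (Cmult (cos ((INR N - 2) * psi)) (Cplus B B')) = 0 /\
    Cplus (Cmult (sin (INR N * psi)) (Cmult Ci (Cminus A A')))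
          (Cmult (sin ((INR N - 2) * psi)) (Cmult Ci (Cminus B B'))) = 0).
  { intros psi E1 E2; unfold trig in E1, E2.
    rewrite <- !Ropp_mult_distr_r, !cos_neg, !sin_neg, !RtoC_opp in E2.
    split.
    - transitivity (Cmult (/ 2) (Cplus 0 0)); [rewrite <- E1 at 1; rewrite <- E2; field; auto | field; auto].
    - transitivity (Cmult (/ 2) (Cminus 0 0)); [rewrite <- E1 at 1; rewrite <- E2; field; auto | field; auto]. }
  destruct (EO (PI / 4)) as [P1 P2]; [apply H; auto | apply H; auto | ].
  destruct (EO al) as [P3 P4]; [apply H; auto | apply H; auto 6 | ].
  destruct (unique_2x2 _ _ _ _ _ _ DE0 P1 P3) as [U1 U2].
  destruct (unique_2x2 _ _ _ _ _ _ DO0 P2 P4) as [U3 U4].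
  assert (CI : forall x y, Cplus x y = 0 -> Cmult Ci (Cminus x y) = 0 -> x = 0 /\ y = 0).
  { intros x y X1 X2.
    assert (X3 : Cminus x y = 0).
    { transitivity (Cmult (Copp Ci) (Cmult Ci (Cminus x y))).
      - apply injective_projections; simpl; ring.
      - rewrite X2; ring. }
    split.
    - transitivity (Cmult (/ 2) (Cplus (Cplus x y) (Cminus x y))); [field; auto | ].
      rewrite X1, X3; field; auto.
    - transitivity (Cmult (/ 2) (Cminus (Cplus x y) (Cminus x y))); [field; auto | ].
      rewrite X1, X3; field; auto. }
  destruct (CI _ _ U1 U3), (CI _ _ U2 U4); auto.
Qed.

(* The particular solution gains a factor [4 + m], which pays for the loss in
   the interpolation at the nodes. *)
Lemma hom_goursat_solution m h nu :
  hom m h nu ->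
  exists u, hom (4 + m) u ((1 + 8 / kap) * nu) /\ (forall p, bilap u p = h p) /\ nodes u.
Proof.
  intros Hh; destruct (hom_lin _ _ _ Hh) as [a [Eh Ha]].
  assert (Hnu := hom_nonneg _ _ _ Hh).
  (* The factor by which Delta^2 multiplies z^(k+2) zbar^(m-k+2). The gain comes from (k + 2) (m - k
     + 2) >= m + 4. *)
  pose (cf := fun k => 16 * (INR (k + 2) * INR (k + 1)) * (INR (m - k + 2) * INR (m - k + 1))).
  assert (HN0 : 0 < INR (4 + m)) by (apply lt_0_INR; lia).
  assert (Hcf : forall k, (k <= m)%nat -> INR (4 + m) <= cf k).
  { intros k Hk; unfold cf.
    assert (X : forall n, 1 <= INR (n + 1)) by (intros n; apply (le_INR 1); lia).
    assert (Y : INR (4 + m) <= INR (k + 2) * INR (m - k + 2))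
      by (rewrite <- mult_INR; apply le_INR; nia).
    assert (X1 := X k); assert (X2 := X (m - k)%nat).
    assert (Z : 1 <= INR (k + 1) * INR (m - k + 1)) by nra.
    replace (16 * _ * _) with (16 * ((INR (k + 2) * INR (m - k + 2)) * (INR (k + 1) * INR (m - k + 1)))) by ring.
    nra. }
  pose (u0 := lin (S m) (fun k => Cmult (a k) (RtoC (/ cf k))) (fun k => (k + 2)%nat) (fun k => (m - k + 2)%nat)).
  assert (H0 : hom (4 + m) u0 (nu / INR (4 + m))).
  { apply (hom_weaken _ _ (rsum (S m) (fun k => Cmod (Cmult (a k) (RtoC (/ cf k))) * 1))).
    - apply hom_sum; intros k Hk; apply hom_scal.
      replace (4 + m)%nat with (k + 2 + (m - k + 2))%nat by lia; apply hom_mono.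
    - apply Rle_trans with (rsum (S m) (fun k => / INR (4 + m) * Cmod (a k))).
      + apply rsum_le; intros k Hk.
        assert (X := Hcf k ltac:(lia)).
        rewrite Cmod_mult, Cmod_R, Rmult_1_r, Rmult_comm.
        apply Rmult_le_compat_r; [apply Cmod_ge_0 | ].
        rewrite Rabs_right by (left; apply Rinv_0_lt_compat; lra).
        apply Rinv_le_contravar; lra.
      + rewrite rsum_scal, Rmult_comm; apply Rmult_le_compat_r; auto.
        left; apply Rinv_0_lt_compat; auto. }
  assert (E0 : forall p, bilap u0 p = h p).
  { intros p; unfold u0; rewrite bilap_lin, Eh; apply csum_ext; intros k Hk.
    replace (k + 2 - 2)%nat with k by lia; replace (m - k + 2 - 2)%nat with (m - k)%nat by lia.
    f_equal.
    replace (k + 2 - 1)%nat with (k + 1)%nat by lia.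
    replace (m - k + 2 - 1)%nat with (m - k + 1)%nat by lia.
    rewrite <- !RtoC_mult; fold (cf k).
    rewrite <- Cmult_assoc, <- RtoC_mult, Rinv_l.
    - ring.
    - assert (X := Hcf k ltac:(lia)); lra. }
  destruct (trig_interpolation (4 + m) (fun psi => u0 (cis (PI / 4 + psi))) (nu / INR (4 + m)))
    as [A [A' [B [B' [HB HV]]]]]; [lia | | ].
  { intros psi; eapply Rle_trans; [apply (Cmod_hom _ _ _ _ H0) | ].
    rewrite Cmod_cis, pow1; lra. }
  assert (HbB : hom (4 + m) (biharm (4 + m) A A' B B') (8 / kap * nu)).
  { eapply hom_weaken; [apply hom_biharm; lia | ].
    eapply Rle_trans; [apply HB | ].
    right; field; lra. }
  exists (fun p => Cplus (u0 p) (Cmult (Copp 1) (biharm (4 + m) A A' B B' p))).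
  split; [ | split].
  - eapply hom_weaken; [apply (hom_plus _ _ _ _ _ H0 (hom_scal _ _ _ (Copp 1) HbB)) | ].
    rewrite Cmod_m1, Rmult_plus_distr_r.
    assert (nu / INR (4 + m) <= 1 * nu); [ | lra].
    unfold Rdiv; rewrite Rmult_comm; apply Rmult_le_compat_r; auto.
    rewrite <- Rinv_1; apply Rinv_le_contravar; [lra | ].
    apply (le_INR 1); lia.
  - intros p.
    rewrite (bilap_plus m _ _ _ _ H0 (hom_scal _ _ _ (Copp 1) HbB)).
    rewrite (bilap_scal m _ _ _ HbB), bilap_biharm, E0; ring.
  - intros psi Hpsi; rewrite biharm_cis, HV by (auto; lia); ring.
Qed.

(** Delta^2 acts diagonally on monomials and kills only those of index 0, 1, 3 + m and 4 + m. What
    survives is therefore of the form [biharm], and the nonzero determinants make it vanish. *)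
Lemma hom_goursat_unique m d N :
  hom (4 + m) d N -> (forall p, bilap d p = RtoC 0) -> nodes d ->
  forall p, d p = RtoC 0.
Proof.
  intros Hd Hb Hn; destruct (hom_lin _ _ _ Hd) as [a [Ed _]].
  assert (Hmid : forall k, (k <= m)%nat -> a (2 + k)%nat = 0).
  { intros k Hk.
    pose (cf := fun k => 16 * (INR (2 + k) * INR (2 + k - 1)) * (INR (4 + m - (2 + k)) * INR (4 + m - (2 + k) - 1))).
    assert (Z : forall p, ev m (fun i => Cmult (a (2 + i)%nat) (cf i)) p = 0).
    { intros p; rewrite <- (Hb p), Ed, bilap_lin; unfold lin, ev.
      replace (S (4 + m)) with (2 + (S m + 2))%nat by lia.
      rewrite !csum_add, (csum_zero 2), (csum_zero 2).
      - rewrite Cplus_0_l, Cplus_0_r; apply csum_ext; intros i Hi.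
        replace (2 + i - 2)%nat with i by lia.
        replace (4 + m - (2 + i) - 2)%nat with (m - i)%nat by lia.
        unfold cf; rewrite !RtoC_mult; reflexivity.
      - intros i Hi.
        assert (X : (4 + m - (2 + (S m + i)) = 1 \/ 4 + m - (2 + (S m + i)) = 0)%nat) by lia.
        destruct X as [-> | ->]; simpl (INR (1 - 1)); simpl (INR 0); ring.
      - intros i Hi.
        assert (X : (i = 0 \/ i = 1)%nat) by lia.
        destruct X as [-> | ->]; simpl (INR (1 - 1)); simpl (INR 0); ring. }
    assert (X := ev_zero_coef _ _ Z k Hk); cbv beta in X.
    assert (Y : cf k <> 0).
    { unfold cf; repeat apply Rmult_integral_contrapositive_currified;
        first [lra | apply not_0_INR; lia]. }
    assert (YC : RtoC (cf k) <> RtoC 0) by (intros E; apply RtoC_inj in E; auto).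
    apply (f_equal (fun x => Cmult x (/ RtoC (cf k)))) in X.
    rewrite <- Cmult_assoc, Cinv_r, Cmult_1_r, Cmult_0_l in X; auto. }
  (* The [cis] factors cancel the rotation by PI/4 built into [biharm]. *)
  assert (Ebi : forall p, d p = biharm (4 + m)
    (Cmult (a (4 + m)%nat) (cis (INR (4 + m) * (PI / 4))))
    (Cmult (a 0%nat) (cis (- (INR (4 + m) * (PI / 4)))))
    (Cmult (a (3 + m)%nat) (cis ((INR (4 + m) - 2) * (PI / 4))))
    (Cmult (a 1%nat) (cis (- ((INR (4 + m) - 2) * (PI / 4))))) p).
  { intros p; rewrite Ed; unfold lin.
    replace (S (4 + m)) with (2 + (S m + 2))%nat by lia.
    rewrite !csum_add, (csum_zero (S m)).
    - unfold biharm; rewrite <- !Cmult_assoc, !(Cmult_assoc (cis _) (cis _)), <- !cis_plus.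
      rewrite !Rplus_opp_r, !Rplus_opp_l, cis_0, !Cmult_1_l.
      cbn [csum].
      replace (2 + (S m + 0))%nat with (3 + m)%nat by lia.
      replace (2 + (S m + 1))%nat with (4 + m)%nat by lia.
      replace (4 + m - (3 + m))%nat with 1%nat by lia.
      replace (4 + m - (4 + m))%nat with 0%nat by lia.
      replace (4 + m - 1)%nat with (3 + m)%nat by lia.
      replace (4 + m - 0)%nat with (4 + m)%nat by lia.
      ring.
    - intros i Hi; rewrite Hmid by lia; ring. }
  assert (T := trig_null (4 + m)
    (Cmult (a (4 + m)%nat) (cis (INR (4 + m) * (PI / 4))))
    (Cmult (a 0%nat) (cis (- (INR (4 + m) * (PI / 4)))))
    (Cmult (a (3 + m)%nat) (cis ((INR (4 + m) - 2) * (PI / 4))))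
    (Cmult (a 1%nat) (cis (- ((INR (4 + m) - 2) * (PI / 4))))) ltac:(lia)).
  destruct T as [T1 [T2 [T3 T4]]].
  { intros psi Hpsi; rewrite <- biharm_cis, <- Ebi by lia; apply Hn; auto. }
  intros p; rewrite Ebi, T1, T2, T3, T4; unfold biharm; ring.
Qed.

End HomogeneousGoursat.

(** * Division by linear forms *)

Definition line (th : R) (p : pt) : R := fst p * sin th - snd p * cos th.

Lemma geom_factor (A B : C) k :
  Cmult (Cminus A B) (csum k (fun i => Cmult (Cpow A i) (Cpow B (k - 1 - i)))) =
  Cminus (Cpow A k) (Cpow B k).
Proof.
  induction k; [simpl; ring | ].
  cbn [csum].
  replace (S k - 1 - k)%nat with 0%nat by lia.
  rewrite (csum_ext k _ (fun i => Cmult B (Cmult (Cpow A i) (Cpow B (k - 1 - i))))).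
  - rewrite csum_scal.
    transitivity (Cplus (Cmult B (Cmult (Cminus A B)
      (csum k (fun i => Cmult (Cpow A i) (Cpow B (k - 1 - i))))))
      (Cmult (Cminus A B) (Cpow A k))); [simpl; ring | ].
    rewrite IHk; simpl; ring.
  - intros i Hi; replace (S k - 1 - i)%nat with (S (k - 1 - i)) by lia.
    rewrite (Cpow_S B); ring.
Qed.

(** Put A = e^(-i th) z and B = e^(i th) zbar, so that A - B is -2 i times the linear form. In these
    variables [h] is the sum of b_k A^k B^(n+1-k), and the b_k add up to h (cis th) = 0; subtracting
    their sum times B^(n+1) leaves multiples of A^k - B^k, each divisible by A - B. *)
Lemma hom_div_line n h N th :
  hom (S n) h N -> h (cis th) = RtoC 0 ->
  exists q, hom n q (2 * INR (S n) * N) /\ forall p, h p = Cmult (RtoC (line th p)) (q p).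
Proof.
  intros [a [Ha HN]] H0.
  pose (A := fun p : pt => Cmult (cis (- th)) (mono 1 0 p)).
  pose (B := fun p : pt => Cmult (cis th) (mono 0 1 p)).
  assert (HA : hom 1 A 1).
  { eapply hom_weaken; [apply hom_scal, (hom_mono 1 0) | rewrite Cmod_cis; lra]. }
  assert (HB : hom 1 B 1).
  { eapply hom_weaken; [apply hom_scal, (hom_mono 0 1) | rewrite Cmod_cis; lra]. }
  pose (b := fun k => Cmult (a k) (cis ((INR k - INR (S n - k)) * th))).
  assert (Hb : csum (S (S n)) b = RtoC 0).
  { rewrite <- H0, Ha; unfold ev; apply csum_ext; intros k Hk.
    rewrite mono_cis; reflexivity. }
  assert (Hmono : forall k j p, mono k j p =
    Cmult (cis ((INR k - INR j) * th)) (Cmult (Cpow (A p) k) (Cpow (B p) j))).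
  { intros k j p.
    replace (A p) with (Cmult (cis (- th)) p) by (unfold A, mono; simpl; ring).
    replace (B p) with (Cmult (cis th) (Cconj p)) by (unfold B, mono; simpl; ring).
    unfold mono; rewrite !Cpow_mult_l, !cis_pow.
    transitivity (Cmult (cis ((INR k - INR j) * th + (INR k * - th + INR j * th)))
      (Cmult (Cpow p k) (Cpow (Cconj p) j))).
    - replace ((INR k - INR j) * th + (INR k * - th + INR j * th)) with 0 by ring.
      rewrite cis_0; ring.
    - rewrite !cis_plus; ring. }
  pose (q0 := fun p => csum (S (S n)) (fun k => Cmult (b k)
    (csum k (fun i => Cmult (Cpow (B p) (S n - k)) (Cmult (Cpow (A p) i) (Cpow (B p) (k - 1 - i))))))).
  assert (Hq0 : hom n q0 (INR (S n) * N)).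
  { apply (hom_weaken _ _ (rsum (S (S n)) (fun k => Cmod (b k) * rsum k (fun i =>
      1 ^ (S n - k) * (1 ^ i * 1 ^ (k - 1 - i)))))).
    - apply hom_sum; intros k Hk; apply hom_scal, hom_sum; intros i Hi.
      replace n with ((S n - k) * 1 + (i * 1 + (k - 1 - i) * 1))%nat at 1 by lia.
      apply hom_mul; [apply hom_pow; auto | apply hom_mul; apply hom_pow; auto].
    - apply Rle_trans with (rsum (S (S n)) (fun k => INR (S n) * Cmod (a k))).
      + apply rsum_le; intros k Hk.
        rewrite (rsum_ext _ _ (fun _ => 1)) by (intros; rewrite !pow1; ring).
        rewrite rsum_const; unfold b; rewrite Cmod_mult, Cmod_cis, !Rmult_1_r, Rmult_comm.
        apply Rmult_le_compat_r; [apply Cmod_ge_0 | apply le_INR; lia].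
      + rewrite rsum_scal; apply Rmult_le_compat_l; [apply pos_INR | auto]. }
  assert (Hh : forall p, h p = Cmult (Cminus (A p) (B p)) (q0 p)).
  { intros p; unfold q0; rewrite <- csum_scal.
    rewrite (csum_ext _ _ (fun k => Cplus (Cmult (a k) (mono k (S n - k) p))
      (Cmult (Copp (Cpow (B p) (S n))) (b k)))).
    - rewrite csum_plus, csum_scal, Hb, Ha; unfold ev; ring.
    - intros k Hk; rewrite csum_scal.
      transitivity (Cmult (Cmult (b k) (Cpow (B p) (S n - k)))
        (Cmult (Cminus (A p) (B p)) (csum k (fun i => Cmult (Cpow (A p) i) (Cpow (B p) (k - 1 - i))))));
        [ring | ].
      rewrite geom_factor, Hmono; unfold b.
      replace (Cpow (B p) (S n)) with (Cmult (Cpow (B p) (S n - k)) (Cpow (B p) k))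
        by (rewrite <- Cpow_add_r; f_equal; lia).
      ring. }
  exists (fun p => Cmult (Cmult (-2) Ci) (q0 p)); split.
  - eapply hom_weaken; [apply hom_scal, Hq0 | ].
    rewrite Cmod_mult, Cmod_Ci, Cmod_R, Rabs_left by lra; right; ring.
  - intros p; rewrite Hh.
    replace (Cminus (A p) (B p)) with (Cmult (Cmult (-2) Ci) (RtoC (line th p))); [ring | ].
    unfold A, B, mono, line, cis; simpl Cpow; rewrite cos_neg, sin_neg.
    destruct p; apply injective_projections; simpl; ring.
Qed.

Lemma line_cis th th' : line th (cis th') = sin (th - th').
Proof. unfold line, cis; simpl; rewrite sin_minus; ring. Qed.

(** Zeros on the remaining lines survive a division as long as the directions differ modulo PI. *)
Lemma div_line_zero h q th th' :
  (forall p, h p = Cmult (RtoC (line th p)) (q p)) -> sin (th - th') <> 0 ->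
  h (cis th') = RtoC 0 -> q (cis th') = RtoC 0.
Proof.
  intros E Hs H0; rewrite E, line_cis in H0.
  assert (YC : RtoC (sin (th - th')) <> RtoC 0) by (intros X; apply RtoC_inj in X; auto).
  apply (f_equal (Cmult (/ RtoC (sin (th - th'))))) in H0.
  rewrite Cmult_assoc, Cinv_l, Cmult_1_l, Cmult_0_r in H0; auto.
Qed.

(** Four successive divisions, each costing twice the degree. The nonzero sines express that the
    lines are distinct; [sin (2 * al) <> 0] separates the two oblique ones. *)
Lemma hom_div_Pt t beta m h N (al := PI / 4 - PI * beta) :
  0 < t -> 0 < sin (PI * beta) -> cos (PI * beta) = t * sin (PI * beta) ->
  sin (2 * al) <> 0 ->
  hom (4 + m) h N -> nodes al h ->
  exists q, hom m q (16 * (t * sin (PI * beta) ^ 2) * INR (4 + m) ^ 4 * N) /\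
    forall p, h p = Cmult (RtoC (Pt t p)) (q p).
Proof.
  intros Ht Hs Hc H2a Hh Hn.
  set (s := sin (PI * beta)) in *.
  assert (Z1 : h (cis 0) = RtoC 0).
  { replace 0 with (PI / 4 + - (PI / 4)) at 1 by ring; apply Hn; auto. }
  assert (Z4 : h (cis (PI / 2)) = RtoC 0).
  { replace (PI / 2) with (PI / 4 + PI / 4) by field; apply Hn; auto. }
  assert (Z2 : h (cis (PI * beta)) = RtoC 0).
  { replace (PI * beta) with (PI / 4 + - al) by (unfold al; ring); apply Hn; auto 6. }
  assert (Z3 : h (cis (PI / 2 - PI * beta)) = RtoC 0).
  { replace (PI / 2 - PI * beta) with (PI / 4 + al) by (unfold al; field); apply Hn; auto 6. }
  assert (Hts : 0 < t * s) by (apply Rmult_lt_0_compat; auto).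
  assert (S12 : sin (0 - PI * beta) <> 0) by (rewrite Rminus_0_l, sin_neg; fold s; lra).
  assert (S13 : sin (0 - (PI / 2 - PI * beta)) <> 0).
  { replace (0 - (PI / 2 - PI * beta)) with (- (PI / 2 - PI * beta)) by ring.
    rewrite sin_neg, sin_shift, Hc; lra. }
  assert (S14 : sin (0 - PI / 2) <> 0) by (rewrite Rminus_0_l, sin_neg, sin_PI2; lra).
  assert (S23 : sin (PI * beta - (PI / 2 - PI * beta)) <> 0).
  { replace (PI * beta - (PI / 2 - PI * beta)) with (- (2 * al)) by (unfold al; field).
    rewrite sin_neg; lra. }
  assert (S24 : sin (PI * beta - PI / 2) <> 0).
  { replace (PI * beta - PI / 2) with (- (PI / 2 - PI * beta)) by ring.
    rewrite sin_neg, sin_shift, Hc; lra. }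
  assert (S34 : sin (PI / 2 - PI * beta - PI / 2) <> 0).
  { replace (PI / 2 - PI * beta - PI / 2) with (- (PI * beta)) by ring.
    rewrite sin_neg; fold s; lra. }
  destruct (hom_div_line (3 + m) h N 0 Hh Z1) as [q1 [H1 E1]].
  pose proof (div_line_zero _ _ _ _ E1 S12 Z2) as Z12.
  pose proof (div_line_zero _ _ _ _ E1 S13 Z3) as Z13.
  pose proof (div_line_zero _ _ _ _ E1 S14 Z4) as Z14.
  destruct (hom_div_line (2 + m) q1 _ _ H1 Z12) as [q2 [H2 E2]].
  pose proof (div_line_zero _ _ _ _ E2 S23 Z13) as Z23.
  pose proof (div_line_zero _ _ _ _ E2 S24 Z14) as Z24.
  destruct (hom_div_line (1 + m) q2 _ _ H2 Z23) as [q3 [H3 E3]].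
  pose proof (div_line_zero _ _ _ _ E3 S34 Z24) as Z34.
  destruct (hom_div_line m q3 _ _ H3 Z34) as [q4 [H4 E4]].
  assert (Hts2 : 0 < t * s ^ 2) by (apply Rmult_lt_0_compat; auto; apply pow_lt; auto).
  (* The product of the four linear forms is -(t s^2) times [Pt t]. *)
  exists (fun p => Cmult (RtoC (- (t * s ^ 2))) (q4 p)); split.
  - eapply hom_weaken; [apply hom_scal, H4 | ].
    assert (HN := hom_nonneg _ _ _ Hh).
    rewrite Cmod_R, Rabs_Ropp, Rabs_right by lra.
    set (X := INR (4 + m)).
    assert (L : forall k, (k <= 4 + m)%nat -> 0 <= INR k <= X)
      by (intros k Hk; split; [apply pos_INR | apply le_INR; auto]).
    destruct (L (S (3 + m)) ltac:(lia)) as [L0 L1]; destruct (L (S (2 + m)) ltac:(lia)) as [L2 L3].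
    destruct (L (S (1 + m)) ltac:(lia)) as [L4 L5]; destruct (L (S m) ltac:(lia)) as [L6 L7].
    replace (16 * (t * s ^ 2) * X ^ 4 * N) with
      (t * s ^ 2 * (2 * X * (2 * X * (2 * X * (2 * X * N))))) by ring.
    apply Rmult_le_compat_l; [lra | ].
    assert (ST : forall u x y, 0 <= u <= X -> 0 <= x <= y -> 0 <= 2 * u * x <= 2 * X * y).
    { intros u x y Hu Hx; split; [apply Rmult_le_pos; lra | ].
      apply Rmult_le_compat; lra. }
    apply ST; [lra | ]; apply ST; [lra | ]; apply ST; [lra | ]; apply ST; lra.
  - intros p; rewrite E1, E2, E3, E4, !Cmult_assoc, <- !RtoC_mult; do 2 f_equal.
    unfold line, Pt; rewrite sin_0, cos_0, sin_PI2, cos_PI2, sin_shift, cos_shift, Hc.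
    fold s; field; lra.
Qed.

(** * The perturbed problem *)

(** [hist n] tabulates the values below [n]; [x0] only fills the empty table. Extensionality of
    [step] allows the table to be exchanged for the finished sequence. *)
Lemma strong_recursion {X : Type} (x0 : X) (step : nat -> (nat -> X) -> X) :
  (forall n h h', (forall i, (i < n)%nat -> h i = h' i) -> step n h = step n h') ->
  exists w, forall n, w n = step n w.
Proof.
  intros Hext.
  pose (hist := fix hist (n : nat) : nat -> X :=
    match n with
    | O => fun _ => x0
    | S n' => fun i => if (i =? n')%nat then step n' (hist n') else hist n' i
    end).
  assert (H : forall n i, (i < n)%nat -> hist n i = hist (S i) i).
  { induction n; intros i Hi; [lia | ].
    simpl hist at 1; destruct (Nat.eqb_spec i n) as [-> | Hne].
    - simpl; rewrite Nat.eqb_refl; reflexivity.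
    - apply IHn; lia. }
  exists (fun i => hist (S i) i); intros n.
  simpl hist at 1; rewrite Nat.eqb_refl.
  apply Hext; intros i Hi; apply H; auto.
Qed.

Lemma rep_exists r fs N :
  (forall m, hom m (fs m) (N m)) -> rad r N -> exists f, rep r fs f.
Proof.
  intros H1 H2.
  assert (H : forall p, exists l, disk r p -> cser (fun m => fs m p) l).
  { intros p; destruct (classic (disk r p)) as [Hp | Hp]; [ | exists (RtoC 0); contradiction].
    destruct (ex_cser_abs (fun m => fs m p) (fun m => N m * Cmod p ^ m)) as [l Hl].
    - intros; apply Cmod_hom; auto.
    - eapply rad_series_disk; eauto.
    - exists l; auto. }
  exists (fun p => proj1_sig (constructive_indefinite_description _ (H p))).
  exists N; split; [ | split]; auto.
  intros p; exact (proj2_sig (constructive_indefinite_description _ (H p))).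
Qed.

(** Reduces identities between functions on the disk to identities between polynomials, degree by
    degree. *)
Lemma rep_value_unique r fs gs f g p :
  rep r fs f -> rep r gs g -> (forall m q, fs m q = gs m q) -> disk r p -> f p = g p.
Proof.
  intros [N [_ [_ H1]]] [M [_ [_ H2]]] E Hp.
  apply (cser_unique (fun m => fs m p)); auto.
  apply (cser_ext (fun m => gs m p)); auto.
Qed.

(** Additivity rests on differentiability, which the representations of [f] and [g] supply. *)
Lemma rep_bilap_plus r fs gs f g p :
  rep r fs f -> rep r gs g -> disk r p ->
  bilap (fun q => Cplus (f q) (g q)) p = Cplus (bilap f p) (bilap g p).
Proof.
  intros Hf Hg Hp.
  apply (rep_value_unique r _ _ _ _ p (rep_bilap _ _ _ (rep_plus _ _ _ _ _ Hf Hg))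
    (rep_plus _ _ _ _ _ (rep_bilap _ _ _ Hf) (rep_bilap _ _ _ Hg))); auto.
  intros m q; destruct Hf as [N [H1 _]], Hg as [M [H2 _]].
  rewrite (bilap_plus m _ _ _ _ (H1 (4 + m)%nat) (H2 (4 + m)%nat)); reflexivity.
Qed.

Lemma cser_scal c a l : cser a l -> cser (fun m => Cmult c (a m)) (Cmult c l).
Proof.
  intros [H1 H2]; split; simpl.
  - apply (is_series_minus (fun m => fst c * fst (a m)) (fun m => snd c * snd (a m)));
      apply (is_series_scal_l (K := R_AbsRing) (V := R_NormedModule)); auto.
  - apply (is_series_plus (fun m => fst c * snd (a m)) (fun m => snd c * fst (a m)));
      apply (is_series_scal_l (K := R_AbsRing) (V := R_NormedModule)); auto.
Qed.

Lemma hom_Pt t : exists N, hom 4 (fun p => RtoC (Pt t p)) N.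
Proof.
  eexists.
  apply (hom_ext _ (fun p => Cmult (Cmult (Cmult (fst p) (snd p))
    (Cminus (fst p) (Cmult t (snd p)))) (Cminus (fst p) (Cmult (/ t)%R (snd p))))).
  - apply (hom_mul 3 1).
    + apply (hom_mul 2 1).
      * apply (hom_mul 1 1); [apply hom_fst | apply hom_snd].
      * apply hom_minus; [apply hom_fst | apply hom_scal, hom_snd].
    + apply hom_minus; [apply hom_fst | apply hom_scal, hom_snd].
  - intros p; unfold Pt; rewrite <- !RtoC_mult, <- !RtoC_minus, <- !RtoC_mult.
    f_equal; unfold Rdiv; ring.
Qed.

(** Multiplication by the quartic raises the degree by 4. The zeros in degrees below 4 start the
    induction for uniqueness. *)
Definition Pt_parts (t : R) (qs : nat -> pt -> C) (m : nat) (p : pt) : C :=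
  match m with
  | S (S (S (S k))) => Cmult (RtoC (Pt t p)) (qs k p)
  | _ => RtoC 0
  end.

Lemma rep_Pt_mul t r qs q :
  rep r qs q -> rep r (Pt_parts t qs) (fun p => Cmult (RtoC (Pt t p)) (q p)).
Proof.
  intros [N [H1 [[H2 H2'] H3]]]; destruct (hom_Pt t) as [M HM].
  assert (HM0 := hom_nonneg _ _ _ HM).
  exists (fun m => match m with S (S (S (S k))) => M * N k | _ => 0 end).
  split; [ | split].
  - intros [ | [ | [ | [ | k]]]]; try apply hom_0.
    apply (hom_mul 4 k); auto.
  - split.
    + intros [ | [ | [ | [ | k]]]]; try lra; apply Rmult_le_pos; auto.
    + intros rho Hr Hlt; destruct (H2' rho Hr Hlt) as [B HB].
      assert (HB0 : 0 <= B).
      { specialize (HB 0%nat); specialize (H2 0%nat); simpl in HB; lra. }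
      assert (Hr4 : 0 <= rho ^ 4) by (apply pow_le; auto).
      exists (M * rho ^ 4 * B); intros m.
      assert (X : 0 <= M * rho ^ 4 * B) by (apply Rmult_le_pos; auto; apply Rmult_le_pos; auto).
      destruct m as [ | [ | [ | [ | k]]]]; try (rewrite Rmult_0_l; auto).
      replace (M * N k * rho ^ S (S (S (S k)))) with (M * rho ^ 4 * (N k * rho ^ k))
        by (simpl; ring).
      apply Rmult_le_compat_l; auto; apply Rmult_le_pos; auto.
  - intros p Hp; destruct (cser_scal (RtoC (Pt t p)) _ _ (H3 p Hp)) as [A B].
    split; do 4 (apply is_series_prepend_0; [reflexivity | ]); assumption.
Qed.

(** * Solution and uniqueness of the perturbed problem *)

Section Goursat.

Variables (t beta kap : R).
Let al := PI / 4 - PI * beta.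
Hypothesis t_pos : 0 < t.
Hypothesis sin_pos : 0 < sin (PI * beta).
Hypothesis cos_t : cos (PI * beta) = t * sin (PI * beta).
Hypothesis sin_2al : sin (2 * al) <> 0.
Hypothesis kap_pos : 0 < kap.
Hypothesis dets : forall N, (4 <= N)%nat ->
  kap / INR N <= Rabs (det_even al N) /\ kap / INR N <= Rabs (det_odd al N).

Lemma Pt_nodes psi :
  psi = PI / 4 \/ psi = - (PI / 4) \/ psi = al \/ psi = - al -> Pt t (cis (PI / 4 + psi)) = 0.
Proof.
  unfold Pt, cis; simpl fst; simpl snd; intros [-> | [-> | [-> | ->]]].
  - replace (PI / 4 + PI / 4) with (PI / 2) by field; rewrite cos_PI2; ring.
  - replace (PI / 4 + - (PI / 4)) with 0 by ring; rewrite sin_0; ring.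
  - replace (PI / 4 + al) with (PI / 2 - PI * beta) by (unfold al; field).
    rewrite sin_shift, cos_shift, cos_t; field; lra.
  - replace (PI / 4 + - al) with (PI * beta) by (unfold al; ring).
    rewrite cos_t; ring.
Qed.

(** The part of degree [4 + m] satisfies Delta^2 d = - sum c_j d_(m-j), where only parts of degree
    at most [m] occur; these vanish by induction, and divisibility by [P_t] provides the nodes. *)
Lemma goursat_formal_unique r cs c ds d q :
  Rbar_lt 0 r -> rep r cs c -> rep r ds d -> inA r q ->
  (forall p, disk r p -> Cplus (bilap d p) (Cmult (c p) (d p)) = 0) ->
  (forall p, disk r p -> d p = Cmult (RtoC (Pt t p)) (q p)) ->
  forall p, disk r p -> d p = 0.
Proof.
  intros Hr Hc Hd Hq Heq HP.
  assert (HPP : forall m p, ds m p = Pt_parts t (taylor_hom q) m p).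
  { apply (rep_parts_unique r _ _ d Hd); auto.
    apply (rep_ext _ _ _ _ HP), rep_Pt_mul, inA_rep; auto. }
  assert (Hnull := rep_null_parts r _ _
    (rep_plus _ _ _ _ _ (rep_bilap _ _ _ Hd) (rep_mult _ _ _ _ _ Hc Hd)) Hr Heq).
  assert (Z : forall n p, ds n p = 0).
  { intros n; induction n as [n IH] using (well_founded_induction lt_wf); intros p.
    destruct (Nat.lt_ge_cases n 4) as [Hn | Hn].
    - rewrite HPP; destruct n as [ | [ | [ | [ | n]]]]; try reflexivity; lia.
    - assert (En : exists m, n = (4 + m)%nat) by (exists (n - 4)%nat; lia).
      destruct En as [m ->]; destruct Hd as [N [H1 _]].
      apply (hom_goursat_unique al kap kap_pos dets m _ _ (H1 (4 + m)%nat)).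
      + intros p'; assert (E := Hnull m p'); cbv beta in E.
        unfold conv in E; rewrite (csum_zero (S m)) in E.
        * rewrite <- E; ring.
        * intros j Hj; rewrite IH by lia; ring.
      + intros psi Hpsi; rewrite HPP; simpl Pt_parts; rewrite Pt_nodes; auto; ring. }
  intros p Hp; apply (rep_value_unique r _ _ _ (fun _ => RtoC 0) p Hd (rep_0 r)); auto.
Qed.

(** The recursion needs a total choice function. The bound [nu] is among its arguments because the
    polynomial chosen must respect that bound. *)
Lemma hom_solver : exists Sol : nat -> (pt -> C) -> R -> pt -> C,
  forall m h nu, hom m h nu ->
    hom (4 + m) (Sol m h nu) ((1 + 8 / kap) * nu) /\
    (forall p, bilap (Sol m h nu) p = h p) /\ nodes al (Sol m h nu).
Proof.
  assert (H : forall (m : nat) (h : pt -> C) (nu : R), exists u, hom m h nu ->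
    hom (4 + m) u ((1 + 8 / kap) * nu) /\ (forall p, bilap u p = h p) /\ nodes al u).
  { intros m h nu; destruct (classic (hom m h nu)) as [Hh | Hh].
    - destruct (hom_goursat_solution al kap kap_pos dets m h nu Hh) as [u Hu]; exists u; auto.
    - exists (fun _ => RtoC 0); contradiction. }
  exists (fun m h nu => proj1_sig (constructive_indefinite_description _ (H m h nu))).
  intros m h nu; exact (proj2_sig (constructive_indefinite_description _ (H m h nu))).
Qed.

(** The recursion produces each part together with its norm bound. The bounds thus satisfy an exact
    scalar recursion, whose growth can be studied without the polynomials. *)
Lemma goursat_formal_solution (cs Fs : nat -> pt -> C) Nc NF :
  (forall m, hom m (cs m) (Nc m)) -> (forall m, hom m (Fs m) (NF m)) ->
  exists (ws : nat -> pt -> C) (Nw : nat -> R),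
    (forall m, hom m (ws m) (Nw m)) /\
    (forall m, (m < 4)%nat -> Nw m = 0 /\ forall p, ws m p = 0) /\
    (forall m, Nw (4 + m)%nat =
       (1 + 8 / kap) * (NF m + rsum (S m) (fun j => Nc j * Nw (m - j)%nat))) /\
    (forall m p, bilap (ws (4 + m)%nat) p = Cminus (Fs m p) (conv cs ws m p)) /\
    (forall m, nodes al (ws (4 + m)%nat)).
Proof.
  intros Hc HF; destruct hom_solver as [Sol HSol].
  pose (H := fun m (hist : nat -> (pt -> C) * R) (p : pt) =>
    Cminus (Fs m p) (conv cs (fun j => fst (hist j)) m p)).
  pose (nu := fun m (hist : nat -> (pt -> C) * R) =>
    NF m + rsum (S m) (fun j => Nc j * snd (hist (m - j)%nat))).
  pose (step := fun n (hist : nat -> (pt -> C) * R) =>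
    match n with
    | S (S (S (S m))) => (Sol m (H m hist) (nu m hist), (1 + 8 / kap) * nu m hist)
    | _ => (fun _ : pt => RtoC 0, 0)
    end).
  destruct (strong_recursion (fun _ : pt => RtoC 0, 0) step) as [w Hw].
  { intros n h h' E; unfold step; destruct n as [ | [ | [ | [ | m]]]]; auto.
    assert (E1 : H m h = H m h').
    { apply functional_extensionality; intros p; unfold H, conv; f_equal.
      apply csum_ext; intros j Hj; rewrite E by lia; reflexivity. }
    assert (E2 : nu m h = nu m h').
    { unfold nu; f_equal; apply rsum_ext; intros j Hj; rewrite E by lia; reflexivity. }
    rewrite E1, E2; reflexivity. }
  assert (Hlow : forall n, (n < 4)%nat -> w n = (fun _ => RtoC 0, 0)).
  { intros n Hn; rewrite Hw; destruct n as [ | [ | [ | [ | n]]]]; try reflexivity; lia. }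
  assert (Hhi : forall m, w (4 + m)%nat = (Sol m (H m w) (nu m w), (1 + 8 / kap) * nu m w)).
  { intros m; rewrite Hw; reflexivity. }
  assert (Hhom : forall n, hom n (fst (w n)) (snd (w n))).
  { intros n; induction n as [n IH] using (well_founded_induction lt_wf).
    destruct (Nat.lt_ge_cases n 4) as [Hn | Hn]; [rewrite Hlow by auto; apply hom_0 | ].
    assert (En : exists m, n = (4 + m)%nat) by (exists (n - 4)%nat; lia).
    destruct En as [m ->]; rewrite Hhi; simpl fst; simpl snd.
    apply HSol, hom_minus; auto.
    apply (hom_conv cs (fun j => fst (w j)) Nc (fun j => snd (w j))); auto.
    intros j Hj; apply IH; lia. }
  assert (Hsol : forall m, hom m (H m w) (nu m w)).
  { intros m; apply hom_minus; auto.
    apply (hom_conv cs (fun j => fst (w j)) Nc (fun j => snd (w j))); auto. }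
  exists (fun n => fst (w n)), (fun n => snd (w n)).
  split; [exact Hhom | split; [ | split; [ | split]]].
  - intros m Hm; rewrite Hlow by auto; split; auto.
  - intros m; rewrite Hhi; reflexivity.
  - intros m p; rewrite Hhi; apply (HSol m (H m w) (nu m w)), Hsol.
  - intros m; rewrite Hhi; apply (HSol m (H m w) (nu m w)), Hsol.
Qed.

Lemma goursat_rad (r : R) Nc NF Nw C0 :
  (forall m, 0 <= Nc m) -> (forall m, 0 <= Nw m) -> rad r NF ->
  (forall m, rsum (S m) (fun j => Nc j * r ^ j) <= C0) ->
  (1 + 8 / kap) * r ^ 4 * C0 <= 1 / 2 ->
  (forall m, (m < 4)%nat -> Nw m = 0) ->
  (forall m, Nw (4 + m)%nat =
     (1 + 8 / kap) * (NF m + rsum (S m) (fun j => Nc j * Nw (m - j)%nat))) ->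
  rad r Nw.
Proof.
  intros HNc HNw [HF0 HF] HC Hsmall Hlow Hrec; split; auto.
  intros rho Hr Hlt; simpl in Hlt.
  destruct (HF rho Hr Hlt) as [MF HMF].
  assert (HMF0 : 0 <= MF).
  { specialize (HMF 0%nat); specialize (HF0 0%nat); simpl in HMF; lra. }
  set (K := 1 + 8 / kap) in *.
  assert (HK : 0 < K) by (unfold K; assert (0 < 8 / kap) by (apply Rdiv_lt_0_compat; lra); lra).
  assert (Hr4 : 0 <= rho ^ 4 <= r ^ 4) by (split; [apply pow_le; auto | apply pow_incr; lra]).
  assert (HC0 : 0 <= C0).
  { eapply Rle_trans; [ | apply (HC 0%nat)]; simpl; specialize (HNc 0%nat); lra. }
  (* Chosen so that the source term contributes at most K rho^4 MF = M / 2; the convolution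
     contributes at most K rho^4 C0 M, which is again at most M / 2. *)
  pose (M := 2 * K * rho ^ 4 * MF).
  assert (HM : 0 <= M) by (unfold M; repeat apply Rmult_le_pos; lra).
  exists M; intros n; induction n as [n IH] using (well_founded_induction lt_wf).
  destruct (Nat.lt_ge_cases n 4) as [Hn | Hn]; [rewrite Hlow by auto; lra | ].
  assert (En : exists m, n = (4 + m)%nat) by (exists (n - 4)%nat; lia).
  destruct En as [m ->]; rewrite Hrec, pow_add.
  assert (B : rsum (S m) (fun j => Nc j * Nw (m - j)%nat) * rho ^ m <= C0 * M).
  { apply Rle_trans with (rsum (S m) (fun j => Nc j * r ^ j) * M).
    - rewrite (Rmult_comm _ (rho ^ m)), (Rmult_comm _ M), <- !rsum_scal.
      apply rsum_le; intros j Hj.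
      replace (rho ^ m) with (rho ^ j * rho ^ (m - j)) by (rewrite <- pow_add; f_equal; lia).
      replace (rho ^ j * rho ^ (m - j) * (Nc j * Nw (m - j)%nat))
        with ((Nw (m - j)%nat * rho ^ (m - j)) * (Nc j * rho ^ j)) by ring.
      apply Rmult_le_compat.
      + apply Rmult_le_pos; auto; apply pow_le; auto.
      + apply Rmult_le_pos; auto; apply pow_le; auto.
      + apply IH; lia.
      + apply Rmult_le_compat_l; auto; apply pow_incr; lra.
    - apply Rmult_le_compat_r; auto. }
  replace (K * (NF m + rsum (S m) (fun j => Nc j * Nw (m - j)%nat)) * (rho ^ 4 * rho ^ m))
    with (K * rho ^ 4 * (NF m * rho ^ m + rsum (S m) (fun j => Nc j * Nw (m - j)%nat) * rho ^ m)) by ring.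
  apply Rle_trans with (K * rho ^ 4 * (MF + C0 * M)).
  - apply Rmult_le_compat_l; [apply Rmult_le_pos; lra | ].
    specialize (HMF m); lra.
  - assert (K * rho ^ 4 * C0 <= 1 / 2).
    { eapply Rle_trans; [ | apply Hsmall]; apply Rmult_le_compat_r; auto.
      apply Rmult_le_compat_l; lra. }
    replace (K * rho ^ 4 * (MF + C0 * M)) with (M / 2 + K * rho ^ 4 * C0 * M) by (unfold M; field).
    nra.
Qed.

(** The quartic factor is dominated by four linear ones, absorbed one at a time; the index shift by
    4 follows. *)
Lemma rad_quartic r N :
  rad r N -> rad r (fun m => 16 * (t * sin (PI * beta) ^ 2) * INR (4 + m) ^ 4 * N (4 + m)%nat).
Proof.
  intros H.
  assert (Hc : 0 <= 16 * (t * sin (PI * beta) ^ 2)).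
  { apply Rmult_le_pos; [lra | ]; apply Rmult_le_pos; [lra | ]; apply pow_le; lra. }
  apply (rad_le _ (fun m => 16 * (t * sin (PI * beta) ^ 2) *
    ((INR (4 + m) + 1) * ((INR (4 + m) + 1) * ((INR (4 + m) + 1) * ((INR (4 + m) + 1) * N (4 + m)%nat)))))).
  - intros m; assert (X := pos_INR (4 + m)); assert (Y := proj1 H (4 + m)%nat).
    set (x := INR (4 + m)) in *; set (y := N (4 + m)%nat) in *.
    assert (P : 0 <= x ^ 4 <= (x + 1) ^ 4) by (split; [apply pow_le; auto | apply pow_incr; lra]).
    rewrite Rmult_assoc; split.
    + apply Rmult_le_pos; auto; apply Rmult_le_pos; lra.
    + apply Rmult_le_compat_l; auto.
      replace ((x + 1) * ((x + 1) * ((x + 1) * ((x + 1) * y)))) with ((x + 1) ^ 4 * y) by ring.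
      apply Rmult_le_compat_r; lra.
  - apply rad_scal; auto.
    apply (rad_shift _ (fun m => (INR (3 + m) + 1) * ((INR (3 + m) + 1) * ((INR (3 + m) + 1) * ((INR (3 + m) + 1) * N (3 + m)%nat))))).
    apply (rad_shift _ (fun m => (INR (2 + m) + 1) * ((INR (2 + m) + 1) * ((INR (2 + m) + 1) * ((INR (2 + m) + 1) * N (2 + m)%nat))))).
    apply (rad_shift _ (fun m => (INR (1 + m) + 1) * ((INR (1 + m) + 1) * ((INR (1 + m) + 1) * ((INR (1 + m) + 1) * N (1 + m)%nat))))).
    apply (rad_shift _ (fun m => (INR m + 1) * ((INR m + 1) * ((INR m + 1) * ((INR m + 1) * N m))))).
    do 4 apply rad_lin; auto.
Qed.

Lemma goursat_solution (r : R) cs c Nc fs f gs g C0 :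
  0 < r ->
  (forall m, hom m (cs m) (Nc m)) ->
  (forall m, rsum (S m) (fun j => Nc j * r ^ j) <= C0) ->
  (1 + 8 / kap) * r ^ 4 * C0 <= 1 / 2 ->
  rep r cs c -> rep r fs f -> rep r gs g ->
  exists us u, rep r us u /\ goursat t r c f g u.
Proof.
  intros Hr HNc HC Hsmall Hc Hf Hg.
  assert (Hr' : Rbar_lt 0 r) by exact Hr.
  pose (F := fun p => Cminus (Cminus (f p) (bilap g p)) (Cmult (c p) (g p))).
  assert (HF := rep_minus _ _ _ _ _ (rep_minus _ _ _ _ _ Hf (rep_bilap _ _ _ Hg))
    (rep_mult _ _ _ _ _ Hc Hg)).
  fold F in HF; set (Fs := fun m p => Cminus (Cminus (fs m p) (bilap (gs (4 + m)%nat) p)) (conv cs gs m p)) in HF.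
  assert (HF' := HF); destruct HF' as [NF [F1 [F2 _]]].
  destruct (goursat_formal_solution cs Fs Nc NF HNc F1)
    as [ws [Nw [W1 [W2 [W3 [W4 W5]]]]]].
  assert (Wrad : rad r Nw).
  { apply (goursat_rad r Nc NF Nw C0); auto.
    - intros m; eapply hom_nonneg; eauto.
    - intros m; eapply hom_nonneg; eauto.
    - intros m Hm; apply W2; auto. }
  destruct (rep_exists r ws Nw W1 Wrad) as [W HW].
  assert (Hq : forall m, exists q, hom m q (16 * (t * sin (PI * beta) ^ 2) * INR (4 + m) ^ 4 * Nw (4 + m)%nat) /\
    forall p, ws (4 + m)%nat p = Cmult (RtoC (Pt t p)) (q p)).
  { intros m; apply hom_div_Pt; auto; apply W5. }
  pose (qs := fun m => proj1_sig (constructive_indefinite_description _ (Hq m))).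
  assert (Hqs : forall m, hom m (qs m) (16 * (t * sin (PI * beta) ^ 2) * INR (4 + m) ^ 4 * Nw (4 + m)%nat) /\
    forall p, ws (4 + m)%nat p = Cmult (RtoC (Pt t p)) (qs m p)).
  { intros m; exact (proj2_sig (constructive_indefinite_description _ (Hq m))). }
  destruct (rep_exists r qs _ (fun m => proj1 (Hqs m)) (rad_quartic r Nw Wrad)) as [Q HQ].
  exists (fun m p => Cplus (gs m p) (ws m p)), (fun p => Cplus (g p) (W p)).
  split; [apply rep_plus; auto | split].
  - intros p Hp.
    rewrite (rep_bilap_plus _ _ _ _ _ p Hg HW Hp).
    (* Compared degree by degree, this is the recursion [W4]. *)
    assert (E : bilap W p = Cminus (F p) (Cmult (c p) (W p))).
    { apply (rep_value_unique r _ _ (bilap W) (fun p => Cminus (F p) (Cmult (c p) (W p))) p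
        (rep_bilap _ _ _ HW) (rep_minus _ _ _ _ _ HF (rep_mult _ _ _ _ _ Hc HW))); auto. }
    rewrite E; unfold F; ring.
  - exists Q; split; [eapply rep_inA; eauto | ].
    intros p Hp.
    transitivity (W p); [ring | ].
    apply (rep_value_unique r _ _ W (fun p => Cmult (RtoC (Pt t p)) (Q p)) p HW (rep_Pt_mul t _ _ _ HQ)); auto.
    intros m q; destruct (Nat.lt_ge_cases m 4) as [Hm | Hm].
    + rewrite (proj2 (W2 m Hm)).
      destruct m as [ | [ | [ | [ | m]]]]; try reflexivity; lia.
    + destruct m as [ | [ | [ | [ | m]]]]; try lia; apply (proj2 (Hqs m)).
Qed.

End Goursat.

(** * The angle beta and the choice of the radius *)

Lemma beta_tangent t beta :
  0 < t -> 0 < beta < 1 ->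
  Cdiv (Cplus (RtoC t) Ci) (Cminus (RtoC t) Ci) = (cos (2 * PI * beta), sin (2 * PI * beta)) ->
  0 < sin (PI * beta) /\ cos (PI * beta) = t * sin (PI * beta).
Proof.
  intros Ht Hb H.
  assert (HPI := PI_RGT_0).
  assert (Hs : 0 < sin (PI * beta)) by (apply sin_gt_0; nra).
  split; auto.
  assert (Hd : Cminus (RtoC t) Ci <> 0).
  { intros E; apply (f_equal fst) in E; simpl in E; lra. }
  assert (E : Cplus (RtoC t) Ci = Cmult (cos (2 * PI * beta), sin (2 * PI * beta)) (Cminus (RtoC t) Ci)).
  { rewrite <- H; field; auto. }
  (* Real parts give t = t cos (2 PI beta) + sin (2 PI beta); the double angle formulas turn this
     into t s^2 = s cos (PI beta) with s = sin (PI beta), and s > 0 cancels. *)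
  apply (f_equal fst) in E; simpl in E.
  replace (2 * PI * beta) with (2 * (PI * beta)) in E by ring.
  rewrite cos_2a_sin, sin_2a in E.
  apply (Rmult_eq_reg_l (sin (PI * beta))); [ | lra]; lra.
Qed.

Theorem theorem6p1 :
  forall (t : R), 0 < t ->
  forall (beta : R), 0 < beta < 1 ->
  Cdiv (Cplus (RtoC t) Ci) (Cminus (RtoC t) Ci)
    = (cos (2 * PI * beta), sin (2 * PI * beta)) ->
  (exists Cst : R, 0 < Cst /\
     forall n m : Z, m <> 0%Z ->
       Rabs (beta - IZR n / IZR m) >= Cst / (IZR m) ^ 2) ->
  forall (Rr : Rbar), Rbar_lt (Finite 0) Rr ->
  forall c : pt -> C, inA Rr c ->
  exists r : Rbar, Rbar_lt (Finite 0) r /\ Rbar_le r Rr /\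
    forall f g : pt -> C, inA Rr f -> inA Rr g ->
      exists u : pt -> C, inA r u /\ goursat t r c f g u /\
        forall v : pt -> C, inA r v -> goursat t r c f g v ->
          forall p, disk r p -> v p = u p.
Proof.
  intros t Ht beta Hb Hbeta [Cst [HCst Hdio]] Rr HRr c Hc.
  destruct (beta_tangent t beta Ht Hb Hbeta) as [Hsin Hcos].
  set (al := PI / 4 - PI * beta).
  assert (Hal : forall l, (1 <= l)%nat -> Cst / 4 / INR l <= Rabs (sin (4 * INR l * al))).
  { intros l Hl; eapply Rle_trans; [apply (badly_approximable_sin beta Cst Hdio l Hl) | ].
    (* The shift by l PI leaves the modulus of the sine unchanged. *)
    replace (4 * INR l * al) with (- (PI * (4 * INR l * beta)) + IZR (Z.of_nat l) * PI)
      by (rewrite <- INR_IZR_INZ; unfold al; field).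
    rewrite Rabs_sin_plus_IZR_PI, sin_neg, Rabs_Ropp; apply Rle_refl. }
  assert (Hk0 : 0 < Cst / 4) by lra.
  assert (Hdets := dets_bound al (Cst / 4) Hk0 Hal).
  set (kap := (Cst / 4) ^ 2 / 4) in Hdets.
  assert (Hkap : 0 < kap) by (unfold kap; apply Rdiv_lt_0_compat; [apply pow_lt | ]; lra).
  (* The Diophantine bound at l = 1 excludes beta = 1/4, that is t = 1, where the two oblique lines
     of [P_t] coincide. *)
  assert (H2al : sin (2 * al) <> 0).
  { intros E; assert (X := Hal 1%nat (le_n 1)); simpl INR in X.
    replace (4 * 1 * al) with (2 * (2 * al)) in X by ring.
    rewrite sin_2a, E, Rmult_0_r, Rmult_0_l, Rabs_R0 in X; lra. }
  set (K := 1 + 8 / kap).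
  assert (HK : 0 < K) by (unfold K; assert (0 < 8 / kap) by (apply Rdiv_lt_0_compat; lra); lra).
  assert (Rc := inA_rep _ _ Hc); assert (Rc' := Rc); destruct Rc' as [Nc [HNc [Radc _]]].
  destruct (Rbar_lt_between _ _ HRr) as [rho0 [Hrho0 Hrho0']].
  assert (Hex := rad_series _ _ _ Radc (Rlt_le _ _ Hrho0) Hrho0').
  set (C0 := Series (fun m => Nc m * rho0 ^ m)).
  assert (Hpart : forall m, rsum (S m) (fun j => Nc j * rho0 ^ j) <= C0).
  { intros m; rewrite <- rsum_sum_n.
    apply (is_lim_seq_incr_compare (sum_n (fun j => Nc j * rho0 ^ j)) C0).
    - apply (Series_correct _ Hex).
    - intros n; rewrite sum_Sn; unfold plus; simpl.
      assert (0 <= Nc (S n) * rho0 ^ S n)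
        by (apply Rmult_le_pos; [apply (proj1 Radc) | apply pow_le; lra]).
      simpl in *; lra. }
  assert (HC0 : 0 <= C0).
  { eapply Rle_trans; [ | apply (Hpart 0%nat)]; simpl; assert (X := proj1 Radc 0%nat); lra. }
  assert (Hr1 : 0 < 1 / (2 * K * (C0 + 1))).
  { apply Rdiv_lt_0_compat; [lra | ]; apply Rmult_lt_0_compat; lra. }
  (* [rho0] keeps the coefficient sum of [c] bounded by [C0], the bound 1 gives r^4 <= r, and the
     last entry gives the smallness; [C0 + 1] avoids division by 0 when [c] is zero. Neither [f] nor
     [g] enters. *)
  set (r := Rmin rho0 (Rmin 1 (1 / (2 * K * (C0 + 1))))).
  assert (Hr : 0 < r) by (repeat apply Rmin_pos; lra).
  assert (Hrr0 : r <= rho0) by apply Rmin_l.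
  assert (Hr_1 : r <= 1) by (eapply Rle_trans; [apply Rmin_r | apply Rmin_l]).
  assert (Hr_K : r <= 1 / (2 * K * (C0 + 1))) by (eapply Rle_trans; [apply Rmin_r | apply Rmin_r]).
  assert (HrR : Rbar_le r Rr).
  { apply Rbar_lt_le; eapply Rbar_le_lt_trans; [ | apply Hrho0']; exact Hrr0. }
  assert (Hpart_r : forall m, rsum (S m) (fun j => Nc j * r ^ j) <= C0).
  { intros m; eapply Rle_trans; [ | apply (Hpart m)]; apply rsum_le; intros j Hj.
    apply Rmult_le_compat_l; [apply (proj1 Radc) | apply pow_incr; lra]. }
  assert (Hsmall : K * r ^ 4 * C0 <= 1 / 2).
  { assert (r ^ 4 <= r).
    { replace (r ^ 4) with (r * r ^ 3) by ring.
      assert (r ^ 3 <= 1 ^ 3) by (apply pow_incr; lra).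
      rewrite pow1 in H; nra. }
    apply Rle_trans with (K * (1 / (2 * K * (C0 + 1))) * (C0 + 1)).
    - apply Rmult_le_compat; [ | lra | | lra].
      + apply Rmult_le_pos; [lra | apply pow_le; lra].
      + apply Rmult_le_compat_l; lra.
    - right; field; lra. }
  exists (Finite r); split; [exact Hr | split; [exact HrR | ]].
  intros f g Hf Hg.
  assert (Rc1 := rep_mono _ _ _ _ HrR Rc).
  destruct (goursat_solution t beta kap Ht Hsin Hcos H2al Hkap Hdets r _ c Nc _ f _ g C0
    Hr HNc Hpart_r Hsmall Rc1 (rep_mono _ _ _ _ HrR (inA_rep _ _ Hf))
    (rep_mono _ _ _ _ HrR (inA_rep _ _ Hg))) as [us [u [Hu Hgu]]].
  exists u; split; [eapply rep_inA; eauto; exact Hr | split; [exact Hgu | ]].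
  intros v Hv [Hv1 [qv [Hqv Hv2]]] p Hp; destruct Hgu as [Hu1 [qu [Hqu Hu2]]].
  assert (Rv := inA_rep _ _ Hv).
  assert (Rd := rep_minus _ _ _ _ _ Rv Hu).
  assert (Hd0 : Cminus (v p) (u p) = 0).
  { apply (goursat_formal_unique t beta kap Ht Hcos Hkap Hdets r _ c _ (fun p => Cminus (v p) (u p))
      (fun p => Cminus (qv p) (qu p)) Hr Rc1 Rd); auto.
    - eapply rep_inA; [exact Hr | apply (rep_minus _ _ _ _ _ (inA_rep _ _ Hqv) (inA_rep _ _ Hqu))].
    - intros q Hq.
      assert (E : bilap v q = Cplus (bilap u q) (bilap (fun p => Cminus (v p) (u p)) q)).
      (* Additivity is applied to v = u + (v - u). *)
      { transitivity (bilap (fun q0 => Cplus (u q0) (Cminus (v q0) (u q0))) q).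
        - apply (f_equal (fun h => bilap h q)), functional_extensionality; intros; ring.
        - apply (rep_bilap_plus _ _ _ u (fun p => Cminus (v p) (u p)) q Hu Rd Hq). }
      assert (E1 := Hv1 q Hq); assert (E2 := Hu1 q Hq).
      transitivity (Cminus (Cplus (bilap v q) (Cmult (c q) (v q))) (Cplus (bilap u q) (Cmult (c q) (u q)))).
      + rewrite E; ring.
      + rewrite E1, E2; ring.
    - intros q Hq; transitivity (Cminus (Cminus (v q) (g q)) (Cminus (u q) (g q))); [ring | ].
      rewrite (Hv2 q Hq), (Hu2 q Hq); ring. }
  transitivity (Cplus (Cminus (v p) (u p)) (u p)); [ring | rewrite Hd0; ring].
Qed.
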